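(* Let $\psi:\mathbb{R}^2\to\mathbb{R}$ be Lipschitz and $\phi:\mathbb{R}^4\to\mathbb{R}$ be bounded and Lipschitz, and let $T>0$. Let $\{N_n\}_{n\in\mathbb{N}}$ be a sequence of finite networks (with edge marks in $\mathbb{R}_+$ and vertex marks in $\mathbb{R}\times\mathbb{R}$), where $N_n$ has vertex set $[n]$. Assume: 1. $U(N_n)\to\nu$ weakly in $\mathcal{P}(\mathcal{N}^* )$ for some $\nu\in\mathcal{P}(\mathcal{N}^* )$. 2. $\nu$ is supported on nice rooted networks, i.e. $\nu(\mathcal{B}^* )=1$. 3. $\max_{v\in[n]}d_v^{N_n}=n^{\epsilon_n}$ where $\epsilon_n\to0$ as $n\to+\infty$. Then the empirical measures over particle trajectories $$L_n=\frac1n\sum_{v\in[n]}\delta_{\theta_v^{N_n}(\cdot)}\in\mathcal{P}(C([0,T];\mathbb{R}))$$ converge almost surely, in the weak topology of $\mathcal{P}(C([0,T];\mathbb{R}))$, to the law of $\theta_o^N(\cdot)$, where $(N,o)$ is sampled from $\nu$.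
   Context: Graphs $G=(V,E)$ are undirected, locally finite, with finite or countable vertex set (which may be taken as a subset of $\mathbb{N}$); loops are allowed; $d_v$ denotes the degree and $[n]=\{1,\dots,n\}$. A network $N=(G,\boldsymbol{\mu},\boldsymbol{\omega},\boldsymbol{\theta}(0))$ is a graph $G=(V,E)$ with edge weights $\mu_e\in\mathbb{R}_+=(0,\infty)$ ($e\in E$), media variables $\omega_v\in\mathbb{R}$ and initial conditions $\theta_v(0)\in\mathbb{R}$ ($v\in V$). Put $\mu_{uv}=\mu_{vu}=\mu_e$ if $e=\{u,v\}\in E$, $\mu_{uv}=0$ otherwise, and $\mu_v=\sum_u\mu_{uv}$. Let $(B_v)_{v\in\mathbb{N}}$ be i.i.d. standard Brownian motions. The system of interacting diffusions on $N$ is the strong solution $\boldsymbol{\theta}^N(\cdot)=(\theta^N_v(\cdot))_{v\in V}$ on $[0,T]$ of $$\mathrm{d}\theta_{v}(t)= \frac{1}{\mu_v}\sum_{u \in V}\mu_{uv}\,\phi(\theta_{u}(t),\theta_{v}(t);\omega_v,\omega_u)\,\mathrm{d}t+\psi(\theta_{v}(t);\omega_v)\,\mathrm{d}t + \mathrm{d}B_v(t),\qquad v\in V,$$ with initial conditions $\theta_v(0)$ (the first term on the right is $0$ if $\mu_v=0$). It exists and is unique for every $N$ with $(N,o)$ nice (defined below), in particular for finite $N$. The law of $\theta^N_o(\cdot)$ when $(N,o)$ is sampled from $\nu$ is the mixture over $\nu$ of the laws (with respect to the Brownian motions) of $\theta^N_o(\cdot)$. The almost sure statement is with respect to the Brownian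 motions. $\mathcal{N}^*$ is the set of rooted-isomorphism classes of rooted connected networks $(N,o)$ with edge marks in $\mathbb{R}_+$ and vertex marks in $\mathbb{R}\times\mathbb{R}$ (with a product metric on vertex marks and the usual distance on edge marks). A rooted isomorphism is a bijection of vertices preserving edges, marks and the root. $(N,o)_r$ is the rooted network induced by the vertices within graph distance $r$ of $o$. For $r\in\{0,1,2,\dots\}$ and $\delta>0$, $(r,\delta)$ is good for $(N,o),(N',o')$ if there is a root-preserving graph isomorphism between $(N,o)_r$ and $(N',o')_r$ under which corresponding vertex marks and corresponding edge marks are at distance $<\delta$. The distance between $[N,o]$ and $[N',o']$ is $\inf\{\frac{1}{1+r}+\delta:(r,\delta)\text{ is good}\}$. $\mathcal{P}(\cdot)$ denotes Borel probability measures with the weak topology; $C([0,T];\mathbb{R})$ has the sup norm. For a finite network $N$ with vertex set $V$, $U(N)=\frac1{|V|}\sum_{v\in V}\delta_{[N(v),v]}$, where $N(v)$ is the network induced by the connected component of $v$. $(N,o)$, with underlying rooted graph $(G,o)$, is nice if (1) there is $a>0$ with $|\partial(G,o)_r|\le ae^{ar}$ for all $r\ge1$, where $\partial(G,o)_r$ is the set of vertices of the ball $(G,o)_r$ having a neighbor outside it; and (2) $0<\inf_e\mu_e$ and $\sup_e\mu_e<\infty$ (automatic if there are no edges). $\mathcal{B}^*\subset\mathcal{N}^*$ is the Borel set of nice rooted networks. *)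

(* Defs.v *)
From HB Require Import structures.
From mathcomp Require Import all_boot all_order all_algebra finmap generic_quotient.
From mathcomp Require Import all_classical all_reals all_analysis.

Set Implicit Arguments.
Unset Strict Implicit.
Unset Printing Implicit Defensive.
Import Order.TTheory GRing.Theory Num.Theory.
Import numFieldNormedType.Exports.

Local Open Scope classical_set_scope.
Local Open Scope ring_scope.
Local Open Scope quotient_scope.

Definition brack (n : nat) : set nat := [set v | (1 <= v <= n)%N].

(* [adj] is the edge relation of an undirected graph without multiple edges
   (loops allowed).  The values of [ewt] off the edges and of [media], [init]
   off [vset] are irrelevant. *)
Record network (R : realType) := Network {
  vset : set nat;
  adj : rel nat;
  adj_vset : forall u v, adj u v -> vset u;
  adj_sym : symmetric adj;
  adj_locfin : forall v, finite_set [set u | adj v u];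
  ewt : nat -> nat -> R;
  ewt_gt0 : forall u v, adj u v -> 0 < ewt u v;
  ewt_sym : forall u v, adj u v -> ewt u v = ewt v u;
  media : nat -> R;
  init : nat -> R }.

Section network_theory.
Context {R : realType}.
Implicit Types (N : network R) (u v o : nat) (r : nat).

Definition edge_mu N u v : R := if adj N u v then ewt N u v else 0.

Definition vertex_mu N v : R := \sum_(u \in vset N) edge_mu N u v.

(* A loop counts once. *)
Definition degree N v : nat := #|` fset_set [set u | adj N v u] |.

Definition max_degree N : nat := \max_(v <- fset_set (vset N)) degree N v.

Definition component N v : set nat :=
  [set u | exists2 p, path (adj N) v p & last v p = u].

(* vertices at graph distance at most [r] from [o] *)
Definition gball N o r : set nat :=
  [set v | exists p, [/\ path (adj N) o p, last o p = v & (size p <= r)%N]].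

Definition gbdry N o r : set nat :=
  [set v | gball N o r v /\ exists2 u, adj N v u & ~ gball N o r u].

Definition edge_weights N : set R :=
  [set x | exists u v, adj N u v /\ x = ewt N u v].

Definition nice N o : Prop :=
  (exists2 a : R, 0 < a & forall r, (1 <= r)%N ->
     #|` fset_set (gbdry N o r) |%:R <= a * expR (a * r%:R)) /\
  ((0 < ereal_inf [set x%:E | x in edge_weights N])%E /\
   (ereal_sup [set x%:E | x in edge_weights N] < +oo)%E).

End network_theory.

Section induced.
Context {R : realType} (N : network R) (W : set nat).

Let adjW : rel nat := fun u v => [&& adj N u v, u \in W & v \in W].

Let adjW_vset u v : adjW u v -> W u.
Proof. by case/and3P => _ /set_mem. Qed.

Let adjW_sym : symmetric adjW.
Proof. by move=> u v; rewrite /adjW adj_sym [(u \in W) && _]andbC. Qed.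

Let adjW_locfin v : finite_set [set u | adjW v u].
Proof. by apply: sub_finite_set (adj_locfin N v) => u /and3P[]. Qed.

Let ewtW_gt0 u v : adjW u v -> 0 < ewt N u v.
Proof. by case/and3P => /ewt_gt0. Qed.

Let ewtW_sym u v : adjW u v -> ewt N u v = ewt N v u.
Proof. by case/and3P => /ewt_sym. Qed.

Definition induced : network R :=
  Network adjW_vset adjW_sym adjW_locfin ewtW_gt0 ewtW_sym (media N) (init N).

End induced.

Record rooted (R : realType) := Rooted {
  rnet :> network R;
  root : nat;
  root_vset : vset rnet root;
  rooted_connected : forall u v, vset rnet u -> vset rnet v ->
    exists2 p, path (adj rnet) u p & last u p = v }.
Arguments root {R}.

HB.instance Definition _ (R : realType) := gen_eqMixin (rooted R).
HB.instance Definition _ (R : realType) := gen_choiceMixin (rooted R).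

Section rooted_iso.
Context {R : realType}.
Implicit Types x y z : rooted R.

Definition rooted_iso x y : Prop :=
  exists f : nat -> nat, [/\ set_bij (vset x) (vset y) f,
    f (root x) = root y,
    (forall u v, vset x u -> vset x v -> adj y (f u) (f v) = adj x u v),
    (forall v, vset x v -> media y (f v) = media x v /\ init y (f v) = init x v)
  & (forall u v, adj x u v -> ewt y (f u) (f v) = ewt x u v)].

(* [(r, delta)] is good for [x], [y]; vertex marks are compared in the max
   metric of [R * R]. *)
Definition good x y (r : nat) (delta : R) : Prop :=
  let Bx := gball x (root x) r in
  let By := gball y (root y) r in
  exists f : nat -> nat, [/\ set_bij Bx By f,
    f (root x) = root y,
    (forall u v, Bx u -> Bx v -> adj y (f u) (f v) = adj x u v),
    (forall v, Bx v -> `|media y (f v) - media x v| < delta /\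
                       `|init y (f v) - init x v| < delta)
  & (forall u v, Bx u -> Bx v -> adj x u v ->
       `|ewt y (f u) (f v) - ewt x u v| < delta)].

(* Extended-real valued: no pair is good when exactly one of the roots carries
   a loop. *)
Definition rdist x y : \bar R :=
  ereal_inf [set e | exists (r : nat) (delta : R),
    [/\ 0 < delta, good x y r delta & e = ((r.+1%:R)^-1 + delta)%:E]].

Lemma gball_vset x r v : gball x (root x) r v -> vset x v.
Proof.
case=> p [pp <- _]; elim/last_ind: p pp => [_|p u _].
  exact: root_vset.
by rewrite rcons_path last_rcons => /andP[_]; rewrite adj_sym => /adj_vset.
Qed.

Lemma gballS (N : network R) o r1 r2 :
  (r1 <= r2)%N -> gball N o r1 `<=` gball N o r2.
Proof. by move=> r12 v [p [? ? h]]; exists p; split=> //; exact: leq_trans r12. Qed.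

Lemma gball_root (N : network R) o r : gball N o r o.
Proof. by exists [::]. Qed.

Lemma gball_step (N : network R) o r u v :
  gball N o r u -> adj N u v -> gball N o r.+1 v.
Proof.
case=> p [pp <- sp] uv; exists (rcons p v).
by rewrite rcons_path pp uv last_rcons size_rcons.
Qed.

Lemma gballSE (N : network R) o r v :
  gball N o r.+1 v <-> v = o \/ exists2 u, gball N o r u & adj N u v.
Proof.
split=> [[p []]|[->|[u ou uv]]]; last 2 first.
- exact: gball_root.
- exact: gball_step uv.
elim/last_ind: p => [_ <-|p w _]; first by left.
rewrite rcons_path last_rcons size_rcons => /andP[pp pw] <- sp; right.
by exists (last o p) => //; exists p.
Qed.

Lemma gball0E (N : network R) o v : gball N o 0 v -> v = o.
Proof. by case=> -[|w p] [_ <- //]. Qed.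

Lemma gball_image (M N : network R) o o' r (f : nat -> nat) :
  f o = o' ->
  (forall u v, gball M o r u -> gball M o r v -> adj N (f u) (f v) = adj M u v) ->
  forall r' v, (r' <= r)%N -> gball M o r' v -> gball N o' r' (f v).
Proof.
move=> fo fE; elim=> [|r' ih] v r'r.
  by move=> /gball0E ->; rewrite fo; exact: gball_root.
move=> /[dup] Bv /gballSE[->|[u Bu uv]]; first by rewrite fo; exact: gball_root.
apply: (@gball_step _ _ _ (f u)); first by apply: ih => //; exact: ltnW.
rewrite fE//; last exact: gballS Bv.
by apply: gballS Bu; exact: ltnW.
Qed.

Lemma gball_preimage (M N : network R) o o' (D : set nat) r (f : nat -> nat) :
  f o = o' -> D o -> set_inj D f ->
  (forall u v, D u -> D v -> adj N (f u) (f v) = adj M u v) ->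
  (forall v, gball N o' r v -> exists2 u, D u & f u = v) ->
  forall k u, (k <= r)%N -> D u -> gball N o' k (f u) -> gball M o k u.
Proof.
move=> fo Do finj fE fsurj; elim=> [|k ih] u kr Du.
  by move=> /gball0E; rewrite -fo => /finj ->; rewrite ?inE//; exact: gball_root.
case/gballSE=> [|[w Bw wu]].
  by rewrite -fo => /finj ->; rewrite ?inE//; exact: gball_root.
have [w' Dw' w'E] := fsurj _ (gballS (ltnW kr) Bw).
apply: (@gball_step _ _ _ w'); last by rewrite -fE// w'E.
by apply: ih => //; [exact: ltnW|rewrite w'E].
Qed.

Lemma good_sym x y r d : good x y r d -> good y x r d.
Proof.
case=> f [[fsub finj fsurj] fr fE fv fe].
have /choice[g gP] : forall v, exists w, gball y (root y) r v ->
    gball x (root x) r w /\ f w = v.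
  move=> v.
  have [/fsurj[w]|] := pselect (gball y (root y) r v); last by exists 0%N.
  by exists w.
have gB v : gball y (root y) r v -> gball x (root x) r (g v) by case/gP.
have gK v : gball y (root y) r v -> f (g v) = v by case/gP.
exists g; split.
- split=> //.
  + by move=> u v /set_mem/gK{2}<- /set_mem/gK{2}<- ->.
  + move=> v Bv; exists (f v); first exact: fsub.
    by apply: finj; rewrite ?inE; [apply/gB/fsub| |apply/gK/fsub].
- have B0 := gball_root y (root y) r.
  apply: finj; rewrite ?inE ?gK ?fr//; [exact: gB|exact: gball_root].
- by move=> u v Bu Bv; rewrite -fE ?gK//; exact: gB.
- by move=> v Bv; rewrite distrC -{1}(gK v Bv) (distrC _ (init y v))
    -{3}(gK v Bv); exact/fv/gB.
- move=> u v Bu Bv uv; rewrite distrC -{1}(gK u Bu) -{1}(gK v Bv).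
  by apply: fe; [exact: gB|exact: gB|rewrite -fE ?gK//; exact: gB].
Qed.

Lemma good_trans x y z r1 r2 d1 d2 : good x y r1 d1 -> good y z r2 d2 ->
  good x z (minn r1 r2) (d1 + d2).
Proof.
move=> gxy gyz.
have tri (a b c : R) : `|b - a| < d1 -> `|c - b| < d2 -> `|c - a| < d1 + d2.
  move=> ab bc; rewrite -(subrK b c) -addrA addrC.
  by rewrite (le_lt_trans (ler_normD _ _))// ltrD.
case: (gxy) => f [[fsub finj fsurj] fr fE fv fe].
case: (gyz) => g [[gsub ginj gsurj] gr gE gv ge].
set r := minn r1 r2.
have rr1 : (r <= r1)%N by exact: geq_minl.
have rr2 : (r <= r2)%N by exact: geq_minr.
have S1 v : gball x (root x) r v -> gball x (root x) r1 v by exact: gballS.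
have S2 v : gball y (root y) r v -> gball y (root y) r2 v by exact: gballS.
have fB v : gball x (root x) r v -> gball y (root y) r (f v).
  by apply: (gball_image fr fE).
have gB v : gball y (root y) r v -> gball z (root z) r (g v).
  by apply: (gball_image gr gE).
have fS v : gball y (root y) r v ->
    exists2 u, gball x (root x) r u & f u = v.
  move=> Bv; have [u Bu uv] := fsurj _ (gballS rr1 Bv).
  exists u => //; apply: (gball_preimage fr (gball_root _ _ r1) finj fE fsurj) => //.
  by rewrite uv.
have gS v : gball z (root z) r v ->
    exists2 u, gball y (root y) r u & g u = v.
  move=> Bv; have [u Bu uv] := gsurj _ (gballS rr2 Bv).
  exists u => //; apply: (gball_preimage gr (gball_root _ _ r2) ginj gE gsurj) => //.
  by rewrite uv.
exists (g \o f); split => /=.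
- split.
  + by move=> v /fB /gB.
  + move=> u v /set_mem Bu /set_mem Bv /= /ginj h.
    by apply: finj; rewrite ?inE; [exact: S1|exact: S1|
      apply: h; rewrite inE; apply/S2/fB].
  + by move=> v /gS[u /fS[w Bw <-] <-]; exists w.
- by rewrite fr.
- by move=> u v Bu Bv; rewrite gE ?fE//; do ?[exact: S1|exact/S2/fB].
- move=> v Bv; have [a1 a2] := fv _ (S1 _ Bv).
  have [b1 b2] := gv _ (S2 _ (fB _ Bv)).
  by split; apply: tri; eassumption.
- move=> u v Bu Bv uv; apply: (tri _ (ewt y (f u) (f v))).
    by apply: fe => //; exact: S1.
  by apply: ge; rewrite ?fE//; do ?[exact: S1|exact/S2/fB].
Qed.

Lemma rdist_ltP x y (e : R) : (rdist x y < e%:E)%E <->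
  exists (r : nat) (delta : R),
    [/\ 0 < delta, good x y r delta & (r.+1%:R)^-1 + delta < e].
Proof.
split.
  case/ereal_inf_lt => _ [r [d [d0 gxy ->]]]; rewrite lte_fin => rd.
  by exists r, d.
case=> r [d [d0 gxy rd]].
apply: (@le_lt_trans _ _ ((r.+1%:R)^-1 + d)%:E); last by rewrite lte_fin.
by apply: ereal_inf_lbound; exists r, d.
Qed.

Lemma rdist_sym x y : rdist x y = rdist y x.
Proof.
rewrite /rdist; congr ereal_inf; apply/seteqP.
by split=> _ [r [d [d0 g ->]]]; exists r, d; split=> //; exact: good_sym.
Qed.

Lemma rdist_triangle x y z (e1 e2 : R) :
  (rdist x y < e1%:E)%E -> (rdist y z < e2%:E)%E ->
  (rdist x z < (e1 + e2)%:E)%E.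
Proof.
move=> /rdist_ltP[r1 [d1 [d10 g1 h1]]] /rdist_ltP[r2 [d2 [d20 g2 h2]]].
apply/rdist_ltP; exists (minn r1 r2), (d1 + d2); split.
- exact: addr_gt0.
- exact: good_trans g1 g2.
- apply: le_lt_trans (ltrD h1 h2); rewrite addrACA lerD2r.
  by rewrite /minn; case: ifP => _; rewrite ?lerDl ?lerDr invr_ge0.
Qed.

Lemma iso_good x y r (d : R) : 0 < d -> rooted_iso x y -> good x y r d.
Proof.
move=> d0 [f [[fsub finj fsurj] fr fE fv fe]].
have fEB k u v : gball x (root x) k u -> gball x (root x) k v ->
    adj y (f u) (f v) = adj x u v.
  by move=> /gball_vset Bu /gball_vset Bv; exact: fE.
exists f; split => //.
- split.
  + by move=> v Bv; apply: (gball_image fr (fEB r)) Bv.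
  + move=> u v /set_mem/gball_vset Bu /set_mem/gball_vset Bv.
    by apply: finj; rewrite inE.
  + move=> v Bv; have [u Vu uv] := fsurj _ (gball_vset Bv).
    exists u => //.
    apply: (gball_preimage fr (root_vset x) finj fE _ (leqnn r)) => //.
      by move=> w /gball_vset /fsurj.
    by rewrite uv.
- exact: fEB.
- by move=> v /gball_vset /fv[-> ->]; rewrite !subrr normr0.
- by move=> u v _ _ /fe ->; rewrite subrr normr0.
Qed.

Lemma rdist_iso x y (e : R) : rooted_iso x y -> 0 < e -> (rdist x y < e%:E)%E.
Proof.
move=> xy e0; apply/rdist_ltP; have e20 : 0 < e / 2 by rewrite divr_gt0.
exists (Num.truncn (e / 2)^-1), (e / 2); split=> //; first exact: iso_good.
rewrite [ltRHS](splitr e) ltrD2r -[ltRHS]invrK ltf_pV2 ?posrE ?invr_gt0//.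
exact: truncnS_gt.
Qed.

Lemma rooted_iso_refl x : rooted_iso x x.
Proof. 
exists id; split=> //; by split=> // v xv; exists v. Qed.

Lemma rooted_iso_sym x y : rooted_iso x y -> rooted_iso y x.
Proof.
case=> f [[fsub finj fsurj] fr fE fv fe].
have /choice[g gP] : forall v, exists w, vset y v -> vset x w /\ f w = v.
  move=> v.
  have [/fsurj[w]|] := pselect (vset y v); last by exists 0%N.
  by exists w.
have gB v : vset y v -> vset x (g v) by case/gP.
have gK v : vset y v -> f (g v) = v by case/gP.
have gE u v : vset y u -> vset y v -> adj x (g u) (g v) = adj y u v.
  by move=> Bu Bv; rewrite -fE ?gK//; exact: gB.
exists g; split => //.
- split=> //.
  + by move=> u v /set_mem/gK{2}<- /set_mem/gK{2}<- ->.
  + move=> v Bv; exists (f v); first exact: fsub.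
    by apply: finj; rewrite ?inE; [apply/gB/fsub| |apply/gK/fsub].
- have B0 := root_vset y.
  apply: finj; rewrite ?inE ?gK ?fr//; [exact: gB|exact: root_vset].
- move=> v Bv; have [<- <-] := fv _ (gB _ Bv).
  by rewrite gK.
- move=> u v uv; have Vu := adj_vset uv.
  have Vv : vset y v by move: uv; rewrite adj_sym => /adj_vset.
  by rewrite -fe ?gE// !gK.
Qed.

Lemma rooted_iso_trans x y z :
  rooted_iso x y -> rooted_iso y z -> rooted_iso x z.
Proof.
case=> f [fbij fr fE fv fe] [g [gbij gr gE gv ge]].
have fsub v : vset x v -> vset y (f v) by case: fbij => + _ _; exact.
exists (g \o f); split=> /=.
- exact: set_bij_comp fbij gbij.
- by rewrite fr.
- by move=> u v xu xv; rewrite gE ?fE//; exact: fsub.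
- by move=> v xv; have [<- <-] := fv _ xv; exact/gv/fsub.
- move=> u v uv; rewrite -fe// ge// fE//; first exact: adj_vset uv.
  by move: uv; rewrite adj_sym => /adj_vset.
Qed.

Definition rooted_isob x y : bool := `[< rooted_iso x y >].

Lemma rooted_isob_refl : reflexive rooted_isob.
Proof. by move=> x; apply/asboolP; exact: rooted_iso_refl. Qed.

Lemma rooted_isob_sym : symmetric rooted_isob.
Proof. by move=> x y; apply/asboolP/asboolP; exact: rooted_iso_sym. Qed.

Lemma rooted_isob_trans : transitive rooted_isob.
Proof.
move=> y x z /asboolP xy /asboolP yz; apply/asboolP.
exact: rooted_iso_trans yz.
Qed.

Canonical rooted_iso_equiv :=
  EquivRel rooted_isob rooted_isob_refl rooted_isob_sym rooted_isob_trans.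

End rooted_iso.

Definition Nstar (R : realType) := {eq_quot @rooted_isob R}.
HB.instance Definition _ (R : realType) := Choice.on (Nstar R).
HB.instance Definition _ (R : realType) :=
  EqQuotient.on (Nstar R).

(* Only meant for [v] in [vset N]; otherwise this is the isolated vertex [v]. *)
Section rooted_component.
Context {R : realType} (N : network R) (v : nat).

Let C := induced N (component N v).

Let root_component : vset C v.
Proof. by exists [::]. Qed.

Let C_path u p : component N v u -> path (adj N) u p -> path (adj C) u p.
Proof.
elim: p u => //= w p ih u vu /andP[uw wp].
have vw : component N v w.
  by case: vu => q vq qu; exists (rcons q w);
    rewrite ?last_rcons// rcons_path vq qu.
by rewrite uw !mem_set//=; exact: ih.
Qed.

Let component_connected u w : vset C u -> vset C w ->
  exists2 p, path (adj C) u p & last u p = w.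
Proof.
move=> vu [q vq qw]; have [p vp pu] := vu.
exists (rev (belast v p) ++ q); last first.
  rewrite last_cat -qw; congr last.
  case/lastP: p pu vp => [/=->//|p x]; rewrite last_rcons => -> _.
  by case: p => [|y p]//=; rewrite rev_cons last_rcons.
apply: C_path => //; rewrite cat_path.
have -> : last u (rev (belast v p)) = v.
  case: p pu vp => [/=->//|y p] _ _.
  by rewrite /= rev_cons last_rcons.
rewrite vq andbT -pu rev_path.
by under eq_path do rewrite adj_sym.
Qed.

Definition rooted_component : rooted R :=
  @Rooted R C v root_component component_connected.

End rooted_component.

Section Nstar_topology.
Context {R : realType}.
Implicit Types X Y Z : Nstar R.

Definition ndist X Y : \bar R := rdist (repr X) (repr Y).

(* [ndist] does not depend on the representatives. *)
Lemma ndistE (x y : rooted R) :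
  ndist (\pi_(Nstar R) x) (\pi_(Nstar R) y) = rdist x y.
Proof.
have le_iso (a b c : rooted R) : rooted_iso a b -> (rdist a c <= rdist b c)%E.
  move=> ab; rewrite leNgt; apply/negP => lt_bc.
  have : (rdist b c < +oo)%E by exact: lt_le_trans lt_bc (leey _).
  have ge0 : (0 <= rdist b c)%E.
    apply: le_ereal_inf_tmp => _ [r [d [d0 _ ->]]].
    by rewrite lee_fin addr_ge0 ?invr_ge0// ltW.
  case E : (rdist b c) lt_bc ge0 => [s| |] // lt_bc _ _.
  suff : (rdist a c <= s%:E)%E by rewrite leNgt lt_bc.
  apply/lee_addgt0Pr => e e0; rewrite -EFinD.
  have e20 : 0 < e / 2 by rewrite divr_gt0.
  rewrite ltW// (splitr e) addrCA.
  by apply: (rdist_triangle (rdist_iso ab e20)); rewrite E lte_fin ltrDl.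
have pi_iso (z : rooted R) : rooted_iso (repr (\pi_(Nstar R) z)) z.
  apply/asboolP; rewrite -[asbool _]/(rooted_iso_equiv _ _).
  by rewrite -(@eqmodE _ rooted_iso_equiv); apply/eqP; rewrite reprK.
have iso_eq (a b c : rooted R) : rooted_iso a b -> rdist a c = rdist b c.
  by move=> ab; apply/eqP; rewrite eq_le !le_iso//; exact: rooted_iso_sym.
by rewrite /ndist (iso_eq _ _ _ (pi_iso x)) rdist_sym
  (iso_eq _ _ _ (pi_iso y)) rdist_sym.
Qed.

Definition Nball X (e : R) : set (Nstar R) := [set Y | (ndist X Y < e%:E)%E].

Let ent : set_system (Nstar R * Nstar R) := entourage_ Nball.
Let Nnbhs X : set_system (Nstar R) := nbhs_ ent X.
Let NnbhsE : Nnbhs = nbhs_ ent. Proof. by []. Qed.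

HB.instance Definition _ := hasNbhs.Build (Nstar R) Nnbhs.

Let Nball_center X (e : R) : 0 < e -> Nball X e X.
Proof. by move=> e0; apply: rdist_iso => //; exact: rooted_iso_refl. Qed.

Let Nball_sym X Y (e : R) : Nball X e Y -> Nball Y e X.
Proof. by rewrite /Nball /= /ndist rdist_sym. Qed.

Let Nball_triangle X Y Z (e1 e2 : R) :
  Nball X e1 Y -> Nball Y e2 Z -> Nball X (e1 + e2) Z.
Proof. exact: rdist_triangle. Qed.

Let entE : ent = entourage_ Nball. Proof. by []. Qed.

HB.instance Definition _ := @Nbhs_isPseudoMetric.Build R (Nstar R)
  ent NnbhsE Nball Nball_center Nball_sym Nball_triangle entE.

End Nstar_topology.

Section Nstar_pointed.
Context {R : realType}.

Let empty_adj : rel nat := fun _ _ => false.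
Let empty_network : network R.
Proof.
refine (@Network R set0 empty_adj _ _ _ (fun _ _ => 1) _ _
  (fun=> 0) (fun=> 0)) => //.
by move=> v; exact: (sub_finite_set _ (@finite_set0 nat)).
Defined.

HB.instance Definition _ := isPointed.Build (Nstar R)
  (\pi_(Nstar R) (rooted_component empty_network 0%N)).

End Nstar_pointed.

Definition nice_classes (R : realType) : set (Nstar R) :=
  [set X | let x : rooted R := repr X in nice x (root x)].
Arguments nice_classes R : clear implicits.

Definition path_space (R : realType) (T : R) :=
  continuousType (`[0, T]%classic : set R) R.

HB.instance Definition _ (R : realType) (T : R) := Choice.on (path_space T).

Section path_space_theory.
Context {R : realType} {T : R}.
Implicit Types f g h : path_space T.

(* [0] outside of [0,T] *)
Definition path_at f (t : R) : R := 'valL_0 (f : `[0, T]%classic -> R) t.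

Definition sup_dist f g : R := sup [set `|f t - g t| | t in setT].

Let path_bounded f : exists M, forall t, `|f t| <= M.
Proof.
have cf : {within `[0, T], continuous ('valL_0 (f : `[0, T]%classic -> R))}.
  apply/subspace_sigL_continuousP; rewrite valLK.
  exact: cts_fun.
have := continuous_compact cf (@segment_compact R 0 T).
move=> /compact_bounded[M [_ /(_ (M + 1))]]; rewrite ltrDl ltr01 => /(_ isT) h.
exists (M + 1) => t; apply: h; exists (set_val t); first exact: set_valP.
by have /(congr1 (fun k => k t)) := valLK 0 (f : `[0, T]%classic -> R).
Qed.

Let sup_dist_ub f g t : `|f t - g t| <= sup_dist f g.
Proof.
apply: ub_le_sup; last by exists t.
have [M1 h1] := path_bounded f; have [M2 h2] := path_bounded g.
by exists (M1 + M2) => _ [s _ <-]; rewrite (le_trans (ler_normB _ _))// lerD.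
Qed.

Let sup_dist_le f g M : 0 <= M -> (forall t, `|f t - g t| <= M) ->
  sup_dist f g <= M.
Proof.
move=> M0 h; rewrite /sup_dist.
have [->|/set0P ne] := eqVneq [set `|f t - g t| | t in setT] set0.
  by rewrite sup0.
by apply: ge_sup => // _ [t _ <-].
Qed.

Let sup_dist_ge0 f g : 0 <= sup_dist f g.
Proof.
rewrite /sup_dist.
have [->|/set0P[_ [t _ _]]] := eqVneq [set `|f t - g t| | t in setT] set0.
  by rewrite sup0.
exact: le_trans (sup_dist_ub f g t).
Qed.

Let sup_distxx f : sup_dist f f = 0.
Proof.
apply/eqP; rewrite eq_le sup_dist_ge0 andbT.
by apply: sup_dist_le => // t; rewrite subrr normr0.
Qed.

Let sup_dist_positivity f g : sup_dist f g = 0 -> f = g.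
Proof.
move=> fg; apply/continuousEP => t; apply/eqP; rewrite -subr_eq0 -normr_le0.
by have := sup_dist_ub f g t; rewrite fg.
Qed.

Let sup_dist_sym f g : sup_dist f g = sup_dist g f.
Proof.
by rewrite /sup_dist; congr sup; apply/seteqP; split=> _ [t _ <-];
  exists t => //; rewrite distrC.
Qed.

Let sup_dist_triangle g f h : sup_dist f h <= sup_dist f g + sup_dist g h.
Proof.
apply: sup_dist_le => [|t]; first exact: addr_ge0.
rewrite -(subrK (g t) (f t)) -addrA (le_trans (ler_normD _ _))//.
by rewrite lerD.
Qed.

HB.instance Definition _ := isMetric.Build R (path_space T)
  sup_distxx sup_dist_positivity sup_dist_sym sup_dist_triangle.

HB.instance Definition _ := isPointed.Build (path_space T)
  (mkcts (@cst_continuous (`[0, T]%classic : set R) R 0)).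

End path_space_theory.

Definition borel (X : ptopologicalType) := g_sigma_algebraType (@open X).
HB.instance Definition _ (X : ptopologicalType) := Measurable.on (borel X).

Definition weak_cvg (R : realType) (X : ptopologicalType)
    (m : nat -> {measure set (borel X) -> \bar R})
    (mu : {measure set (borel X) -> \bar R}) : Prop :=
  forall f : X -> R, continuous f -> bounded_fun f ->
    (\int[m n]_x (f x)%:E)%E @[n --> \oo] --> (\int[mu]_x (f x)%:E)%E.

(* [V] is meant to be finite; the zero measure when [V] is empty. *)
Section empirical.
Context {R : realType} {X : ptopologicalType}.
Variables (V : set nat) (x : nat -> X).

Definition empirical (A : set (borel X)) : \bar R :=
  ((#|` fset_set V |%:R)^-1%:E *
   \sum_(v <- fset_set V) (\d_(x v : borel X) A))%E.

Let c : {nonneg R} := (#|` fset_set V |%:R^-1)%:nng.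
Let s : seq nat := fset_set V.
Let m : {measure set (borel X) -> \bar R} :=
  mscale c (msum (fun i => \d_(x (nth 0%N s i) : borel X)) (size s)).

Let empiricalE : empirical = m.
Proof.
apply/funext => A; rewrite /empirical /m /mscale /msum /=; congr (_ * _)%E.
by rewrite (big_nth 0%N) big_mkord.
Qed.

Let empirical0 : empirical set0 = 0%E.
Proof. by rewrite empiricalE measure0. Qed.
Let empirical_ge0 A : (0 <= empirical A)%E.
Proof. by rewrite empiricalE. Qed.
Let empirical_sigma_additive : semi_sigma_additive empirical.
Proof. by rewrite empiricalE; exact: measure_semi_sigma_additive. Qed.

HB.instance Definition _ := isMeasure.Build _ _ _ empirical
  empirical0 empirical_ge0 empirical_sigma_additive.

End empirical.
Arguments empirical R {X} V x.

(* the measure [U(N)] *)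
Definition root_measure (R : realType) (N : network R) :
    {measure set (borel (Nstar R)) -> \bar R} :=
  empirical R (vset N) (fun v => \pi_(Nstar R) (rooted_component N v)).

Section brownian.
Context {d} {Omega : measurableType d} {R : realType} (P : probability Omega R).

Definition mutually_independent (I : choiceType) (F : I -> set (set Omega)) :=
  forall (J : {fset I}) (E : I -> set Omega),
    (forall i, i \in J -> F i (E i)) ->
    P (\bigcap_(i in [set` J]) E i) = (\prod_(i <- J) P (E i))%E.

Definition sigma_var (Y : Omega -> R) : set (set Omega) :=
  preimage_set_system setT Y measurable.

Definition sigma_process (X : R -> Omega -> R) : set (set Omega) :=
  <<s \bigcup_(t in [set t | 0 <= t]) sigma_var (X t) >>.

(* The last parameter of [normal_prob] is the standard deviation. *)
Definition standard_brownian (X : R -> Omega -> R) : Prop :=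
  [/\ (forall t, 0 <= t -> measurable_fun setT (X t)),
      {ae P, forall w, X 0 w = 0},
      {ae P, forall w, {within `[0, +oo[, continuous (X ^~ w)}},
      (forall s t, 0 <= s -> s < t -> forall A : set R, measurable A ->
         P [set w | A (X t w - X s w)] = normal_prob 0 (Num.sqrt (t - s)) A)
    & (forall t : nat -> R, 0 <= t 0%N -> (forall i, t i < t i.+1) ->
         mutually_independent
           (fun i => sigma_var (fun w => X (t i.+1) w - X (t i) w)))].

Definition iid_brownian (B : nat -> R -> Omega -> R) : Prop :=
  (forall v, standard_brownian (B v)) /\
  mutually_independent (fun v => sigma_process (B v)).

(* augmented by the null events *)
Definition brownian_filtration (B : nat -> R -> Omega -> R) (t : R) :
    set (set Omega) :=
  <<s [set A | (exists v s, 0 <= s <= t /\ sigma_var (B v s) A) \/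
               (measurable A /\ P A = 0%E)] >>.

End brownian.

Section diffusion.
Context {d} {Omega : measurableType d} {R : realType} (P : probability Omega R).
Variables (phi : R * R * R * R -> R) (psi : R * R -> R) (T : R).
Variable B : nat -> R -> Omega -> R.
Implicit Types N : network R.

(* [0^-1 = 0], so the first term vanishes when [vertex_mu N v = 0]. *)
Definition drift N (x : nat -> R) (v : nat) : R :=
  (vertex_mu N v)^-1 * (\sum_(u \in vset N)
     edge_mu N u v * phi (x u, x v, media N v, media N u)) +
  psi (x v, media N v).

(* The noise is additive, so the equation needs no stochastic integral: the
   integral of [dB_v] over [0,t] is [B v t], as [B v 0 = 0] a.s. *)
Definition strong_solution N (theta : nat -> Omega -> path_space T) : Prop :=
  (forall v t, vset N v -> t \in `[0, T] ->
     sigma_var (fun w => path_at (theta v w) t)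
       `<=` brownian_filtration P B t) /\
  (forall v, vset N v -> {ae P, forall w, forall t, t \in `[0, T] ->
     path_at (theta v w) t = init N v +
       (\int[lebesgue_measure]_(s in `[0, t])
          drift N (fun u => path_at (theta u w) s) v) +
       B v t w}).

(* The strong solution, unique up to indistinguishability on [vset N] for
   bounded Lipschitz [phi] and Lipschitz [psi]; [get] selects one version. *)
Definition diffusion N : nat -> Omega -> path_space T :=
  get [set theta | strong_solution N theta].

(* For nice [X] this does not depend on the representative, the Brownian motions
   being i.i.d. *)
Definition root_law (X : Nstar R) (A : set (borel (path_space T))) : \bar R :=
  let x : rooted R := repr X in P [set w | A (diffusion x (root x) w)].

End diffusion.

(* Main.v *)
Require Import Defs.
From HB Require Import structures.
From mathcomp Require Import all_boot all_order all_algebra finmap generic_quotient.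
From mathcomp Require Import all_classical all_reals all_analysis.
From mathcomp Require Import measurable_realfun giry zify lra.

Set Implicit Arguments.
Unset Strict Implicit.
Unset Printing Implicit Defensive.
Import Order.TTheory GRing.Theory Num.Theory.
Import numFieldNormedType.Exports.

Local Open Scope classical_set_scope.
Local Open Scope ring_scope.

(** The noise is additive, so the equation can be solved path by path: for every
family [b] of continuous paths, one for each vertex, the integral equation driven
by [b] has exactly one solution [flow N b]. Up to a null event the diffusion is
[flow N b] for the Brownian paths [b] ([diffusion_flow]), and the theorem becomes
a statement on the deterministic map [flow] and on a family of independent and
equidistributed paths.

The main estimate on [flow] is [stability]. Suppose that a map [f] identifies the
ball of radius [r] around [o] in one network with a part of another one, up to an
error [e] in the marks and in the noise and [eta] in the normalized weights. Then
the solutions at [o] and [f o] differ by at most [c (e + eta) + c' / 2 ^ r].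
Nothing is known about the neighbours of a vertex on the rim of the ball, but
their effect is limited by the bound on [phi], and in the norm with weight
[exp (- 2 k s)] every step from the rim towards [o] halves this effect. The
estimate yields the uniqueness of the solution, its measurability in the noise
(only finitely many noise paths matter up to a small error), its locality, and its
continuity in the network.

Locality gives a law of large numbers ([lln]). Let [h] be a bounded Lipschitz
function of a path. Up to [O(2 ^ - r)], the value of [h] at vertex [v] depends on
the noise in the ball of radius [r] around [v] only, and such local values are
independent as soon as the balls are disjoint. As the degrees are [n ^ o(1)], so
is the number of balls that meet a given one, and [n ^ o(1)] colours suffice to
give distinct colours to vertices with intersecting balls. Each colour class is a
family of independent variables, so the fourth moment of the centred average is
[n ^ (- 2 + o(1))], which is summable. By Borel-Cantelli the average of [h] over
the vertices approaches the average of its expectations almost surely.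

The expectation of [h] at [v] depends on the rooted component of [v] only, and is a
bounded continuous function [class_obs] on the space of rooted networks: a
rooted isomorphism of balls matches the vertices, and since the noise is
exchangeable, matched vertices may be given the same noise before [stability] is
applied. The average of the expectations is therefore the integral of [class_obs]
against the measure [root_measure (N n)], and it converges to the integral against
[nu], that is, to the integral of [h] against the mixture of the root laws.

It remains to pass from one [h] at a time to all bounded continuous functions
outside a single null event. A countable family is enough: the path space is
separable, and every nonnegative lower semicontinuous function is an increasing
limit of finite maxima of rational cones ([lsc_cones]). Bounding a continuous
function from both sides in this way gives the weak convergence
([portmanteau_averages]). The same family shows that the law at the root is
a measurable function of the network ([kernel_measurable]), so that its mixture
over [nu] is a probability measure. *)

(** * Integrals with exponential weights *)

Section calculus.
Context {R : realType}.
Notation mu := (@lebesgue_measure R).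
Implicit Types (h g : R -> R) (s t a c k : R).

Lemma within_continuous_itvS h s t : s <= t ->
  {within `[0, t], continuous h} -> {within `[0, s], continuous h}.
Proof.
move=> st; apply: continuous_subspaceW; apply: subset_itvl.
by rewrite bnd_simp.
Qed.

Lemma continuous_itv_integrable h t : {within `[0, t], continuous h} ->
  mu.-integrable `[0, t] (EFin \o h).
Proof.
by move=> ch; apply: continuous_compact_integrable => //; exact: segment_compact.
Qed.

Lemma is_derive_affine_expR (a c k s : R) :
  is_derive s 1 (fun x : R => a * x + c * expR (k * x))
    (a + c * (k * expR (k * s))).
Proof.
have dk : is_derive s 1 (fun x : R => k * x) k.
  have -> : (fun x : R => k * x) = k \*: (@id R).
    by apply/funext.
  by rewrite -{2}[k]mulr1; exact: is_deriveZ.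
have da : is_derive s 1 (fun x : R => a * x) a.
  have -> : (fun x : R => a * x) = a \*: (@id R).
    by apply/funext.
  by rewrite -{2}[a]mulr1; exact: is_deriveZ.
have de : is_derive s 1 (fun x : R => expR (k * x)) (k * expR (k * s)).
  have := @is_derive1_comp R expR (fun x : R => k * x) s _ _
    (is_derive_expR _) dk.
  by rewrite mulrC.
have -> : (fun x : R => a * x + c * expR (k * x)) =
  (fun x : R => a * x) + c \*: (fun x : R => expR (k * x)).
  by apply/funext.
by apply: is_deriveD; exact: is_deriveZ.
Qed.

Lemma Rintegral_affine_expR (a c k t : R) : 0 <= t ->
  \int[mu]_(s in `[0, t]) (a + c * (k * expR (k * s))) =
  a * t + c * expR (k * t) - c.
Proof.
rewrite le_eqVlt => /predU1P[<-|t0].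
  by rewrite set_itv1 Rintegral_set1 !mulr0 expR0 mulr1 add0r subrr.
pose F (x : R) := a * x + c * expR (k * x).
have dF (x : R) : is_derive x 1 F (a + c * (k * expR (k * x))).
  exact: is_derive_affine_expR.
have cF (x : R) : {for x, continuous F}.
  by apply: differentiable_continuous; apply/derivable1_diffP; case: (dF x).
have cf : continuous (fun s => a + c * (k * expR (k * s))).
  move=> x; apply: cvgD; first exact: cvg_cst.
  apply: cvgMr; apply: cvgMr.
  apply: (@continuous_comp _ _ _ (fun x : R => k * x) expR).
    by apply: cvgMr; exact: cvg_id.
  exact: continuous_expR.
rewrite /Rintegral (@continuous_FTC2 _ _ F)//=.
- by rewrite /F !mulr0 expR0 mulr1 add0r.
- exact: continuous_subspaceT.
- split.
  + by move=> x _; case: (dF x).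
  + by apply: cvg_at_right_filter; exact: cF.
  + by apply: cvg_at_left_filter; exact: cF.
- by move=> x _; rewrite derive1E; case: (dF x).
Qed.

(** The weight [expR (2 k s)] turns integration into a contraction of ratio
    [1/2], which drives the fixed point argument, the Gronwall estimate and the
    decay of the influence of distant vertices. *)
Lemma le_Rintegral_expR h (a c k t : R) : 0 <= t -> 0 <= c ->
  {within `[0, t], continuous h} ->
  (forall s, 0 <= s <= t -> `|h s| <= a + k * (c * expR (2 * k * s))) ->
  `|\int[mu]_(s in `[0, t]) h s| <= a * t + c / 2 * expR (2 * k * t).
Proof.
move=> t0 c0 ch hle.
have ih := continuous_itv_integrable ch.
apply: (le_trans (le_normr_Rintegral _ _)) => //.
apply: (@le_trans _ _ (\int[mu]_(s in `[0, t])
    (a + c / 2 * (2 * k * expR (2 * k * s))))).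
  apply: le_Rintegral => //.
  - exact: (integrable_norm ih).
  - apply: continuous_itv_integrable; apply: continuous_subspaceT.
    move=> x; apply: cvgD; first exact: cvg_cst.
    apply: cvgMr; apply: cvgMr.
    apply: (@continuous_comp _ _ _ (fun x : R => 2 * k * x) expR).
      by apply: cvgMr; exact: cvg_id.
    exact: continuous_expR.
  - move=> x; rewrite /= in_itv/= => /hle /le_trans; apply.
    by rewrite lerD2l le_eqVlt; apply/orP; left; apply/eqP; lra.
rewrite Rintegral_affine_expR//; lra.
Qed.

(** The bound is tested at the point [m] where [g s * expR (- 2 k s)] is maximal:
    there the hypothesis, applied with the maximum as [c], bounds the maximum by
    [a] plus half of itself. *)
Lemma gronwall_max g (a k t : R) : 0 <= t -> 0 <= k -> 0 <= a ->
  {within `[0, t], continuous g} ->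
  (forall s, 0 <= s <= t -> 0 <= g s) ->
  (forall s c, 0 <= s <= t -> 0 <= c ->
     (forall x, 0 <= x <= s -> g x <= c * expR (2 * k * x)) ->
     g s <= a + c / 2 * expR (2 * k * s)) ->
  forall s, 0 <= s <= t -> g s <= 2 * a * expR (2 * k * s).
Proof.
move=> t0 k0 a0 cg g0 hg.
pose G x := g x * expR (- (2 * k * x)).
have cG : {within `[0, t], continuous G}.
  move=> x; apply: cvgM; first exact: cg.
  have : {within `[0, t], continuous (fun x => expR (- (2 * k * x)))}.
    apply: continuous_subspaceT => y.
    apply: (@continuous_comp _ _ _ (fun x : R => - (2 * k * x)) expR).
      by apply: cvgN; apply: cvgMr; exact: cvg_id.
    exact: continuous_expR.
  by apply.
have [m m0t Gm] := EVT_max t0 cG.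
rewrite in_itv/= in m0t.
have Gg x : g x = G x * expR (2 * k * x).
  by rewrite /G -mulrA -expRD addNr expR0 mulr1.
have le2a : G m <= 2 * a.
  have : g m <= a + G m / 2 * expR (2 * k * m).
    apply: hg => //; first by rewrite mulr_ge0 ?expR_ge0// g0.
    move=> x /andP[x0 xm]; rewrite Gg ler_wpM2r ?expR_ge0//; apply: Gm.
    by rewrite in_itv/= x0 (le_trans xm)//; case/andP: m0t.
  rewrite {1}Gg => h.
  have e1 : 1 <= expR (2 * k * m).
    by rewrite -expR0 ler_expR !mulr_ge0//; case/andP: m0t.
  have : G m * expR (2 * k * m) <= 2 * a by move: h; rewrite -mulrA; lra.
  move=> /(le_trans _); apply; rewrite ler_peMr//.
  by rewrite mulr_ge0 ?expR_ge0// g0.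
move=> s s0t; rewrite Gg ler_wpM2r ?expR_ge0//.
by rewrite (le_trans _ le2a)//; apply: Gm; rewrite in_itv.
Qed.

End calculus.

(** * Continuous paths *)

Section paths.
Context {R : realType} {T : R}.
Implicit Types f g : path_space T.

Lemma path_at_val f (t : `[0, T]%classic) : path_at f (set_val t) = f t.
Proof.
have /(congr1 (fun k => k t)) := valLK 0 (f : `[0, T]%classic -> R).
by [].
Qed.

Lemma path_at_continuous f : {within `[0, T], continuous (path_at f)}.
Proof.
rewrite /path_at; apply/subspace_sigL_continuousP; rewrite valLK.
exact: cts_fun.
Qed.

Lemma path_ex (g : R -> R) : {within `[0, T], continuous g} ->
  exists f : path_space T, forall t, 0 <= t <= T -> path_at f t = g t.
Proof.
move=> /subspace_sigL_continuousP cg.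
exists (mkcts cg : path_space T) => t t0T.
have tin : t \in `[0, T]%classic by rewrite inE/= in_itv.
have -> : t = set_val (SigSub tin : `[0, T]%classic) by [].
by rewrite path_at_val.
Qed.

Lemma path_ext f g :
  (forall t, 0 <= t <= T -> path_at f t = path_at g t) -> f = g.
Proof.
move=> fg; apply/continuousEP => t; rewrite -!path_at_val; apply: fg.
by have := set_valP t; rewrite /= in_itv.
Qed.

Lemma path_dist_continuous f g :
  {within `[0, T], continuous (fun t => `|path_at f t - path_at g t|)}.
Proof.
move=> t; apply: (@continuous_comp (subspace `[0, T]) R^o R^o
  (fun t => path_at f t - path_at g t) (fun z => `|z|)).
  by apply: cvgB; exact: path_at_continuous.
exact: norm_continuous.
Qed.

Lemma path_at_sup_dist f g t : 0 <= t <= T ->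
  `|path_at f t - path_at g t| <= sup_dist f g.
Proof.
move=> t0T; have T0 : 0 <= T by case/andP: t0T; exact: le_trans.
have [m _ mP] := EVT_max T0 (@path_dist_continuous f g).
have tin : t \in `[0, T]%classic by rewrite inE/= in_itv.
have [t' <-] : exists t' : `[0, T]%classic, set_val t' = t.
  by exists (SigSub tin).
rewrite !path_at_val.
apply: ub_le_sup; last by exists t'.
exists (`|path_at f m - path_at g m|) => _ [s _ <-].
by rewrite -!path_at_val; apply: mP; exact: (set_valP s).
Qed.

Lemma sup_dist_le f g a : 0 <= a ->
  (forall t, 0 <= t <= T -> `|path_at f t - path_at g t| <= a) ->
  sup_dist f g <= a.
Proof.
move=> a0 fga; rewrite /sup_dist.
have [->|/set0P ne] := eqVneq [set `|f t - g t| | t in setT] set0.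
  by rewrite sup0.
apply: ge_sup => // _ [t _ <-]; rewrite -!path_at_val; apply: fga.
by have := set_valP t; rewrite /= in_itv.
Qed.

Lemma sup_dist_ge0 f g : 0 <= sup_dist f g.
Proof. exact: (@mdist_ge0 _ (path_space T)). Qed.
Lemma sup_distC f g : sup_dist f g = sup_dist g f.
Proof. exact: (@metric_sym _ (path_space T)). Qed.

Lemma ball_sup_dist f g (e : R) : ball f e g = (sup_dist f g < e).
Proof. by rewrite ballEmdist. Qed.
End paths.

(** * The drift *)

Section neighbours.
Context {R : realType}.
Implicit Types (N : network R) (u v o : nat) (f : nat -> nat).

Definition nbs N v : seq nat := fset_set [set u | adj N v u].

Lemma mem_nbs N v u : (u \in nbs N v) = adj N v u.
Proof.
by rewrite in_fset_set ?inE//; [apply/idP/idP; rewrite inE|exact: adj_locfin].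
Qed.

Lemma nbs_uniq N v : uniq (nbs N v). Proof. exact: fset_uniq. Qed.

Lemma sum_nbsE N v (F : nat -> R) :
  \sum_(u \in vset N) edge_mu N u v * F u = \sum_(u <- nbs N v) ewt N u v * F u.
Proof.
rewrite -(@fsbig_widen _ _ _ _ [set u | adj N v u]); last 2 first.
- by move=> u /=; rewrite adj_sym => /adj_vset.
- by move=> u [_ /= /negP]; rewrite /edge_mu adj_sym => /negbTE ->; rewrite mul0r.
rewrite fsbig_finite; last exact: adj_locfin.
apply: eq_big_seq => u; rewrite -/(nbs N v) mem_nbs /edge_mu adj_sym => ->.
by [].
Qed.

Lemma vertex_muE N v : vertex_mu N v = \sum_(u <- nbs N v) ewt N u v.
Proof.
have := sum_nbsE N v (fun=> 1).
under eq_fsbigr do rewrite mulr1.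
by rewrite /vertex_mu => ->; apply: eq_bigr => u _; rewrite mulr1.
Qed.

(** The transition probability from [v] to [u] of the random walk on [N]: the drift
    is an average over the neighbours with these weights. *)
Definition pw N v u : R := (vertex_mu N v)^-1 * ewt N u v.

Lemma nbs_ewt_gt0 N v u : u \in nbs N v -> 0 < ewt N u v.
Proof. by rewrite mem_nbs adj_sym => /ewt_gt0. Qed.

Lemma vertex_mu_ge0 N v : 0 <= vertex_mu N v.
Proof.
by rewrite vertex_muE big_seq sumr_ge0// => u /nbs_ewt_gt0 /ltW.
Qed.

Lemma pw_ge0 N v u : u \in nbs N v -> 0 <= pw N v u.
Proof.
by move=> uv; rewrite mulr_ge0 ?invr_ge0 ?vertex_mu_ge0// ltW// nbs_ewt_gt0.
Qed.

Lemma pw_sum_le1 N v : \sum_(u <- nbs N v) pw N v u <= 1.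
Proof.
rewrite -mulr_sumr -vertex_muE.
have [->|h] := eqVneq (vertex_mu N v) 0; first by rewrite mulr0.
by rewrite mulVf.
Qed.

(** All that the drift at [v] uses of the weights of a network. The second
    condition bounds a total variation distance between transition
    probabilities. *)
Definition nbs_close N N' f (eta : R) v :=
  perm_eq (map f (nbs N v)) (nbs N' (f v)) /\
  \sum_(u <- nbs N v) `|pw N v u - pw N' (f v) (f u)| <= eta.

Lemma nbs_close_id N v : nbs_close N N id 0 v.
Proof.
split; first by rewrite map_id.
by rewrite big1// => u _; rewrite subrr normr0.
Qed.

End neighbours.

Section drift_bounds.
Context {R : realType}.
Variables (phi : R * R * R * R -> R) (psi : R * R -> R) (L M : R).
Hypothesis L0 : 0 < L.
Hypothesis phiL : forall p q, `|phi p - phi q| <= L * `|p - q|.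
Hypothesis psiL : forall p q, `|psi p - psi q| <= L * `|p - q|.
Hypothesis phiM : forall p, `|phi p| <= M.
Implicit Types (N : network R) (u v o : nat) (f : nat -> nat) (x : nat -> R).

Lemma M_ge0 : 0 <= M. Proof. exact: le_trans (phiM (0, 0, 0, 0)). Qed.

Lemma driftE N x v : drift phi psi N x v =
  \sum_(u <- nbs N v) pw N v u * phi (x u, x v, media N v, media N u) +
  psi (x v, media N v).
Proof.
rewrite /drift sum_nbsE mulr_sumr; congr (_ + _).
by apply: eq_bigr => u _; rewrite mulrA.
Qed.

Lemma phi_dist a b c d a' b' c' d' (e : R) : `|a - a'| <= e -> `|b - b'| <= e ->
  `|c - c'| <= e -> `|d - d'| <= e ->
  `|phi (a, b, c, d) - phi (a', b', c', d')| <= L * e.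
Proof.
move=> h1 h2 h3 h4; apply: (le_trans (phiL _ _)); rewrite ler_pM2l//.
by rewrite !prod_normE/= !ge_max h1 h2 h3 h4.
Qed.

Lemma psi_dist a b a' b' (e : R) : `|a - a'| <= e -> `|b - b'| <= e ->
  `|psi (a, b) - psi (a', b')| <= L * e.
Proof.
move=> h1 h2; apply: (le_trans (psiL _ _)); rewrite ler_pM2l//.
by rewrite !prod_normE/= !ge_max h1 h2.
Qed.

(** A bound that ignores the neighbours of [v], at the price of the constant
    [2 M]: it is used at the vertices on the rim of a ball, whose neighbours are
    out of control. *)
Lemma drift_dist_coarse N N' f x x' v (D e : R) : 0 <= D -> 0 <= e ->
  `|x v - x' (f v)| <= D -> `|media N' (f v) - media N v| <= e ->
  `|drift phi psi N x v - drift phi psi N' x' (f v)| <=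
    2 * M + 2 * L * (D + e).
Proof.
move=> D0 e0 xD me; rewrite !driftE.
have bd N0 (y : nat -> R) w : `|\sum_(u <- nbs N0 w) pw N0 w u *
    phi (y u, y w, media N0 w, media N0 u)| <= M.
  apply: (le_trans (ler_norm_sum _ _ _)).
  apply: (@le_trans _ _ (\sum_(u <- nbs N0 w) pw N0 w u * M)).
    rewrite big_seq [leRHS]big_seq; apply: ler_sum => u uw.
    by rewrite normrM (ger0_norm (pw_ge0 uw)) ler_wpM2l ?pw_ge0.
  by rewrite -mulr_suml ler_piMl ?M_ge0// pw_sum_le1.
have ps : `|psi (x v, media N v) - psi (x' (f v), media N' (f v))| <=
    L * (D + e).
  by apply: psi_dist; [rewrite (le_trans xD)// lerDl|
    rewrite distrC (le_trans me)// lerDr].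
set S := \sum_(_ <- _) _; set S' := \sum_(_ <- _) _.
have -> (p q : R) : S + p - (S' + q) = S - S' + (p - q) by lra.
rewrite (le_trans (ler_normD _ _))//.
have := bd N x v; have := bd N' x' (f v); rewrite -/S -/S' => b1 b2.
have := ler_normB S S' => b3.
have LDe : 0 <= L * (D + e) by rewrite mulr_ge0 ?addr_ge0// ltW.
lra.
Qed.

(** Each product [pw * phi] changes by a change of the weight, which costs [eta M]
    in total, and by a change of the arguments of [phi], whose Lipschitz bound is
    averaged with weights of total mass at most [1]. *)
Lemma drift_dist N N' f x x' v (D e eta : R) : 0 <= D -> 0 <= e ->
  nbs_close N N' f eta v ->
  (forall u, adj N v u -> `|x u - x' (f u)| <= D /\
     `|media N' (f u) - media N u| <= e) ->
  `|x v - x' (f v)| <= D -> `|media N' (f v) - media N v| <= e ->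
  `|drift phi psi N x v - drift phi psi N' x' (f v)| <=
    eta * M + 2 * L * (D + e).
Proof.
move=> D0 e0 [pe pc] xu xD me; rewrite !driftE.
have ps : `|psi (x v, media N v) - psi (x' (f v), media N' (f v))| <=
    L * (D + e).
  by apply: psi_dist; [rewrite (le_trans xD)// lerDl|
    rewrite distrC (le_trans me)// lerDr].
rewrite -(perm_big _ pe)/= big_map.
set p := psi _ in ps *; set q := psi _ in ps *.
set S := \sum_(_ <- _) _; set S' := \sum_(_ <- _) _.
have -> : S + p - (S' + q) = S - S' + (p - q) by lra.
rewrite (le_trans (ler_normD _ _))//.
suff : `|S - S'| <= eta * M + L * (D + e) by lra.
rewrite /S /S' -sumrB (le_trans (ler_norm_sum _ _ _))//.
apply: (@le_trans _ _ (\sum_(u <- nbs N v)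
  (`|pw N v u - pw N' (f v) (f u)| * M + pw N v u * (L * (D + e))))).
  rewrite big_seq [leRHS]big_seq; apply: ler_sum => u uv.
  set a := pw N v u; set b := pw N' _ _; set y := phi _; set y' := phi _.
  have -> : a * y - b * y' = (a - b) * y' + a * (y - y') by lra.
  rewrite (le_trans (ler_normD _ _))// lerD//.
    by rewrite normrM ler_wpM2l ?phiM.
  have a0 : 0 <= a := pw_ge0 uv.
  rewrite normrM (ger0_norm a0) ler_wpM2l//.
  move: uv; rewrite mem_nbs => /xu[h1 h2].
  apply: phi_dist.
  - by rewrite (le_trans h1)// lerDl.
  - by rewrite (le_trans xD)// lerDl.
  - by rewrite distrC (le_trans me)// lerDr.
  - by rewrite distrC (le_trans h2)// lerDr.
rewrite big_split/= -!mulr_suml lerD//.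
  by rewrite ler_wpM2r ?M_ge0.
by rewrite ler_piMl ?pw_sum_le1// mulr_ge0 ?addr_ge0// ltW.
Qed.

Lemma phi_cvg (I : Type) (F : set_system I) {FF : Filter F} (g h : I -> R)
    (a b c d : R) : g x @[x --> F] --> a -> h x @[x --> F] --> b ->
  phi (g x, h x, c, d) @[x --> F] --> phi (a, b, c, d).
Proof.
move=> /cvgrPdist_lt ga /cvgrPdist_lt hb; apply/cvgrPdist_le => e e0.
have e1 : 0 < e / L by rewrite divr_gt0.
have eE : e = L * (e / L) by rewrite mulrC divfK// gt_eqF.
near=> x; rewrite [leRHS]eE; apply: phi_dist.
- by near: x; apply: filterS (ga _ e1) => x /ltW.
- by near: x; apply: filterS (hb _ e1) => x /ltW.
- by rewrite subrr normr0 ltW.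
- by rewrite subrr normr0 ltW.
Unshelve. all: by end_near. Qed.

Lemma psi_cvg (I : Type) (F : set_system I) {FF : Filter F} (g : I -> R)
    (a b : R) : g x @[x --> F] --> a ->
  psi (g x, b) @[x --> F] --> psi (a, b).
Proof.
move=> /cvgrPdist_lt ga; apply/cvgrPdist_le => e e0.
have e1 : 0 < e / L by rewrite divr_gt0.
have eE : e = L * (e / L) by rewrite mulrC divfK// gt_eqF.
near=> x; rewrite [leRHS]eE; apply: psi_dist.
- by near: x; apply: filterS (ga _ e1) => x /ltW.
- by rewrite subrr normr0 ltW.
Unshelve. all: by end_near. Qed.

Lemma drift_continuous (T : R) N (x : nat -> path_space T) v :
  {within `[0, T],
    continuous (fun s => drift phi psi N (fun u => path_at (x u) s) v)}.
Proof.
have cx u := @path_at_continuous _ _ (x u).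
have -> : (fun s => drift phi psi N (fun u => path_at (x u) s) v) =
  (fun s => \sum_(u <- nbs N v) pw N v u * phi (path_at (x u) s,
     path_at (x v) s, media N v, media N u) +
  psi (path_at (x v) s, media N v)).
  by apply/funext => s; rewrite driftE.
move=> s; apply: cvgD; last by apply: psi_cvg; exact: cx.
apply: (@continuous_big R^o _ +%R 0 xpredT add_continuous (subspace `[0, T]) (nbs N v)
    (fun u s => pw N v u * phi (path_at (x u) s,
     path_at (x v) s, media N v, media N u))).
by move=> u _ z; apply: cvgMr; apply: phi_cvg; exact: cx.
Qed.

End drift_bounds.

(** * Stability of solutions *)

Section dynamics.
Context {R : realType}.
Variables (phi : R * R * R * R -> R) (psi : R * R -> R) (L M T : R).
Hypothesis L0 : 0 < L.
Hypothesis phiL : forall p q, `|phi p - phi q| <= L * `|p - q|.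
Hypothesis psiL : forall p q, `|psi p - psi q| <= L * `|p - q|.
Hypothesis phiM : forall p, `|phi p| <= M.
Hypothesis T0 : 0 < T.
Notation mu := (@lebesgue_measure R).
Implicit Types (N : network R) (u v o : nat) (f : nat -> nat).

(** The equation for a single family [b] of driving paths: no stochastic integral
    is involved, so it makes sense for every outcome. *)
Definition solution N (b : nat -> R -> R) (x : nat -> path_space T) v :=
  forall t, 0 <= t <= T -> path_at (x v) t = init N v +
    \int[mu]_(s in `[0, t]) drift phi psi N (fun u => path_at (x u) s) v + b v t.

Variable k : R.
Hypothesis kE : k = 2 * L.
Let k0 : 0 <= k. Proof. by rewrite kE mulr_ge0// ltW. Qed.
Let M0 : 0 <= M. Proof. exact: M_ge0 phiM. Qed.
Let T0' : 0 <= T. Proof. exact: ltW. Qed.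
Let expk_ge1 (s : R) : 0 <= s -> 1 <= expR (2 * k * s).
Proof. by move=> s0; rewrite -expR0 ler_expR !mulr_ge0. Qed.

(** The constants of [stability]: [stab_coef] multiplies the mismatch inside the
    ball, [stab_tail] the influence of the outside. *)
Definition stab_coef : R := 2 * (2 + M * T + k * T) * expR (2 * k * T).
Definition stab_tail : R := 4 * M * T * expR (2 * k * T).

Lemma stab_coef_ge0 : 0 <= stab_coef.
Proof.
have kT : 0 <= k * T by exact: mulr_ge0.
have MT : 0 <= M * T by exact: mulr_ge0.
by rewrite mulr_ge0 ?expR_ge0//; lra.
Qed.

Lemma stab_tail_ge0 : 0 <= stab_tail.
Proof.
have MT : 0 <= M * T by exact: mulr_ge0.
by rewrite mulr_ge0 ?expR_ge0//; lra.
Qed.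

(** One step of all the estimates below: a weighted bound with constant [c] on the
    difference of the drifts becomes one with constant [c / 2] on the difference
    of the solutions. *)
Lemma solution_dist N N' f b b' (x x' : nat -> path_space T) v s (a c e : R) :
  0 <= s <= T -> 0 <= c -> 0 <= a ->
  solution N b x v -> solution N' b' x' (f v) ->
  `|init N' (f v) - init N v| <= e -> `|b v s - b' (f v) s| <= e ->
  (forall y, 0 <= y <= s ->
     `|drift phi psi N (fun u => path_at (x u) y) v -
       drift phi psi N' (fun u => path_at (x' u) y) (f v)|
     <= a + k * (c * expR (2 * k * y))) ->
  `|path_at (x v) s - path_at (x' (f v)) s| <=
    2 * e + a * T + c / 2 * expR (2 * k * s).
Proof.
move=> /andP[s0 sT] c0 a0 sx sx' ie be dle.
rewrite sx ?s0// sx' ?s0//.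
have cd := within_continuous_itvS sT
  (@drift_continuous _ _ _ _ L0 phiL psiL _ N x v).
have cd' := within_continuous_itvS sT
  (@drift_continuous _ _ _ _ L0 phiL psiL _ N' x' (f v)).
have := @le_Rintegral_expR R (fun y => drift phi psi N (fun u => path_at (x u) y) v -
       drift phi psi N' (fun u => path_at (x' u) y) (f v)) a c k s s0 c0 _ dle.
rewrite RintegralB//; try exact: continuous_itv_integrable.
set I1 := Rintegral _ _ _; set I2 := Rintegral _ _ _.
have cdd : {within `[0, s], continuous (fun y => drift phi psi N (fun u => path_at (x u) y) v -
       drift phi psi N' (fun u => path_at (x' u) y) (f v))}.
  by move=> y; apply: cvgB; [exact: cd|exact: cd'].
move=> /(_ cdd) h.
have -> : init N v + I1 + b v s - (init N' (f v) + I2 + b' (f v) s) =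
  (init N v - init N' (f v)) + (b v s - b' (f v) s) + (I1 - I2) by lra.
rewrite distrC in ie.
have h1 := ler_normD (init N v - init N' (f v)) (b v s - b' (f v) s).
have h2 : a * s <= a * T by rewrite ler_wpM2l.
rewrite (le_trans (ler_normD _ _))//; lra.
Qed.

(** A change far from the root is felt at the root only through a chain of
    neighbours, and each link of the chain halves the weighted distance. The
    induction is on the number [j] of steps that separate [v] from the rim of the
    ball. On the rim the boundedness of [phi] and Gronwall's inequality bound the
    distance by a constant; one step inside, the drifts are compared through the
    neighbours, for which the bound is already known. *)
Theorem stability N N' f o r b b' (x x' : nat -> path_space T) (e eta t : R) :
  0 <= t <= T -> 0 <= e -> 0 <= eta ->
  (forall v, gball N o r v -> solution N b x v /\ solution N' b' x' (f v)) ->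
  (forall v, gball N o r v -> [/\ `|init N' (f v) - init N v| <= e,
     `|media N' (f v) - media N v| <= e &
     forall s, 0 <= s <= t -> `|b v s - b' (f v) s| <= e]) ->
  (forall v j, (j < r)%N -> gball N o j v -> nbs_close N N' f eta v) ->
  forall s, 0 <= s <= t -> `|path_at (x o) s - path_at (x' (f o)) s| <=
    stab_coef * (e + eta) + stab_tail / 2 ^+ r.
Proof.
move=> /andP[t0 tT] e0 eta0 sol cl nc.
pose A := 2 + M * T + k * T.
have MT0 : 0 <= M * T by exact: mulr_ge0.
have kT0 : 0 <= k * T by exact: mulr_ge0.
have A0 : 0 <= A by rewrite /A; lra.
have e2 : 0 <= e + eta by exact: addr_ge0.
pose c j := 2 * A * (e + eta) + 4 * M * T / 2 ^+ j.
have c0 j : 0 <= c j.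
  have h1 : 0 <= A * (e + eta) by exact: mulr_ge0.
  have h2 : 0 <= M * T / 2 ^+ j by rewrite mulr_ge0// invr_ge0 exprn_ge0.
  by rewrite /c; lra.
have Te0 : 0 <= T * e by exact: mulr_ge0.
have MTe0 : 0 <= M * (T * e) by exact: mulr_ge0.
have MTeta0 : 0 <= M * (T * eta) by rewrite mulr_ge0// mulr_ge0.
have kTe0 : 0 <= k * (T * e) by rewrite mulr_ge0.
have kTeta0 : 0 <= k * (T * eta) by rewrite mulr_ge0// mulr_ge0.
have key j : forall i v, (i + j <= r)%N -> gball N o i v ->
    forall s, 0 <= s <= t ->
    `|path_at (x v) s - path_at (x' (f v)) s| <= c j * expR (2 * k * s).
  elim: j => [|j ih] i v ijr Bv s st.
    have Bvr : gball N o r v by apply: gballS Bv; rewrite -[i]addn0.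
    have [sv sv'] := sol _ Bvr; have [iv mv bv] := cl _ Bvr.
    (* [2 M] is the effect of the unknown neighbours, [k e] that of the media *)
    pose a0 := 2 * e + (2 * M + k * e) * T.
    apply: (@le_trans _ _ (2 * a0 * expR (2 * k * s))); last first.
      rewrite ler_wpM2r ?expR_ge0// /c /a0 /A expr0 divr1; nra.
    have cg := within_continuous_itvS tT (@path_dist_continuous _ _ (x v) (x' (f v))).
    have a00 : 0 <= a0.
      by rewrite addr_ge0 ?mulr_ge0 ?addr_ge0 ?mulr_ge0// ltW.
    apply: (gronwall_max t0 k0 a00 cg _ _ st) => // y d /andP[y0 yt] d0 gd.
    rewrite /a0; apply: (@solution_dist N N' f b b') => //.
    - by rewrite y0 (le_trans yt).
    - by rewrite addr_ge0 ?mulr_ge0.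
    - by apply: bv; rewrite y0.
    - move=> z /[dup] zy /andP[z0 zy'].
      have := @drift_dist_coarse R phi psi L M L0 psiL phiM N N' f
        (fun u => path_at (x u) z) (fun u => path_at (x' u) z) v
        (d * expR (2 * k * z)) e _ e0 (gd _ zy) mv.
      rewrite mulr_ge0 ?expR_ge0// => /(_ isT) /le_trans; apply.
      by rewrite -kE le_eqVlt; apply/orP; left; apply/eqP; lra.
  have ir : (i < r)%N by rewrite (leq_trans _ ijr)// addnS ltnS leq_addr.
  have Bvr : gball N o r v by apply: gballS Bv; exact: ltnW.
  have [sv sv'] := sol _ Bvr; have [iv mv bv] := cl _ Bvr.
  have /andP[s0 s1] := st.
  apply: (@le_trans _ _ (2 * e + (eta * M + k * e) * T +
      c j / 2 * expR (2 * k * s))); last first.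
    (* [c] is chosen to solve this recursion *)
    have -> : c j.+1 = A * (e + eta) + c j / 2.
      by rewrite /c exprS invfM; lra.
    rewrite [leRHS]mulrDl lerD2r.
    apply: (@le_trans _ _ (A * (e + eta))).
      rewrite /A; nra.
    by rewrite ler_peMr ?mulr_ge0 ?addr_ge0// expk_ge1.
  apply: (@solution_dist N N' f b b') => //.
  - by rewrite s0 (le_trans s1).
  - by rewrite addr_ge0// mulr_ge0.
  - by apply: bv; rewrite s0.
  - move=> z /andP[z0 zs].
    have zt : 0 <= z <= t by rewrite z0 (le_trans zs).
    have ee : 0 <= c j * expR (2 * k * z) by rewrite mulr_ge0 ?expR_ge0.
    have ijr' : (i.+1 + j <= r)%N by rewrite addSnnS.
    have Bv' : gball N o i.+1 v by apply: gballS Bv.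
    have := @drift_dist R phi psi L M L0 phiL psiL phiM N N' f
        (fun u => path_at (x u) z) (fun u => path_at (x' u) z) v
        _ e eta ee e0 (nc _ _ ir Bv) _ (ih i.+1 _ ijr' Bv' _ zt) mv.
    rewrite -kE => h; apply: (le_trans (h _)).
      move=> u vu; have Bu : gball N o i.+1 u by exact: gball_step vu.
      split; first exact: (ih i.+1).
      have ir' : (i.+1 <= r)%N by [].
      by have [] := cl u (gballS ir' Bu).
    by rewrite le_eqVlt; apply/orP; left; apply/eqP; lra.
move=> s st; have /andP[s0 s1] := st.
apply: (le_trans (key r 0%N o _ (gball_root _ _ _) s st)) => //.
apply: (@le_trans _ _ (c r * expR (2 * k * T))).
  rewrite ler_wpM2l// ler_expR ler_wpM2l ?mulr_ge0//.
  exact: le_trans tT.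
by rewrite /c /stab_coef /stab_tail -/A; lra.
Qed.

End dynamics.

(** * Existence of solutions *)

(** Nested intervals: [u n - 2 c / 2 ^ n] is nondecreasing and
    [u n + 2 c / 2 ^ n] is nonincreasing. *)
Lemma geometric_limit (R : realType) (u : nat -> R) (c : R) :
  (forall n, `|u n.+1 - u n| <= c / 2 ^+ n) ->
  exists g, forall n, `|u n - g| <= 2 * c / 2 ^+ n.
Proof.
move=> uc.
have c2 n : c / 2 ^+ n.+1 = c / 2 ^+ n / 2 by rewrite exprS invfM; lra.
have c0 n : 0 <= c / 2 ^+ n by exact: le_trans (uc n).
pose lo n := u n - 2 * (c / 2 ^+ n); pose hi n := u n + 2 * (c / 2 ^+ n).
have loS n : lo n <= lo n.+1.
  by rewrite /lo c2; have := uc n; rewrite ler_norml => /andP[]; lra.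
have hiS n : hi n.+1 <= hi n.
  by rewrite /hi c2; have := uc n; rewrite ler_norml => /andP[]; lra.
have loM : {homo lo : m n / (m <= n)%N >-> m <= n}.
  by apply: homo_leq => //; exact: le_trans.
have hiM : {homo hi : m n / (m <= n)%N >-> n <= m}.
  by apply: homo_leq => // y x z h1 h2; exact: le_trans h2 h1.
have lohi m n : lo m <= hi n.
  apply: (@le_trans _ _ (lo (maxn m n))); first exact: loM (leq_maxl _ _).
  apply: (@le_trans _ _ (hi (maxn m n))); last exact: hiM (leq_maxr _ _).
  by rewrite /lo /hi; have := c0 (maxn m n); lra.
exists (sup (range lo)) => n.
have : lo n <= sup (range lo).
  apply: ub_le_sup; last by exists n.
  by exists (hi 0%N) => _ [m _ <-].
have : sup (range lo) <= hi n.
  by apply: ge_sup; [by exists (lo 0%N), 0%N|move=> _ [m _ <-]].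
by rewrite /lo /hi ler_norml => *; apply/andP; split; lra.
Qed.

Lemma uniform_limit_within (R : realType) (t : R) (F : nat -> R -> R)
    (g : R -> R) (a : nat -> R) :
  (forall n, {within `[0, t], continuous (F n)}) ->
  (forall e, 0 < e -> exists n, a n < e) ->
  (forall n s, 0 <= s <= t -> `|F n s - g s| <= a n) ->
  {within `[0, t], continuous g}.
Proof.
move=> cF a0 Fg; apply/subspace_continuousP => s /= st.
apply/cvgrPdist_lt => e e0.
have e3 : 0 < e / 3 by rewrite divr_gt0.
have [n an] := a0 _ e3.
have /subspace_continuousP/(_ s st)/cvgrPdist_lt/(_ _ e3) h := cF n.
near=> y; have yt : `[0, t]%classic y by near: y; exact: withinT.
have h1 := Fg n s; have h2 := Fg n y.
rewrite /= !in_itv/= in st yt.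
have h3 : `|F n s - F n y| < e / 3 by near: y; exact: h.
have -> : g s - g y = (g s - F n s) + (F n s - F n y) + (F n y - g y) by lra.
rewrite (le_lt_trans (ler_normD _ _))//.
have := ler_normD (g s - F n s) (F n s - F n y).
have := h1 st; have := h2 yt; rewrite (distrC (F n s)); lra.
Unshelve. all: by end_near. Qed.

Section picard.
Context {R : realType}.
Variables (T k : R).
Hypothesis k0 : 0 <= k.
Implicit Types x y : nat -> path_space T.

(** Picard iteration for infinitely many coordinates. The weight [c v] may be
    unbounded in [v], so that no norm on the whole family is needed: the iteration
    converges coordinate by coordinate, at a geometric rate. *)
Lemma picard (F : (nat -> path_space T) -> nat -> path_space T)
    (c : nat -> R) x0 : (forall v, 0 <= c v) ->
  (forall v t, 0 <= t <= T ->
    `|path_at (F x0 v) t - path_at (x0 v) t| <= c v * expR (2 * k * t)) ->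
  (forall x y a, 0 <= a ->
    (forall v t, 0 <= t <= T ->
      `|path_at (x v) t - path_at (y v) t| <= a * c v * expR (2 * k * t)) ->
    forall v t, 0 <= t <= T ->
      `|path_at (F x v) t - path_at (F y v) t| <=
        a / 2 * c v * expR (2 * k * t)) ->
  exists x, F x = x.
Proof.
move=> c0 F0 FF; pose X n := iter n F x0.
have XS n v t : 0 <= t <= T -> `|path_at (X n.+1 v) t - path_at (X n v) t| <=
    (2 ^+ n)^-1 * c v * expR (2 * k * t).
  elim: n v t => [|n ih] v t tT; first by rewrite expr0 invr1 mul1r F0.
  by rewrite exprS invfM [_^-1 * _]mulrC; apply: FF.
(* the pointwise limits of the iterates *)
have /choice[g gP] : forall vt : nat * R, exists g, 0 <= vt.2 <= T -> forall n,
    `|path_at (X n vt.1) vt.2 - g| <=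
      2 * (c vt.1 * expR (2 * k * vt.2)) / 2 ^+ n.
  move=> [v t] /=.
  have [tT|] := boolP (0 <= t <= T); last by exists 0.
  have [|g gP] := @geometric_limit R (fun n => path_at (X n v) t)
    (c v * expR (2 * k * t)); last by exists g.
  by move=> n; rewrite mulrC mulrA; exact: XS.
have half (a e : R) : 0 < e -> exists n, a / 2 ^+ n < e.
  move=> e0; have [n an] : exists n, a / e < n%:R.
    by exists (Num.truncn (a / e)).+1; exact: truncnS_gt.
  exists n; rewrite ltr_pdivrMr ?exprn_gt0// mulrC -ltr_pdivrMr//.
  by rewrite (lt_trans an)// -natrX ltr_nat ltn_expl.
have expT t : 0 <= t <= T -> expR (2 * k * t) <= expR (2 * k * T).
  by move=> /andP[? ?]; rewrite ler_expR ler_wpM2l// mulr_ge0.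
have cg v : {within `[0, T], continuous (fun t => g (v, t))}.
  apply: (@uniform_limit_within R T (fun n => path_at (X n v)) _
    (fun n => 2 * (c v * expR (2 * k * T)) / 2 ^+ n)).
  - by move=> n; exact: path_at_continuous.
  - by move=> e e0; exact: half.
  - move=> n s sT; apply: (le_trans (gP (v, s) sT n)) => /=.
    rewrite ler_wpM2r ?invr_ge0 ?exprn_ge0// ler_wpM2l// ler_wpM2l//.
    exact: expT.
have /choice[x xP] v := path_ex (cg v).
exists x; apply/funext => v; apply: path_ext => t tT.
apply/eqP; rewrite -subr_eq0 -normr_le0; apply/ler_addgt0Pr => e e0.
rewrite add0r.
have [n hn] := half (4 * (c v * expR (2 * k * t))) e e0.
have h1 : `|path_at (F x v) t - path_at (X n.+1 v) t| <=
    2 / 2 ^+ n / 2 * c v * expR (2 * k * t).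
  apply: FF => //.
  move=> w s sT; rewrite xP// distrC (le_trans (gP (w, s) sT n))//=.
  by rewrite le_eqVlt; apply/orP; left; apply/eqP; lra.
have h2 := gP (v, t) tT n.+1; rewrite /= in h2.
rewrite -(subrK (path_at (X n.+1 v) t) (path_at (F x v) t)) -addrA.
rewrite (le_trans (ler_normD _ _))// xP// (le_trans (lerD h1 h2))//.
have h3 : 0 <= c v * expR (2 * k * t) / 2 ^+ n.
  by rewrite mulr_ge0 ?invr_ge0 ?exprn_ge0// mulr_ge0// expR_ge0.
by rewrite exprS invfM; lra.
Qed.

End picard.

Section existence.
Context {R : realType}.
Variables (phi : R * R * R * R -> R) (psi : R * R -> R) (L M T : R).
Hypothesis L0 : 0 < L.
Hypothesis phiL : forall p q, `|phi p - phi q| <= L * `|p - q|.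
Hypothesis psiL : forall p q, `|psi p - psi q| <= L * `|p - q|.
Hypothesis phiM : forall p, `|phi p| <= M.
Hypothesis T0 : 0 < T.
Notation mu := (@lebesgue_measure R).
Implicit Types (N : network R) (x : nat -> path_space T).

Lemma integral_map_ex (h : (nat -> path_space T) -> nat -> R -> R)
    (a : nat -> R) (b : nat -> path_space T) :
  (forall x v, {within `[0, T], continuous (h x v)}) ->
  exists F : (nat -> path_space T) -> nat -> path_space T,
    forall x v t, 0 <= t <= T -> path_at (F x v) t =
      a v + \int[mu]_(s in `[0, t]) h x v s + path_at (b v) t.
Proof.
move=> ch.
have /choice[F FP] : forall xv : (nat -> path_space T) * nat,
    exists f : path_space T, forall t, 0 <= t <= T -> path_at f t =
      a xv.2 + \int[mu]_(s in `[0, t]) h xv.1 xv.2 s + path_at (b xv.2) t.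
  move=> [x v]; apply: path_ex => s /=.
  apply: cvgD; last exact: path_at_continuous.
  apply: cvgD; first exact: cvg_cst.
  apply: (@parameterized_integral_continuous R 0 T (h x v)); first exact: ltW.
  exact: continuous_itv_integrable.
by exists (fun x v => F (x, v)) => x v t tT; rewrite (FP (x, v)).
Qed.

Lemma integral_map_contract (h h' : R -> R) (k a b c t : R) : 0 <= t -> 0 <= a ->
  {within `[0, t], continuous h} -> {within `[0, t], continuous h'} ->
  (forall s, 0 <= s <= t -> `|h s - h' s| <= k * (a * expR (2 * k * s))) ->
  `|b + \int[mu]_(s in `[0, t]) h s + c - (b + \int[mu]_(s in `[0, t]) h' s + c)|
    <= a / 2 * expR (2 * k * t).
Proof.
move=> t0 a0 ch ch' hh.
have -> (p q : R) : b + p + c - (b + q + c) = p - q by lra.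
rewrite -RintegralB//; try exact: continuous_itv_integrable.
have := @le_Rintegral_expR R (fun s => h s - h' s) 0 a k t t0 a0.
rewrite mul0r add0r; apply; last by move=> s st; rewrite add0r hh.
by move=> y; apply: cvgB; [exact: ch|exact: ch'].
Qed.

(** The interaction displaces a path by at most [M T], uniformly in the vertex, but
    the paths without interaction may be as large as the noise. The iteration is
    therefore run twice: first for [psi] alone, where the vertices are decoupled
    and each one has its own weight, then for the full drift, from the result of
    the first run and with the same weight at all vertices. *)
Theorem solution_ex N (b : nat -> path_space T) :
  exists x, forall v, solution phi psi N (fun v => path_at (b v)) x v.
Proof.
have T0' : 0 <= T by exact: ltW.
pose k := 2 * L; have k0 : 0 <= k by rewrite mulr_ge0// ltW.
have kL (a : R) : 0 <= a -> L * a <= k * a.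
  by move=> a0; rewrite ler_wpM2r// /k; have := ltW L0; lra.
have ek (s : R) : 0 <= s -> 1 <= expR (2 * k * s).
  by move=> s0; rewrite -expR0 ler_expR mulr_ge0// mulr_ge0.
have cpsi x v : {within `[0, T],
    continuous (fun s => psi (path_at (x v) s, media N v))}.
  by move=> s; apply: (psi_cvg L0 psiL); exact: path_at_continuous.
have cdrift x v := @drift_continuous _ _ _ _ L0 phiL psiL T N x v.
have [F0 F0P] := @integral_map_ex (fun x v s => psi (path_at (x v) s, media N v))
  (init N) b cpsi.
have [F FP] := @integral_map_ex
  (fun x v s => drift phi psi N (fun u => path_at (x u) s) v) (init N) b cdrift.
have [z zE] : exists z, F0 z = z.
  apply: (@picard R T k k0 F0 (fun v => sup_dist (F0 b v) (b v)) b).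
  - by move=> v; exact: sup_dist_ge0.
  - move=> v t tT; rewrite (le_trans (path_at_sup_dist _ _ tT))//.
    by rewrite ler_peMr ?sup_dist_ge0// ek//; case/andP: tT.
  - move=> x y a a0 xy v t tT; rewrite !F0P//.
    have /andP[t0 tT'] := tT.
    have ac0 : 0 <= a * sup_dist (F0 b v) (b v) by rewrite mulr_ge0// sup_dist_ge0.
    rewrite [a / 2 * _]mulrAC.
    apply: (@integral_map_contract (fun s => psi (path_at (x v) s, media N v))
      (fun s => psi (path_at (y v) s, media N v)) k _ (init N v)
      (path_at (b v) t) t t0 ac0).
    + exact: within_continuous_itvS (cpsi _ _).
    + exact: within_continuous_itvS (cpsi _ _).
    + move=> s /andP[s0 st]; apply: (le_trans _ (kL _ _)); last first.
        by rewrite mulr_ge0 ?expR_ge0.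
      apply: (psi_dist L0 psiL); first by apply: xy; rewrite s0 (le_trans st).
      by rewrite subrr normr0 mulr_ge0 ?expR_ge0.
have M0 : 0 <= M by exact: M_ge0 phiM.
have MT0 : 0 <= 2 * M * T by rewrite mulr_ge0// mulr_ge0.
have [x xE] : exists x, F x = x.
  apply: (@picard R T k k0 F (fun v => 2 * M * T) z) => //.
  - move=> v t tT; have /andP[t0 tT'] := tT.
    rewrite -{2}zE F0P// FP//.
    have := @le_Rintegral_expR R (fun s => drift phi psi N (fun u => path_at (z u) s) v
      - psi (path_at (z v) s, media N v)) M 0 k t t0 (lexx _).
    rewrite RintegralB//; last 2 first.
    + apply: continuous_itv_integrable.
      exact: within_continuous_itvS (cdrift _ _).
    + apply: continuous_itv_integrable.
      exact: within_continuous_itvS (cpsi _ _).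
    have -> (p q a c : R) : a + p + c - (a + q + c) = p - q by lra.
    move=> h; apply: (le_trans (h _ _)).
    + move=> s; apply: cvgB; first exact: (within_continuous_itvS tT' (cdrift _ _)).
      exact: (within_continuous_itvS tT' (cpsi _ _)).
    + move=> s st; rewrite mul0r mulr0 addr0 driftE addrK.
      apply: (le_trans (ler_norm_sum _ _ _)).
      apply: (@le_trans _ _ (\sum_(u <- nbs N v) pw N v u * M)).
        rewrite big_seq [leRHS]big_seq; apply: ler_sum => u uw.
        by rewrite normrM (ger0_norm (pw_ge0 uw)) ler_wpM2l ?pw_ge0.
      by rewrite -mulr_suml ler_piMl// pw_sum_le1.
    + rewrite mul0r mul0r addr0.
      have h1 : M * t <= M * T by rewrite ler_wpM2l.
      have h0 : 0 <= M * T by rewrite mulr_ge0.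
      by rewrite (le_trans h1)//; have := ek _ t0; nra.
  - move=> x y a a0 xy v t tT; rewrite !FP//.
    have /andP[t0 tT'] := tT.
    have ac0 : 0 <= a * (2 * M * T) by rewrite mulr_ge0.
    rewrite [a / 2 * _]mulrAC.
    apply: (@integral_map_contract
      (fun s => drift phi psi N (fun u => path_at (x u) s) v)
      (fun s => drift phi psi N (fun u => path_at (y u) s) v)
      k _ (init N v) (path_at (b v) t) t t0 ac0).
    + exact: within_continuous_itvS (cdrift _ _).
    + exact: within_continuous_itvS (cdrift _ _).
    + move=> s /andP[s0 st]; have sT : 0 <= s <= T by rewrite s0 (le_trans st).
      have ee : 0 <= a * (2 * M * T) * expR (2 * k * s).
        by rewrite mulr_ge0// expR_ge0.
      have := @drift_dist R phi psi L M L0 phiL psiL phiM N N id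
        (fun u => path_at (x u) s) (fun u => path_at (y u) s) v
        _ 0 0 ee (lexx _) (nbs_close_id _ _).
      rewrite mul0r add0r addr0 subrr normr0; apply => //; last exact: xy.
      by move=> u _; rewrite subrr normr0; split=> //; exact: xy.
by exists x => v t tT; rewrite -{1}xE FP.
Qed.

End existence.

(** * Dyadic grids and separability of the path space *)

Section dyadic.
Context {R : realType}.
Implicit Types (h : R -> R) (s t T c e : R).

Lemma within_itv_near h t s e : {within `[0, t], continuous h} -> 0 <= s <= t ->
  0 < e -> exists2 d, 0 < d &
    forall y, 0 <= y <= t -> `|s - y| < d -> `|h s - h y| < e.
Proof.
move=> /subspace_continuousP ch st e0.
have sin : `[0, t]%classic s by rewrite /= in_itv.
have /cvgrPdist_lt/(_ _ e0) := ch _ sin.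
rewrite near_withinE => /nbhs_ballP[d /= d0 dP].
exists d => // y yt sy; apply: dP => //.
Qed.

Lemma within_itv_unif h t e : {within `[0, t], continuous h} -> 0 < e ->
  exists2 d, 0 < d & forall x y, 0 <= x <= t -> 0 <= y <= t -> `|x - y| < d ->
    `|h x - h y| < e.
Proof.
move=> ch e0; have e2 : 0 < e / 2 by rewrite divr_gt0.
pose P (d x : R) := forall y, 0 <= x <= t -> 0 <= y <= t -> `|x - y| < d ->
  `|h x - h y| < e.
have : \forall d \near 0^'+, `[0, t]%classic `<=` P d.
  apply: (compact_near_coveringP _).1; first exact: segment_compact.
  move=> x; rewrite /= in_itv/= => xt.
  have [d d0 dP] := within_itv_near ch xt e2.
  have d2 : 0 < d / 2 by rewrite divr_gt0.
  near=> z r => y zt yt zy.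
  have xz : `|x - z| < d / 2 by near: z; exact: nbhsx_ballx.
  have rd : r < d / 2 by near: r; exact: nbhs_right_lt.
  have hz : `|h x - h z| < e / 2 by apply: dP => //; rewrite (lt_trans xz)//; lra.
  have hy : `|h x - h y| < e / 2.
    apply: dP => //; rewrite -(subrK z x) -addrA (le_lt_trans (ler_normD _ _))//.
    by have := lt_trans zy rd; lra.
  rewrite -(subrK (h x) (h z)) -addrA (le_lt_trans (ler_normD _ _))//.
  by rewrite distrC; lra.
move=> [d /= d0 dP]; exists (d / 2); first by rewrite divr_gt0.
move=> x y xt yt xy; apply: (dP (d / 2)) => //=.
- by rewrite sub0r normrN gtr0_norm ?divr_gt0//; lra.
- by rewrite divr_gt0.
Unshelve. all: by end_near. Qed.

(** The left end point of the cell of the grid of mesh [t / n] that contains [s]. *)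
Definition grid t (n : nat) s : R := t * (Num.truncn (s / t * n%:R))%:R / n%:R.

Lemma grid_le t n s : 0 < t -> 0 <= s <= t -> (0 < n)%N ->
  [/\ 0 <= grid t n s, grid t n s <= s, `|s - grid t n s| < t / n%:R &
     (Num.truncn (s / t * n%:R) <= n)%N].
Proof.
move=> t0 /andP[s0 st] n0; have n0' : 0 < n%:R :> R by rewrite ltr0n.
set i := Num.truncn _.
have q0 : 0 <= s / t * n%:R by rewrite !mulr_ge0// invr_ge0 ltW.
have i1 : i%:R <= s / t * n%:R by rewrite truncn_le.
have i2 : s / t * n%:R < i.+1%:R by exact: truncnS_gt.
have gs : grid t n s <= s.
  rewrite /grid -/i ler_pdivrMr// mulrC -ler_pdivlMr//.
  by rewrite (le_trans i1)// mulrAC.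
split => //.
- by rewrite /grid mulr_ge0 ?invr_ge0// mulr_ge0// ltW.
- rewrite ger0_norm ?subr_ge0// ltrBlDr /grid -/i -mulrDl.
  rewrite ltr_pdivlMr// -{1}[t]mulr1 -mulrDr -ltr_pdivrMl//.
  by rewrite addrC natr1 mulrA [_^-1 * _]mulrC.
- rewrite -(ler_nat R) (le_trans i1)// ler_piMl ?ler0n//.
  by rewrite ler_pdivrMr// mul1r.
Qed.

Lemma ex_mesh t e : 0 < t -> 0 < e -> exists m, t / 2 ^+ m < e.
Proof.
move=> t0 e0; pose n := (Num.truncn (t / e)).+1; exists n.
rewrite ltr_pdivrMr ?exprn_gt0// mulrC -ltr_pdivrMr//.
rewrite (@lt_trans _ _ n%:R)//; first exact: truncnS_gt.
by rewrite -natrX ltr_nat ltn_expl.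
Qed.

(** Reduces a bound over an interval to countably many points, for the
    measurability of suprema of paths. *)
Lemma le_dyadic h t c : 0 < t -> {within `[0, t], continuous h} ->
  (forall m i, (i <= 2 ^ m)%N -> h (t * i%:R / (2 ^ m)%:R) <= c) ->
  forall s, 0 <= s <= t -> h s <= c.
Proof.
move=> t0 ch hc s st; rewrite leNgt; apply/negP => cs.
have e0 : 0 < h s - c by rewrite subr_gt0.
have [d d0 dP] := within_itv_near ch st e0.
have [m md] := ex_mesh t0 d0.
have n0 : (0 < 2 ^ m)%N by rewrite expn_gt0.
have [g0 gs sg gi] := grid_le t0 st n0.
have /andP[s0 st'] := st.
have := dP (grid t (2 ^ m) s); rewrite g0 (le_trans gs)// => /(_ isT).
rewrite (lt_trans sg) ?natrX// => /(_ isT).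
have := hc _ _ gi; rewrite -/(grid _ _ _) => h1.
by rewrite ltr_norml => /andP[_]; lra.
Qed.

End dyadic.

Section separability.
Context {R : realType} {T : R}.
Hypothesis T0 : 0 < T.
Notation C := (path_space T).

(** A code consists of a precision [m], a number [n] and the values of a step function
    on [n.+1] cells, in multiples of [1 / m.+1]. One half of the error [2 / m.+1] is
    for the oscillation of [f] in a cell, the other for rounding its values. *)
Definition has_code (c : nat * nat * seq int) (f : C) : Prop :=
  forall t, 0 <= t <= T ->
    `|path_at f t -
      (nth 0 c.2 (Num.truncn (t / T * c.1.2.+1%:R)))%:~R / c.1.1.+1%:R| <=
    2 / c.1.1.+1%:R.

Lemma has_code_ex (f : C) (m : nat) : exists n s, has_code (m, n, s) f.
Proof.
have m0 : 0 < m.+1%:R :> R by rewrite ltr0n.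
have [d d0 dP] := within_itv_unif (@path_at_continuous _ _ f)
  (divr_gt0 ltr01 m0).
pose n := Num.truncn (T / d).
have nd : T / n.+1%:R < d.
  by rewrite ltr_pdivrMr// mulrC -ltr_pdivrMr//; exact: truncnS_gt.
exists n, (mkseq (fun i => Num.floor (path_at f (T * i%:R / n.+1%:R) * m.+1%:R)) n.+2).
move=> t tT /=; have [g0 gt tg gi] := grid_le T0 tT (ltn0Sn n).
rewrite nth_mkseq// -/(grid T n.+1 t).
set x := path_at f (grid _ _ _).
have h1 : `|path_at f t - x| < 1 / m.+1%:R.
  apply: dP => //; last exact: lt_trans tg nd.
  by rewrite g0 (le_trans gt)//; case/andP: tT.
have h2 : `|x - (Num.floor (x * m.+1%:R))%:~R / m.+1%:R| <= 1 / m.+1%:R.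
  have := floor_itv (x * m.+1%:R) => /andP[f1 f2].
  rewrite ger0_norm; last by rewrite subr_ge0 ler_pdivrMr.
  rewrite -[x in x - _](mulfK (lt0r_neq0 m0)) -mulrBl ler_pM2r ?invr_gt0//.
  by rewrite lerBlDl -[1]/(1%:~R) -intrD ltW.
rewrite -(subrK x (path_at f t)) -addrA (le_trans (ler_normD _ _))//.
by rewrite -[2](natr1 1) mulrDl lerD// ltW.
Qed.

(** There are countably many codes, and two paths with the same code are close: one
    path for each code that occurs is a dense sequence. *)
Lemma path_separable :
  exists q : nat -> C, forall f e, 0 < e -> exists i, sup_dist f (q i) < e.
Proof.
have /choice[r rP] : forall c, exists g : C, forall f, has_code c f -> has_code c g.
  move=> c; have [[f fc]|h] := pselect (exists f, has_code c f).
    by exists f.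
  by exists point => f fc; case: h; exists f.
exists (fun i : nat => r (odflt (0%N, 0%N, [::])
  (choice.unpickle i : option (nat * nat * seq int)))) => f e e0.
pose m := Num.truncn (4 / e).
have [n [s fc]] := has_code_ex f m.
exists (choice.pickle (m, n, s)); rewrite choice.pickleK/=.
have := rP _ _ fc => gc.
have m0 : 0 < m.+1%:R :> R by rewrite ltr0n.
apply: (@le_lt_trans _ _ (4 / m.+1%:R)).
  apply: sup_dist_le => [|t tT]; first by rewrite mulr_ge0// invr_ge0.
  have := fc t tT; have := gc t tT; rewrite /=.
  set y := (_%:~R / _) => h1 h2.
  rewrite -(subrK y (path_at f t)) -addrA (le_trans (ler_normD _ _))//.
  have e4 : 4 = 2 + 2 :> R by lra.
  by rewrite distrC in h1; rewrite e4 mulrDl lerD.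
by rewrite ltr_pdivrMr// mulrC -ltr_pdivrMr//; exact: truncnS_gt.
Qed.

End separability.

(** * Measurability of random paths *)

Section finite_balls.
Context {R : realType}.
Implicit Types (N : network R).

Lemma gball_finite N o r : finite_set (gball N o r).
Proof.
elim: r => [|r ih]; first by apply: (sub_finite_set _ (finite_set1 o)) => v /gball0E ->.
have := @bigcup_finite _ _ (gball N o r) (fun u => [set v | adj N u v]) ih
  (fun u _ => adj_locfin N u).
move=> h; apply: (@sub_finite_set _ _ ([set o] `|` \bigcup_(u in gball N o r)
  [set v | adj N u v])).
  by move=> v /gballSE[->|[u Bu uv]]; [left|right; exists u].
by rewrite finite_setU.
Qed.

Lemma finite_set_bounded (A : set nat) : finite_set A ->
  exists n, forall u, A u -> (u < n)%N.
Proof.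
move=> Af; exists (\max_(u <- fset_set A) u).+1 => u Au.
by rewrite ltnS; apply: leq_bigmax_seq => //; rewrite in_fset_set// inE.
Qed.

End finite_balls.

Lemma countable_factor_measurable d (S : measurableType d) (I : countType)
    d' (S' : measurableType d') (h : S -> I) (g : I -> S') :
  (forall i, measurable (h @^-1` [set i])) -> measurable_fun setT (g \o h).
Proof.
move=> mh _ Y mY; rewrite setTI.
have -> : (g \o h) @^-1` Y = \bigcup_i (if `[< Y (g i) >] then h @^-1` [set i] else set0).
  apply/seteqP; split=> [w Yw|w [i _]].
    by exists (h w) => //; case: asboolP.
  by case: asboolP => // Yi /= ->.
apply: countable_bigcupT_measurable; first exact: countableP.
by move=> i; case: ifP.
Qed.

Section measurable_paths.
Context {R : realType} {T : R} {d : measure_display} {S : measurableType d}.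
Hypothesis T0 : 0 < T.
Notation C := (path_space T).

(** By continuity the times can be restricted to dyadic multiples of [t]. Only times
    up to [t] enter, as needed for adapted processes. *)
Lemma measurable_path_near (X : S -> C) (t : R) (p : C) (c : R) : 0 <= t <= T ->
  (forall s, 0 <= s <= t -> measurable_fun setT (fun w => path_at (X w) s)) ->
  measurable [set w | forall s, 0 <= s <= t ->
    `|path_at (X w) s - path_at p s| <= c].
Proof.
move=> /andP[t0 tT] mX.
have m1 s : 0 <= s <= t ->
    measurable [set w | `|path_at (X w) s - path_at p s| <= c].
  move=> st; have mf : measurable_fun setT (fun w => `|path_at (X w) s - path_at p s|).
    by apply: measurableT_comp => //; apply: measurable_funB => //; exact: mX.
  have := mf measurableT `]-oo, c]%classic (measurable_itv _).
  rewrite setTI => h.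
  have -> : [set w | `|path_at (X w) s - path_at p s| <= c] =
      (fun w => `|path_at (X w) s - path_at p s|) @^-1` `]-oo, c]%classic.
    by apply/seteqP; split=> w /=; rewrite in_itv.
  exact: h.
move: t0; rewrite le_eqVlt => /predU1P[t0|t0].
  have := m1 0; rewrite -t0 lexx => /(_ isT) h.
  have -> : [set w | forall s, 0 <= s <= 0 -> `|path_at (X w) s - path_at p s| <= c]
      = [set w | `|path_at (X w) 0 - path_at p 0| <= c].
    apply/seteqP; split=> [w /= /(_ 0)|w /= h' s]; first by rewrite lexx; exact.
    by move=> /le_anti <-.
  exact: h.
have dt m i : (i <= 2 ^ m)%N -> 0 <= t * i%:R / (2 ^ m)%:R <= t.
  move=> im; have m0 : 0 < (2 ^ m)%:R :> R by rewrite ltr0n expn_gt0.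
  apply/andP; split; first by rewrite divr_ge0// mulr_ge0// ltW.
  by rewrite ler_pdivrMr// ler_pM2l// ler_nat.
have -> : [set w | forall s, 0 <= s <= t ->
    `|path_at (X w) s - path_at p s| <= c] =
  \bigcap_m \bigcap_i [set w | (i <= 2 ^ m)%N ->
    `|path_at (X w) (t * i%:R / (2 ^ m)%:R) - path_at p (t * i%:R / (2 ^ m)%:R)| <= c].
  apply/seteqP; split=> [w h m _ i _ /= /dt|w h]; first exact: h.
  apply: (@le_dyadic R (fun s => `|path_at (X w) s - path_at p s|)) => //.
    exact: within_continuous_itvS (@path_dist_continuous _ _ _ _).
  by move=> m i im; exact: (h m I i I).
apply: bigcapT_measurable => m; apply: bigcapT_measurable => i.
have [im|im] := leqP i (2 ^ m).
  have h := m1 _ (dt m i im).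
  have -> : [set w | true -> `|path_at (X w) (t * i%:R / (2 ^ m)%:R) -
      path_at p (t * i%:R / (2 ^ m)%:R)| <= c] = [set w | `|path_at (X w)
      (t * i%:R / (2 ^ m)%:R) - path_at p (t * i%:R / (2 ^ m)%:R)| <= c].
    by apply/seteqP; split=> w /=; [exact|].
  exact: h.
have -> : [set w | false -> `|path_at (X w) (t * i%:R / (2 ^ m)%:R) -
    path_at p (t * i%:R / (2 ^ m)%:R)| <= c] = setT by apply/seteqP.
exact: measurableT.
Qed.

(** An open set is a countable union of closed balls with centres in a dense
    sequence, because the path space is separable. *)
Lemma borel_path_measurable (X : S -> C) :
  (forall s, 0 <= s <= T -> measurable_fun setT (fun w => path_at (X w) s)) ->
  measurable_fun setT (X : S -> borel C).
Proof.
move=> mX; apply: (@measurability _ _ S (borel C) setT X (@open C)) => //.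
move=> _ [U oU <-]; rewrite setTI.
have [q qP] := path_separable T0.
pose good (im : nat * nat) := forall g : C, sup_dist g (q im.1) <= im.2.+1%:R^-1 -> U g.
have -> : X @^-1` U = \bigcup_im (if `[< good im >] then
    [set w | forall s, 0 <= s <= T ->
      `|path_at (X w) s - path_at (q im.1) s| <= im.2.+1%:R^-1] else set0).
  apply/seteqP; split => [w /= Uw|w [[i m] _]]; last first.
    case: asboolP => // gi /= h; apply: gi; apply: sup_dist_le => //.
  have /nbhs_ballP[e /= e0 eU] : nbhs (X w) U by exact: open_nbhs_nbhs.
  pose m := Num.truncn (2 / e).
  have m0 : 0 < m.+1%:R :> R by rewrite ltr0n.
  have me : 2 / m.+1%:R < e.
    by rewrite ltr_pdivrMr// mulrC -ltr_pdivrMr//; exact: truncnS_gt.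
  have m0' : 0 < m.+1%:R^-1 :> R by rewrite invr_gt0.
  have [i iP] := qP (X w) _ m0'.
  exists (i, m) => //; case: asboolP => [_|]; last first.
    case=> g /= gi; apply: eU; rewrite ball_sup_dist.
    have := @metric_triangle _ C (X w) (q i) g.
    rewrite -![mdist _ _]/(sup_dist _ _) (sup_distC (q i)) => /le_lt_trans; apply.
    by move: iP gi me => /=; set y := m.+1%:R^-1; lra.
  by move=> s sT /=; rewrite (le_trans (path_at_sup_dist _ _ sT))// ltW.
apply: countable_bigcupT_measurable => [|[i m]]; first exact: countableP.
case: ifP => // _; apply: measurable_path_near => //.
by rewrite lexx ltW.
Qed.

End measurable_paths.

Section borel_functions.
Context {R : realType}.

Lemma continuous_borel_measurable (X : ptopologicalType) (f : X -> R) :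
  continuous f -> measurable_fun setT (f : borel X -> R).
Proof.
move=> cf; apply: (measurability _ (RGenOpens.measurableE R)).
move=> _ [_ [a [b ->] <-]]; rewrite setTI; apply: sub_sigma_algebra.
by move/continuousP : cf; apply; exact: interval_open.
Qed.

Lemma path_at_sup_continuous (T : R) (s : R) : 0 <= s <= T ->
  continuous (fun f : path_space T => path_at f s).
Proof.
move=> sT f; apply: (cvgrPdist_lt (F := nbhs f) _ _).2 => e e0.
apply/nbhs_ballP; exists e => // g; rewrite ball_sup_dist /=.
exact: le_lt_trans (path_at_sup_dist _ _ sT).
Qed.

End borel_functions.

(** * The solution map *)

Section flow.
Context {R : realType}.
Variables (phi : R * R * R * R -> R) (psi : R * R -> R) (T : R).
Implicit Types (N : network R) (b : nat -> path_space T) (v o : nat).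

(** By [flow_unique] below, [flow N b] is the only solution driven by [b]. *)
Definition flow N b : nat -> path_space T :=
  get [set x | forall v, solution phi psi N (fun u => path_at (b u)) x v].

Variables (L M : R).
Hypothesis L0 : 0 < L.
Hypothesis phiL : forall p q, `|phi p - phi q| <= L * `|p - q|.
Hypothesis psiL : forall p q, `|psi p - psi q| <= L * `|p - q|.
Hypothesis phiM : forall p, `|phi p| <= M.
Hypothesis T0 : 0 < T.

Lemma flowP N b v :
  solution phi psi N (fun u => path_at (b u)) (flow N b) v.
Proof.
have [x xP] := solution_ex L0 phiL psiL phiM T0 N b.
rewrite /flow; set A := [set x | _].
have : A (get A) by apply: getPex; exists x.
exact.
Qed.

Let k := 2 * L.
Let c := stab_coef M T k.
Let e := stab_tail M T k.

Lemma tail_small (z : R) : 0 < z -> exists r, e / 2 ^+ r < z.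
Proof.
move=> z0; have e1 : 0 < e + 1.
  by rewrite ltr_wpDl// (stab_tail_ge0 phiM T0).
have [r h] := ex_mesh e1 z0; exists r; apply: lt_trans h.
by rewrite ltr_pM2r ?invr_gt0 ?exprn_gt0// ltrDl.
Qed.

(** A comparison of [x] with [flow N b] in the same network and with the same noise:
    the bound of [stability] reduces to its tail, which vanishes as [r]
    grows. Asking for the equation in the component of [o] only is what identifies the
    flow of a component with that of the network. *)
Lemma flow_unique N b (x : nat -> path_space T) o :
  (forall r v, gball N o r v -> solution phi psi N (fun u => path_at (b u)) x v) ->
  x o = flow N b o.
Proof.
move=> sx; apply: path_ext => t tT; apply/eqP; rewrite -subr_eq0 -normr_le0.
apply/ler_addgt0Pr => z z0; rewrite add0r.
have [r rz] := tail_small z0.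
have := @stability R phi psi L M T L0 phiL psiL phiM T0 k erefl N N id o r
  (fun u => path_at (b u)) (fun u => path_at (b u)) x (flow N b) 0 0 T.
rewrite lexx ltW// => /(_ isT (lexx _) (lexx _)) h.
rewrite (le_trans (h _ _ _ _ tT))//.
- by move=> v Bv; split; [exact: sx Bv|exact: flowP].
- by move=> v Bv; split=> [||s _]; rewrite subrr normr0.
- by move=> v j _ _; exact: nbs_close_id.
- by rewrite addr0 mulr0 add0r ltW.
Qed.

(** For [b = b'] in the ball this is the locality of the flow; for [r] large it is
    its continuity in the noise. *)
Lemma flow_noise_dist N b b' v r (a t : R) : 0 <= t <= T -> 0 <= a ->
  (forall u, gball N v r u -> forall s, 0 <= s <= t ->
    `|path_at (b u) s - path_at (b' u) s| <= a) ->
  forall s, 0 <= s <= t ->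
    `|path_at (flow N b v) s - path_at (flow N b' v) s| <= c * a + e / 2 ^+ r.
Proof.
move=> tT a0 bb' s st.
have := @stability R phi psi L M T L0 phiL psiL phiM T0 k erefl N N id v r
  (fun u => path_at (b u)) (fun u => path_at (b' u)) (flow N b) (flow N b') a 0 t
  tT a0 (lexx _).
rewrite addr0; apply => //.
- by move=> u _; split; exact: flowP.
- by move=> u Bu; rewrite !subrr !normr0; split=> // z zt; exact: bb'.
- by move=> u j _ _; exact: nbs_close_id.
Qed.

Section flow_measurable.
Context {d : measure_display} {S : measurableType d}.
Variables (X : S -> nat -> path_space T) (t : R).
Hypothesis tT : 0 <= t <= T.
Hypothesis mX : forall u s, 0 <= s <= t ->
  measurable_fun setT (fun w => path_at (X w u) s).

(** The noise at the first [m] vertices is rounded to a dense sequence of paths and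
    the remaining noise is replaced by a constant. The flow of the rounded noise
    takes countably many values, and it converges to the flow as [m] grows, because
    a ball contains finitely many vertices. *)
Lemma flow_measurable N v :
  measurable_fun setT (fun w => path_at (flow N (X w) v) t).
Proof.
have [q qP] := path_separable T0.
pose near (m : nat) (f : path_space T) i := forall s, 0 <= s <= t ->
  `|path_at f s - path_at (q i) s| <= m.+1%:R^-1.
have near_ex m f : exists i, `[< near m f i >].
  have m0 : 0 < m.+1%:R^-1 :> R by rewrite invr_gt0.
  have [i iP] := qP f _ m0; exists i; apply/asboolP => s /andP[s0 st].
  have sT : 0 <= s <= T by rewrite s0 (le_trans st)//; case/andP: tT.
  by rewrite (le_trans (path_at_sup_dist _ _ sT))// ltW.
(* the index of the path to which [f] is rounded *)
pose idx m f := ex_minn (near_ex m f).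
have midx m u i : measurable [set w | idx m (X w u) = i].
  have mn j : measurable [set w | near m (X w u) j].
    by apply: measurable_path_near => // s st; exact: mX.
  have -> : [set w | idx m (X w u) = i] = [set w | near m (X w u) i] `&`
      \bigcap_j (if (j < i)%N then ~` [set w | near m (X w u) j] else setT).
    apply/seteqP; split=> w /=.
      rewrite /idx; case: ex_minnP => j /asboolP nj jmin <-; split=> // l _.
      by case: ltnP => //= lj nl; have := jmin l; rewrite leqNgt lj => /(_ (asboolT nl)).
    move=> [ni nj]; rewrite /idx; case: ex_minnP => j /asboolP h jmin.
    apply/eqP; rewrite eqn_leq jmin ?asboolT// leqNgt; apply/negP => ji.
    by have := nj j I; rewrite ji.
  apply: measurableI => //; apply: bigcapT_measurable => j.
  by case: ifP => // _; exact: measurableC.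
pose b (m : nat) (s : seq nat) u : path_space T := if (u < m)%N then q (nth 0%N s u) else point.
pose h m w := mkseq (fun u => idx m (X w u)) m.
pose g m s := path_at (flow N (b m s) v) t.
apply: (@measurable_fun_cvg _ _ _ _ (fun m => g m \o h m)).
  move=> m; apply: countable_factor_measurable => s.
  have [<-|sm] := eqVneq (size s) m; last first.
    rewrite (_ : _ @^-1` _ = set0)//; apply/seteqP; split=> // w /= hs.
    by move: sm; rewrite -hs size_mkseq eqxx.
  rewrite (_ : _ @^-1` _ = \bigcap_u (if (u < size s)%N then
      [set w | idx (size s) (X w u) = nth 0%N s u] else setT)).
    by apply: bigcapT_measurable => u; case: ifP.
  apply/seteqP; split=> [w /= hs u _|w /= hw].
    by case: ltnP => //= us; rewrite -[in RHS]hs nth_mkseq.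
  apply: (@eq_from_nth _ 0%N); first by rewrite size_mkseq.
  move=> u; rewrite size_mkseq => us; rewrite nth_mkseq//.
  by have := hw u I; rewrite us.
move=> w _; apply/cvgrPdist_le => z z0.
have z2 : 0 < z / 2 by rewrite divr_gt0.
have [r rz] := tail_small z2.
have [n nP] := finite_set_bounded (gball_finite N v r).
have c0 : 0 <= c by exact: stab_coef_ge0 L0 phiM T0 _ erefl.
have c1 : 0 < c + 1 by rewrite ltr_wpDl.
have zc : 0 < z / 2 / (c + 1) by rewrite divr_gt0.
near=> m.
have mn : (n <= m)%N by near: m; exact: nbhs_infty_ge.
have mz : m.+1%:R^-1 <= z / 2 / (c + 1) :> R.
  by apply: ltW; near: m; exact: (near_infty_natSinv_lt (PosNum zc)).
have st : 0 <= t <= t by rewrite lexx andbT; case/andP: tT.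
apply: (le_trans (@flow_noise_dist N (X w) (b m (h m w)) v r m.+1%:R^-1 t tT _ _ _ st)).
- by rewrite invr_ge0.
- move=> u /nP un s ss; rewrite /b (leq_trans un mn) nth_mkseq ?(leq_trans un mn)//.
  by rewrite /idx; case: ex_minnP => j /asboolP + _; exact.
- have : (c + 1) * m.+1%:R^-1 <= z / 2 by rewrite mulrC -ler_pdivlMr.
  have : 0 <= m.+1%:R^-1 :> R by rewrite invr_ge0.
  by move: rz; set y := m.+1%:R^-1; lra.
Unshelve. all: by end_near. Qed.

End flow_measurable.

Lemma flow_borel_measurable d (S : measurableType d)
    (X : S -> nat -> path_space T) N v :
  (forall u s, 0 <= s <= T -> measurable_fun setT (fun w => path_at (X w u) s)) ->
  measurable_fun setT ((fun w => flow N (X w) v) : S -> borel (path_space T)).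
Proof.
move=> mX; apply: borel_path_measurable => // t tT.
apply: flow_measurable => // u s /andP[s0 st]; apply: mX.
by rewrite s0 (le_trans st)//; case/andP: tT.
Qed.

End flow.

(** * Independent sequences *)

Section laws.
Context {R : realType}.

Definition to_mfun d d' (S : measurableType d) (S' : measurableType d')
    (f : S -> S') (mf : measurable_fun setT f) : {mfun S >-> S'} :=
  HB.pack f (isMeasurableFun.Build _ _ _ _ _ mf).

Definition law d d' (S : measurableType d) (S' : measurableType d')
    (P : probability S R) (f : S -> S') (mf : measurable_fun setT f) :
  probability S' R := distribution P (to_mfun mf).

Lemma lawE d d' (S : measurableType d) (S' : measurableType d')
    (P : probability S R) (f : S -> S') (mf : measurable_fun setT f) A :
  law P mf A = P (f @^-1` A).
Proof. by []. Qed.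

Lemma law_lty d d' (S : measurableType d) (S' : measurableType d')
    (P : probability S R) (f : S -> S') (mf : measurable_fun setT f) :
  (law P mf setT < +oo)%E.
Proof. by rewrite lawE preimage_setT probability_setT ltry. Qed.

Lemma law_unique d (S : measurableType d) (G : set (set S))
    (m1 m2 : {measure set S -> \bar R}) : measurable = <<s G >> ->
  setI_closed G -> G setT -> (m1 setT < +oo)%E ->
  (forall A, G A -> m1 A = m2 A) -> forall A, measurable A -> m1 A = m2 A.
Proof.
move=> mG GI GT m1T m12 A mA.
apply: (@measure_unique _ _ _ G (fun=> setT)) => //.
by apply/seteqP; split=> // x _; exists 0%N.
Qed.

(** As functions of [A], both sides of the product rule are finite measures, so they
    agree once they agree on a pi-system. *)
Lemma indep_event_ext d d' (S : measurableType d) (S' : measurableType d')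
    (P : probability S R) (X : S -> S') (mX : measurable_fun setT X)
    (G : set (set S')) (D : set S) : measurable = <<s G >> ->
  setI_closed G -> G setT -> measurable D ->
  (forall A, G A -> P (X @^-1` A `&` D) = (P (X @^-1` A) * P D)%E) ->
  forall A, measurable A -> P (X @^-1` A `&` D) = (P (X @^-1` A) * P D)%E.
Proof.
move=> mG GI GT mD GD A mA.
pose m1 := measure_function_pushforward__canonical__measure_function_Measure
  (mrestr P mD) mX.
have PD : 0 <= fine (P D) by rewrite fine_ge0.
pose m2 := mscale (NngNum PD) (law P mX).
have m2E B : m2 B = (P (X @^-1` B) * P D)%E.
  by rewrite /m2 /mscale /= fineK ?fin_num_measure// muleC.
have m1E B : m1 B = P (X @^-1` B `&` D) by [].
rewrite -m1E -m2E; apply: (law_unique mG) => //.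
- rewrite m1E preimage_setT setTI.
  by rewrite (le_lt_trans (probability_le1 _ mD))// ltry.
- by move=> B GB; exact: etrans (GD B GB) (esym (m2E B)).
Qed.

End laws.

Section sequences_space.
Context {d : measure_display} (S : measurableType d).

Definition cylinders : set (set (nat -> S)) :=
  [set A | exists i B, measurable B /\ A = [set x | B (x i)]].

(** Sequences with the product sigma-algebra. *)
Definition seqm := g_sigma_algebraType cylinders.
HB.instance Definition _ := Measurable.on seqm.

Definition rectangles : set (set seqm) :=
  [set A | exists (m : nat) (E : nat -> set S), (forall i, measurable (E i)) /\
    A = [set x | forall i, (i < m)%N -> E i (x i)]].

Lemma rectanglesI : setI_closed rectangles.
Proof.
move=> _ _ [m [E [mE ->]]] [m' [E' [mE' ->]]].
exists (maxn m m'), (fun i => (if (i < m)%N then E i else setT) `&`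
  (if (i < m')%N then E' i else setT)); split.
  by move=> i; apply: measurableI; case: ifP.
apply/seteqP; split => [x [/= h h'] i _|x /= h].
  by split; case: ifP => // im; [exact: h|exact: h'].
split=> /= i im; have := h i; rewrite leq_max im ?orbT => /(_ isT)[] //.
Qed.

Lemma rectanglesT : rectangles setT.
Proof. by exists 0%N, (fun=> setT); split=> //; apply/seteqP. Qed.

Lemma measurable_rectangles : @measurable _ seqm = <<s rectangles >>.
Proof.
apply/seteqP; split; last first.
  apply: smallest_sub; first exact: sigma_algebra_measurable.
  move=> _ [m [E [mE ->]]].
  have -> : [set x : seqm | forall i, (i < m)%N -> E i (x i)] =
      \bigcap_i (if (i < m)%N then [set x : seqm | E i (x i)] else setT).
    apply/seteqP; split=> x /=.
      by move=> h i _; case: ifP => // im; exact: h.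
    by move=> h i im; have := h i I; rewrite im.
  apply: bigcapT_measurable => i; case: ifP => // _.
  by apply: sub_sigma_algebra; exists i, (E i).
apply: smallest_sub; first exact: smallest_sigma_algebra.
move=> _ [i [B [mB ->]]]; apply: sub_sigma_algebra.
exists i.+1, (fun j => if j == i then B else setT); split.
  by move=> j; case: ifP.
apply/seteqP; split=> x /= h; last by have := h i (ltnSn i); rewrite eqxx.
by move=> j _; case: eqP => // ->.
Qed.

Lemma seqm_measurable d' (S' : measurableType d') (X : S' -> nat -> S) :
  (forall i, measurable_fun setT (fun w => X w i)) ->
  measurable_fun setT (X : S' -> seqm).
Proof.
move=> mX; apply: (@measurability _ _ S' seqm setT X cylinders) => //.
move=> _ [_ [i [B [mB ->]]] <-].
exact: mX.
Qed.

Lemma coord_measurable i : measurable_fun setT (fun x : seqm => x i).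
Proof.
move=> _ B mB; rewrite setTI; apply: sub_sigma_algebra.
by exists i, B.
Qed.

End sequences_space.

Section iid.
Context {R : realType} d d' (Om : measurableType d) (S : measurableType d').
Variable P : probability Om R.
Implicit Types X Y : Om -> nat -> S.

(** Independence of the sequence, in the form that determines its law: the [E i] may
    be the whole space, so that this covers every finite set of indices. *)
Definition prod_rule X := forall (m : nat) (E : nat -> set S),
  (forall i, measurable (E i)) ->
  P [set w | forall i, (i < m)%N -> E i (X w i)] =
    (\prod_(i < m) P [set w | E i (X w i)])%E.

Lemma prod_rule_law X Y :
  (forall i, measurable_fun setT (fun w => X w i)) ->
  (forall i, measurable_fun setT (fun w => Y w i)) ->
  prod_rule X -> prod_rule Y ->
  (forall i A, measurable A -> P [set w | A (X w i)] = P [set w | A (Y w i)]) ->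
  forall A : set (seqm S), measurable A ->
    P [set w | A (X w)] = P [set w | A (Y w)].
Proof.
move=> mX mY pX pY XY A mA.
have mX' := seqm_measurable mX; have mY' := seqm_measurable mY.
have := @law_unique R _ (seqm S) _ (law P mX') (law P mY')
  (measurable_rectangles S) (@rectanglesI _ S) (rectanglesT S).
apply => //; first exact: (law_lty P mX').
move=> _ [m [E [mE ->]]].
have E1 := pX m E mE; have E2 := pY m E mE.
apply: (etrans E1); apply: (etrans _ (esym E2)).
by apply: eq_bigr => i _; exact: XY.
Qed.

(** A function of [x] that depends on the coordinates in [D] only is represented as a
    function of [mask D x]. *)
Definition mask (D : set nat) (x : nat -> S) : nat -> S :=
  fun i => if `[< D i >] then x i else point.

Lemma mask_measurable X D : (forall i, measurable_fun setT (fun w => X w i)) ->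
  measurable_fun setT ((fun w => mask D (X w)) : Om -> seqm S).
Proof.
move=> mX; apply: seqm_measurable => i; rewrite /mask; case: asboolP => // _.
Qed.

(** On rectangles the two masked sequences factor coordinate by coordinate: one of
    the two factors is constant, so its event is trivial. The pi-system argument is
    then applied to each of the two events in turn. *)
Lemma mask_indep X D : (forall i, measurable_fun setT (fun w => X w i)) ->
  prod_rule X -> forall A A' : set (seqm S), measurable A -> measurable A' ->
  P ([set w | A (mask D (X w))] `&` [set w | A' (mask (~` D) (X w))]) =
  (P [set w | A (mask D (X w))] * P [set w | A' (mask (~` D) (X w))])%E.
Proof.
move=> mX pX.
have mD := mask_measurable D mX; have mD' := mask_measurable (~` D) mX.
have rect (m : nat) (E E' : nat -> set S) : (forall i, measurable (E i)) ->
    (forall i, measurable (E' i)) ->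
    P ([set w | forall i, (i < m)%N -> E i (mask D (X w) i)] `&`
       [set w | forall i, (i < m)%N -> E' i (mask (~` D) (X w) i)]) =
    (P [set w | forall i, (i < m)%N -> E i (mask D (X w) i)] *
     P [set w | forall i, (i < m)%N -> E' i (mask (~` D) (X w) i)])%E.
  move=> mE mE'.
  pose triv (B : set S) : set S := if `[< B point >] then setT else set0.
  have trivE B x : triv B x <-> B point.
    by rewrite /triv; case: asboolP => // ?; split.
  have mtriv B : measurable (triv B) by rewrite /triv; case: ifP.
  pose F i : set S := if `[< D i >] then E i else triv (E i).
  pose F' i : set S := if `[< D i >] then triv (E' i) else E' i.
  have mF i : measurable (F i) by rewrite /F; case: ifP.
  have mF' i : measurable (F' i) by rewrite /F'; case: ifP.
  have FE i x : F i (x i) <-> E i (mask D x i).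
    by rewrite /F /mask; case: asboolP => // _; exact: trivE.
  have FE' i x : F' i (x i) <-> E' i (mask (~` D) x i).
    rewrite /F' /mask; case: asboolP => [Di|nDi].
      by case: asboolP => // _; exact: trivE.
    by case: asboolP.
  have -> : [set w | forall i, (i < m)%N -> E i (mask D (X w) i)] =
      [set w | forall i, (i < m)%N -> F i (X w i)].
    by apply/seteqP; split=> w h i im; apply/FE/h.
  have -> : [set w | forall i, (i < m)%N -> E' i (mask (~` D) (X w) i)] =
      [set w | forall i, (i < m)%N -> F' i (X w i)].
    by apply/seteqP; split=> w h i im; apply/FE'/h.
  rewrite !pX// -big_split/=.
  have -> : [set w | forall i, (i < m)%N -> F i (X w i)] `&`
      [set w | forall i, (i < m)%N -> F' i (X w i)] =
      [set w | forall i, (i < m)%N -> (F i `&` F' i) (X w i)].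
    apply/seteqP; split=> w; first by move=> [h h'] i im; split; [exact: h|exact: h'].
    by move=> h; split=> i im; have [] := h i im.
  rewrite (pX m (fun i => F i `&` F' i)) => [|i]; last exact: measurableI.
  apply: eq_bigr => i _.
  have trivP B (B' : set S) : P [set w | (triv B `&` B') (X w i)] =
      (P [set w | triv B (X w i)] * P [set w | B' (X w i)])%E.
    rewrite /triv; case: asboolP => _.
      rewrite setTI (_ : [set w | setT (X w i)] = setT)//.
      by rewrite probability_setT mul1e.
    by rewrite set0I (_ : [set w | set0 (X w i)] = set0)// measure0 mul0e.
  rewrite /F /F'; case: asboolP => _; last exact: trivP.
  by rewrite setIC trivP muleC.
move=> A A' mA mA'.
apply: (@indep_event_ext R _ _ _ (seqm S) P _ mD _ _ (measurable_rectangles S)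
  (@rectanglesI _ S) (rectanglesT S) _ _ A mA).
  by rewrite -[X in measurable X]setTI; exact: mD'.
move=> B rB.
have mB : measurable B.
  by rewrite measurable_rectangles; exact: sub_sigma_algebra.
rewrite setIC muleC.
apply: (@indep_event_ext R _ _ _ (seqm S) P _ mD' _ _ (measurable_rectangles S)
  (@rectanglesI _ S) (rectanglesT S) _ _ A' mA').
  by rewrite -[X in measurable X]setTI; exact: mD.
move: rB => [m [E [mE ->]]] _ [m' [E' [mE' ->]]].
rewrite setIC muleC.
have pad (k j : nat) (G : nat -> set S) (Z : Om -> nat -> S) : (k <= j)%N ->
    [set w | forall i, (i < k)%N -> G i (Z w i)] =
    [set w | forall i, (i < j)%N -> (if (i < k)%N then G i else setT) (Z w i)].
  move=> kj; apply/seteqP; split=> w h i ij; first by case: ifP => // ik; exact: h.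
  by have := h i (leq_trans ij kj); rewrite ij.
have := rect (maxn m m') (fun i => if (i < m)%N then E i else setT)
  (fun i => if (i < m')%N then E' i else setT).
rewrite -(pad _ _ _ (fun w => mask D (X w)) (leq_maxl m m')).
rewrite -(pad _ _ _ (fun w => mask (~` D) (X w)) (leq_maxr m m')).
by apply=> i; case: ifP.
Qed.

End iid.

(** * The sigma-algebra of the path space *)

Section independence_reindexed.
Context {d} {Om : measurableType d} {R : realType} (P : probability Om R).

(** As [s] is injective, its first [m] values form a set of [m] indices, over which the
    product of the definition of independence can be taken. *)
Lemma mutually_independent_prod (F : nat -> set (set Om)) (s : nat -> nat) :
  mutually_independent P F -> injective s ->
  forall (m : nat) (E : nat -> set Om), (forall i, F (s i) (E i)) ->
    P [set w | forall i, (i < m)%N -> E i w] = (\prod_(i < m) P (E i))%E.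
Proof.
move=> iF sinj m E FE.
have /choice[g gK] : forall v, exists i, forall j, s j = v -> i = j.
  move=> v; have [[j <-]|h] := pselect (exists j, s j = v).
    by exists j => k /sinj ->.
  by exists 0%N => j sj; case: h; exists j.
have gsK i : g (s i) = i by apply: gK.
pose J := [fset s i | i in iota 0 m]%fset.
have JP v : v \in J -> exists2 i, (i < m)%N & v = s i.
  by move=> /imfsetP[i /=]; rewrite mem_iota/= => im ->; exists i.
have inJ i : (i < m)%N -> s i \in J.
  by move=> im; apply: in_imfset; rewrite /= mem_iota.
have h := iF J (fun v => E (g v)).
have -> : [set w | forall i, (i < m)%N -> E i w] =
    \bigcap_(v in [set` J]) E (g v).
  apply/seteqP; split=> w h' => [v /= /JP[i im ->]|i im].
    by rewrite gsK; exact: h'.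
  by rewrite -(gsK i); apply: h'; exact: inJ.
rewrite h; last by move=> v /JP[i _ ->]; rewrite gsK.
rewrite (perm_big (map s (iota 0 m))); last first.
  apply: uniq_perm; [exact: fset_uniq|by rewrite map_inj_uniq ?iota_uniq|].
  move=> v; apply/idP/idP => [/JP[i im ->]|/mapP[i]].
    by apply: map_f; rewrite mem_iota.
  by rewrite mem_iota => im ->; exact: inJ.
rewrite big_map (_ : iota 0 m = index_iota 0 m); last by rewrite /index_iota subn0.
rewrite big_mkord.
by apply: eq_bigr => i _; rewrite gsK.
Qed.

(** The events are only compared outside a null event: this lets the continuous
    modification of the noise replace the Brownian motions. *)
Lemma prob_eq_off (Z A A' : set Om) : measurable Z -> P Z = 0%E ->
  measurable A -> measurable A' -> (forall w, ~ Z w -> A w <-> A' w) ->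
  P A = P A'.
Proof.
move=> mZ PZ mA mA' AA'.
have h (D : set Om) : measurable D -> P D = P (D `\` Z).
  move=> mD; have DZ : P (D `&` Z) = 0%E.
    apply/eqP; rewrite eq_le measure_ge0 andbT -PZ le_measure ?inE//.
    exact: measurableI.
  have E : P (D `&` Z `|` D `\` Z) = (P (D `&` Z) + P (D `\` Z))%E.
    apply: measureU; [exact: measurableI|exact: measurableD|].
    by apply/seteqP; split=> // w [[_ Zw] [_]].
  by rewrite setUIDK DZ add0e in E.
rewrite (h A)// (h A')//; congr (P _).
by apply/seteqP; split=> w [Aw Zw]; split=> //; apply/(AA' w Zw).
Qed.

End independence_reindexed.

Section path_sigma_algebra.
Context {R : realType} {T : R}.
Hypothesis T0 : 0 < T.
Notation C := (path_space T).

Definition evaluations : set (set C) :=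
  [set A | exists s (B : set R), [/\ 0 <= s <= T, measurable B &
    A = [set f | B (path_at f s)]]].

(** A path-valued function with measurable evaluations is Borel measurable; applied
    to the identity. *)
Lemma borel_sub (G : set (set C)) :
  (forall s, 0 <= s <= T ->
    measurable_fun setT (fun f : g_sigma_algebraType G => path_at f s)) ->
  forall A : set (borel C), measurable A -> <<s G >> A.
Proof.
move=> mG A mA.
have := @borel_path_measurable R T _ (g_sigma_algebraType G) T0 id mG measurableT A mA.
by rewrite setTI.
Qed.

Lemma borel_evaluations (A : set (borel C)) : measurable A -> <<s evaluations >> A.
Proof.
apply: borel_sub => s sT _ B mB; rewrite setTI; apply: sub_sigma_algebra.
by exists s, B.
Qed.

Definition dyadic_values (m : nat) (f : C) : nat -> R :=
  fun i => if (i <= 2 ^ m)%N then path_at f (T * i%:R / (2 ^ m)%:R) else 0.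

(** Finer grids determine coarser ones, so these sets form a pi-system, unlike the
    sets that constrain a single evaluation. *)
Definition dyadic_sets : set (set C) :=
  [set A | exists m (B : set (seqm R)), measurable B /\
     A = [set f | B (dyadic_values m f)]].

Lemma dyadic_refine m m' f : (m <= m')%N -> dyadic_values m f =
  (fun i => if (i <= 2 ^ m)%N then dyadic_values m' f (i * 2 ^ (m' - m))%N else 0).
Proof.
move=> mm'; apply/funext => i; rewrite /dyadic_values; case: ifP => // im.
have -> : (i * 2 ^ (m' - m) <= 2 ^ m')%N.
  by rewrite -{2}(subnKC mm') expnD leq_mul2r im orbT.
have E : (2 ^ m' = 2 ^ m * 2 ^ (m' - m))%N by rewrite -expnD subnKC.
congr path_at; rewrite E !natrM mulrA -mulf_div divff ?mulr1//.
Qed.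

Lemma dyadic_sets_mono m m' (B : set (seqm R)) : (m <= m')%N -> measurable B ->
  exists B' : set (seqm R), measurable B' /\
    [set f | B (dyadic_values m f)] = [set f | B' (dyadic_values m' f)].
Proof.
move=> mm' mB.
pose h (x : seqm R) : seqm R :=
  fun i => if (i <= 2 ^ m)%N then x (i * 2 ^ (m' - m))%N else 0.
have mh : measurable_fun setT h.
  apply: (@seqm_measurable _ R _ (seqm R)) => i; rewrite /h; case: leqP => _.
    exact: coord_measurable.
  exact: measurable_cst.
exists (h @^-1` B); split; first by have := mh measurableT B mB; rewrite setTI.
by apply/seteqP; split=> f /=; rewrite (dyadic_refine f mm').
Qed.

Lemma dyadic_setsI : setI_closed dyadic_sets.
Proof.
move=> _ _ [m [B [mB ->]]] [m' [B' [mB' ->]]].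
have [D [mD ->]] := dyadic_sets_mono (leq_maxl m m') mB.
have [D' [mD' ->]] := dyadic_sets_mono (leq_maxr m m') mB'.
by exists (maxn m m'), (D `&` D'); split; [exact: measurableI|].
Qed.

Lemma dyadic_setsT : dyadic_sets setT.
Proof. by exists 0%N, setT; split => //; apply/seteqP. Qed.

Lemma dyadic_values_measurable m d (S : measurableType d) (X : S -> C) :
  (forall s, 0 <= s <= T -> measurable_fun setT (fun w => path_at (X w) s)) ->
  measurable_fun setT ((fun w => dyadic_values m (X w)) : S -> seqm R).
Proof.
move=> mX; apply: seqm_measurable => i; rewrite /dyadic_values; case: leqP => im.
  apply: mX; apply/andP; split; first by rewrite divr_ge0// mulr_ge0// ltW.
  by rewrite ler_pdivrMr ?ltr0n ?expn_gt0// ler_pM2l// ler_nat.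
exact: measurable_cst.
Qed.

Lemma path_at_borel s : 0 <= s <= T ->
  measurable_fun setT (fun f : borel C => path_at f s).
Proof.
move=> sT; apply: continuous_borel_measurable; exact: path_at_sup_continuous.
Qed.

(** The value of a path at [s] is the limit of its values at the dyadic points to the
    left of [s]. *)
Lemma borel_dyadic : @measurable _ (borel C) = <<s dyadic_sets >>.
Proof.
apply/seteqP; split; last first.
  apply: smallest_sub; first exact: sigma_algebra_measurable.
  move=> _ [m [B [mB ->]]].
  have := @dyadic_values_measurable m _ (borel C) id path_at_borel measurableT B mB.
  by rewrite setTI.
apply: borel_sub => s sT.
apply: (@measurable_fun_cvg _ _ _ _ (fun m (f : g_sigma_algebraType dyadic_sets) =>
  path_at f (grid T (2 ^ m) s))).
  move=> m _ B mB; rewrite setTI; apply: sub_sigma_algebra.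
  have n0 : (0 < 2 ^ m)%N by rewrite expn_gt0.
  have [_ _ _ gi] := grid_le T0 sT n0.
  exists m, [set x | B (x (Num.truncn (s / T * (2 ^ m)%:R)))]; split.
    have := @coord_measurable _ R (Num.truncn (s / T * (2 ^ m)%:R)) measurableT B mB.
    by rewrite setTI.
  by apply/seteqP; split=> f /=; rewrite /dyadic_values gi.
move=> f _; apply/cvgrPdist_lt => e e0.
have [dl dl0 dP] := within_itv_near (@path_at_continuous _ _ f) sT e0.
have [m md] := ex_mesh T0 dl0.
near=> n.
have n0 : (0 < 2 ^ n)%N by rewrite expn_gt0.
have [g0 gs sg _] := grid_le T0 sT n0.
apply: dP; first by rewrite g0 (le_trans gs)//; case/andP: sT.
rewrite (lt_trans sg)//; apply: le_lt_trans md; rewrite ler_pM2l//.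
rewrite natrX lef_pV2 ?posrE ?exprn_gt0// ler_weXn2l// ?ler1n//.
by near: n; exact: nbhs_infty_ge.
Unshelve. all: by end_near. Qed.

End path_sigma_algebra.

(** * Brownian paths as noise *)

Section noise.
Context {R : realType} {T : R} {d} {Om : measurableType d} (P : probability Om R).
Variable B : nat -> R -> Om -> R.
Hypothesis T0 : 0 < T.
Hypothesis BB : iid_brownian P B.
Notation C := (path_space T).

Lemma brownian_regular_off_null : exists Z : set Om, [/\ measurable Z, P Z = 0%E &
  forall w, ~ Z w -> forall v, B v 0 w = 0 /\
    {within `[0, +oo[, continuous (B v ^~ w)}].
Proof.
have [Z [mZ PZ ZP]] : {ae P, forall w, forall v, B v 0 w = 0 /\
    {within `[0, +oo[, continuous (B v ^~ w)}}.
  apply: ae_foralln => v; have [_ h0 hc _ _] := BB.1 v.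
  by apply: filterS2 h0 hc => w ? ?; split.
by exists Z; split=> // w nZ; apply: contrapT => h; apply: nZ; exact: ZP.
Qed.

Variable Z : set Om.
Hypothesis mZ : measurable Z.
Hypothesis PZ : P Z = 0%E.
Hypothesis ZP : forall w, ~ Z w -> forall v, B v 0 w = 0 /\
    {within `[0, +oo[, continuous (B v ^~ w)}.

Lemma path_at_point t : 0 <= t <= T -> path_at (point : C) t = 0.
Proof.
move=> tT; have tin : t \in `[0, T]%classic by rewrite inE/= in_itv.
have [t' <-] : exists t' : `[0, T]%classic, set_val t' = t.
  by exists (SigSub tin).
by rewrite path_at_val.
Qed.

(** Brownian paths are continuous almost surely only, whereas [flow] requires a path
    for every outcome: on a null event the noise is set to zero. *)
Definition noise (w : Om) (v : nat) : C :=
  get [set f : C | forall t, 0 <= t <= T ->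
    path_at f t = if `[< Z w >] then 0 else B v t w].

Lemma noiseE w v t : 0 <= t <= T ->
  path_at (noise w v) t = if `[< Z w >] then 0 else B v t w.
Proof.
move: t; suff [f fP] : exists f : C, forall t, 0 <= t <= T ->
    path_at f t = if `[< Z w >] then 0 else B v t w.
  rewrite /noise; set A := [set f : C | _].
  have : A (get A) by apply: getPex; exists f.
  exact.
case: asboolP => Zw; first by exists point => t tT; exact: path_at_point.
have [_ cB] := ZP Zw v.
apply: path_ex; apply: continuous_subspaceW cB => t /=.
by rewrite !in_itv/= => /andP[->].
Qed.

Lemma noise_preimage v t (A : set R) : 0 <= t <= T ->
  [set w | A (path_at (noise w v) t)] =
  (Z `&` (if `[< A 0 >] then setT else set0)) `|` (~` Z `&` [set w | A (B v t w)]).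
Proof.
move=> tT; apply/seteqP; split=> w /=; rewrite noiseE//.
  by case: asboolP => Zw Aw; [left; case: asboolP|right].
case=> -[Zw]; last by case: asboolP.
by case: asboolP => // A0 _; case: asboolP.
Qed.

Lemma B_measurable v t : 0 <= t -> measurable_fun setT (B v t).
Proof. by have [h _ _ _ _] := BB.1 v; exact: h. Qed.

Lemma noise_measurable v t : 0 <= t <= T ->
  measurable_fun setT (fun w => path_at (noise w v) t).
Proof.
move=> tT _ A mA; rewrite setTI -[X in measurable X]/[set w | A (path_at (noise w v) t)].
rewrite noise_preimage//; apply: measurableU; apply: measurableI => //.
- by case: ifP.
- exact: measurableC.
- have /andP[t0 _] := tT; have := B_measurable v t0 measurableT mA.
  by rewrite setTI.
Qed.

Lemma noise_borel v : measurable_fun setT ((noise ^~ v) : Om -> borel C).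
Proof.
by apply: borel_path_measurable => // s sT; exact: noise_measurable.
Qed.

(** Transfers the independence of the Brownian motions to the noise: an event on the
    noise at [v] agrees, off the null event, with an event on the motion [B v]. *)
Lemma noise_sigma_process v (A : set (borel C)) : measurable A ->
  exists2 D, sigma_process (B v) D & forall w, ~ Z w -> A (noise w v) <-> D w.
Proof.
move=> mA; have := borel_evaluations T0 mA; move: A {mA}.
apply: smallest_sub.
  split.
  - by exists set0 => //; exact: sigma_algebra0.
  - move=> A [D sD AD]; exists (~` D); first by exact: sigma_algebraC.
    move=> w /AD h; rewrite setTD; split=> /= h1 h2; apply: h1; exact/h.
  - move=> F FP.
    have /choice[D DP] : forall n, exists D, sigma_process (B v) D /\
        forall w, ~ Z w -> F n (noise w v) <-> D w.
      by move=> n; have [D sD DP] := FP n; exists D.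
    exists (\bigcup_n D n).
      by apply: sigma_algebra_bigcup => n; have [] := DP n.
    move=> w Zw; split=> -[n _ h]; exists n => //; have [_ DPn] := DP n;
      exact/(DPn w Zw).
move=> _ [s [A [/andP[s0 sT] mA ->]]].
exists [set w | A (B v s w)].
  apply: sub_sigma_algebra; exists s => //.
  by exists A => //; rewrite setTI.
move=> w Zw /=; rewrite noiseE ?s0//; by case: asboolP.
Qed.

Lemma sigma_process_measurable v D : sigma_process (B v) D -> measurable D.
Proof.
apply: smallest_sub; first exact: sigma_algebra_measurable.
move=> _ [s /= s0 [A mA <-]].
exact: B_measurable.
Qed.

Lemma noise_prod_rule (s : nat -> nat) : injective s ->
  prod_rule P (fun w v => noise w (s v) : borel C).
Proof.
move=> sinj m E mE.
have /choice[D DP] : forall i, exists D, sigma_process (B (s i)) D /\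
    forall w, ~ Z w -> E i (noise w (s i)) <-> D w.
  by move=> i; have [D sD DP] := noise_sigma_process (s i) (mE i); exists D.
have mD i : measurable (D i) by apply: (@sigma_process_measurable (s i)); have [] := DP i.
have mN i : measurable [set w | E i (noise w (s i))].
  by have := noise_borel (s i) measurableT (mE i); rewrite setTI.
have bigm (F : nat -> set Om) : (forall i, measurable (F i)) ->
    measurable [set w | forall i, (i < m)%N -> F i w].
  move=> mF; have -> : [set w | forall i, (i < m)%N -> F i w] =
      \bigcap_i (if (i < m)%N then F i else setT).
    apply/seteqP; split=> w /=; first by move=> h i _; case: ifP => // /h.
    by move=> h i im; have := h i I; rewrite im.
  by apply: bigcapT_measurable => i; case: ifP.
rewrite (prob_eq_off mZ PZ (bigm _ mN) (bigm _ mD)).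
  rewrite (mutually_independent_prod BB.2 sinj); last by move=> i; have [] := DP i.
  apply: eq_bigr => i _; apply: (prob_eq_off mZ PZ) => // w Zw.
  by have [_ /(_ w Zw)[h1 h2]] := DP i; split.
move=> w Zw; split=> h i im; have [_ /(_ w Zw)[h1 h2]] := DP i.
  by apply: h1; exact: h.
by apply: h2; exact: h.
Qed.

(** On a dyadic grid a path is the sequence of partial sums of its increments, and
    these are independent with Gaussian laws that depend on the grid only. *)
Lemma noise_same_law u v (A : set (borel C)) : measurable A ->
  P [set w | A (noise w u)] = P [set w | A (noise w v)].
Proof.
suff E : forall A : set (borel C), measurable A ->
  law P (noise_borel u) A = law P (noise_borel v) A by exact: E.
have U := (@law_unique R _ (borel C) _ (law P (noise_borel u)) (law P (noise_borel v))
  (borel_dyadic T0) (@dyadic_setsI _ T) (@dyadic_setsT _ T)).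
move=> A0 mA0; refine (U _ _ _ mA0).
  exact: law_lty.
move=> _ [m [D [mD ->]]].
pose t i : R := T * i%:R / (2 ^ m)%:R.
have m0 : 0 < (2 ^ m)%:R :> R by rewrite ltr0n expn_gt0.
have t0 i : 0 <= t i by rewrite divr_ge0// mulr_ge0// ltW.
have tS i : t i < t i.+1 by rewrite ltr_pM2r ?invr_gt0// ltr_pM2l// ltr_nat.
pose incr v i (w : Om) := B v (t i.+1) w - B v (t i) w.
have mincr v' i : measurable_fun setT (incr v' i).
  by apply: measurable_funB; exact: B_measurable.
(* from increments to values *)
pose Q (x : seqm R) : seqm R :=
  fun i => if (i <= 2 ^ m)%N then \sum_(j < i) x j else 0.
have mQ : measurable_fun setT Q.
  apply: seqm_measurable => i; rewrite /Q; case: leqP => _; last exact: measurable_cst.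
  apply: (@measurable_sum _ _ _ _ _ _ (fun (j : 'I_i) (x : seqm R) => x j)).
  move=> j; exact: coord_measurable.
have QE v' w : ~ Z w -> dyadic_values m (noise w v') = Q (fun i => incr v' i w).
  move=> Zw; apply/funext => i; rewrite /dyadic_values /Q; case: leqP => // im.
  rewrite -/(t i) noiseE; last first.
    by rewrite t0 /= /t ler_pdivrMr// ler_pM2l// ler_nat.
  case: asboolP => // _.
  rewrite -[RHS](big_mkord xpredT (fun j => incr v' j w)) /incr telescope_sumr//.
  have -> : t 0%N = 0 by rewrite /t mulr0 mul0r.
  by have [-> _] := ZP Zw v'; rewrite subr0.
have prodI v' : prod_rule P (fun w i => incr v' i w).
  move=> n E mE; have [_ _ _ _ ind] := BB.1 v'.
  have := mutually_independent_prod (ind t (t0 0%N) tS) (@inj_id nat).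
  move=> /(_ n (fun i => [set w | E i (incr v' i w)])); apply => i.
  by exists (E i) => //; rewrite setTI.
have mQD : measurable (Q @^-1` D).
  by have := mQ measurableT _ mD; rewrite setTI.
have inQ v' : P [set w | D (dyadic_values m (noise w v'))] =
    P [set w | (Q @^-1` D) (fun i => incr v' i w)].
  apply: (prob_eq_off mZ PZ).
  - have := @dyadic_values_measurable R T T0 m _ Om (noise ^~ v')
      (fun s sT => noise_measurable v' sT) measurableT _ mD.
    by rewrite setTI.
  - have := @seqm_measurable _ R _ Om (fun w i => incr v' i w) (mincr v')
      measurableT _ mQD.
    by rewrite setTI.
  - by move=> w Zw /=; rewrite QE.
apply: (etrans (inQ u)); apply: (etrans _ (esym (inQ v))).
apply: (prod_rule_law (mincr u) (mincr v) (prodI u) (prodI v)) => // i E mE.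
have [_ _ _ inc _] := BB.1 u; have [_ _ _ inc' _] := BB.1 v.
by rewrite inc ?inc'.
Qed.

(** The noise paths are independent and have the same law, hence so are the relabelled
    ones, and the law of a sequence of independent variables is determined by its
    marginals. Exchangeability lets the vertices of two isomorphic networks carry
    the same noise. *)
Theorem noise_exchangeable (s : nat -> nat) : injective s ->
  forall A : set (seqm (borel C)), measurable A ->
    P [set w | A (noise w)] = P [set w | A (fun v => noise w (s v))].
Proof.
move=> sinj.
apply: (@prod_rule_law R _ _ _ (borel C) P noise (fun w v => noise w (s v))).
- by move=> i; exact: noise_borel.
- by move=> i; exact: noise_borel.
- exact: (noise_prod_rule (@inj_id nat)).
- exact: noise_prod_rule.
- by move=> i A mA; exact: noise_same_law.
Qed.

(** The null event that is discarded belongs to the filtration at every time, as the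
    filtration is augmented. *)
Lemma noise_adapted v s t : 0 <= s <= t -> t <= T -> forall A : set R,
  measurable A -> brownian_filtration P B t [set w | A (path_at (noise w v) s)].
Proof.
move=> /[dup] st /andP[s0 st'] tT A mA.
rewrite noise_preimage ?s0 ?(le_trans st')//.
pose G := [set A | (exists v s, 0 <= s <= t /\ sigma_var (B v s) A) \/
               (measurable A /\ P A = 0%E)].
pose SG := g_sigma_algebraType G.
have mZ' : @measurable _ SG Z by apply: sub_sigma_algebra; right.
have : @measurable _ SG (Z `&` (if `[< A 0 >] then setT else set0) `|`
    ~` Z `&` [set w | A (B v s w)]).
  apply: measurableU; apply: measurableI => //.
  - by case: ifP.
  - exact: measurableC.
  - apply: sub_sigma_algebra; left; exists v, s; split => //.
    by exists A => //; rewrite setTI.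
exact.
Qed.

End noise.

(** * Expectations of bounded variables *)

Section expectation.
Context {d} {Om : measurableType d} {R : realType} (P : probability Om R).
Implicit Types (f g : Om -> R) (c : R).

(** Bounded measurable functions with an explicit bound: they are closed under sums
    and products, and expectations are additive on them without further integrability
    conditions. *)
Definition bmeas f c := measurable_fun setT f /\ forall w, `|f w| <= c.

Lemma bmeas_integrable f c : bmeas f c -> P.-integrable setT (EFin \o f).
Proof.
move=> [mf fc]; apply: measurable_bounded_integrable => //.
  exact: (le_lt_trans (probability_le1 P measurableT) (ltry 1)).
exists c; split; first exact: num_real.
by move=> x cx w _; apply: le_trans (fc w) _; exact: ltW.
Qed.

Definition E f := \int[P]_w f w.

Lemma E_cst c : E (fun=> c) = c.
Proof.
rewrite /E Rintegral_cst// [X in c * fine X](_ : _ = 1%E) ?mulr1//.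
exact: probability_setT.
Qed.

Lemma bmeasD f g c c' : bmeas f c -> bmeas g c' ->
  bmeas (fun w => f w + g w) (c + c').
Proof.
move=> [mf fc] [mg gc]; split; first exact: measurable_funD.
by move=> w; rewrite (le_trans (ler_normD _ _))// lerD.
Qed.

Lemma bmeasM f g c c' : bmeas f c -> bmeas g c' ->
  bmeas (fun w => f w * g w) (c * c').
Proof.
move=> [mf fc] [mg gc]; split; first exact: measurable_funM.
by move=> w; rewrite normrM ler_pM.
Qed.

Lemma bmeas_cst c : bmeas (fun=> c) `|c|.
Proof. by split => //; exact: measurable_cst. Qed.

Lemma bmeasX f c n : bmeas f c -> bmeas (fun w => f w ^+ n) (c ^+ n).
Proof.
move=> fc; elim: n => [|n ih].
  by rewrite expr0 -[X in bmeas _ X]normr1; exact: bmeas_cst.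
rewrite exprS; have := bmeasM fc ih.
by congr (bmeas _ _); apply/funext => w; rewrite exprS.
Qed.

Lemma bmeas_sum (s : seq nat) (F : nat -> Om -> R) c :
  (forall v, bmeas (F v) c) ->
  bmeas (fun w => \sum_(v <- s) F v w) ((size s)%:R * c).
Proof.
move=> Fc; elim: s => [|v s ih].
  rewrite mul0r -[X in bmeas _ X](@normr0 _ R).
  have := bmeas_cst 0.
  by congr (bmeas _ _); apply/funext => w; rewrite big_nil.
have := bmeasD (Fc v) ih; rewrite -natr1 mulrDl mul1r addrC.
by congr (bmeas _ _); apply/funext => w; rewrite big_cons.
Qed.

Lemma ED f g c c' : bmeas f c -> bmeas g c' ->
  E (fun w => f w + g w) = E f + E g.
Proof.
by move=> /bmeas_integrable fc /bmeas_integrable gc; rewrite /E RintegralD.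
Qed.

Lemma EZ f c a : bmeas f c -> E (fun w => a * f w) = a * E f.
Proof. by move=> /bmeas_integrable fc; rewrite /E RintegralZl. Qed.

Lemma E_le f g c c' : bmeas f c -> bmeas g c' -> (forall w, f w <= g w) ->
  E f <= E g.
Proof.
by move=> /bmeas_integrable fc /bmeas_integrable gc fg; rewrite /E le_Rintegral.
Qed.

Lemma E_norm f c : bmeas f c -> `|E f| <= c.
Proof.
move=> fc; have c1 : bmeas (fun=> c) `|c| by exact: bmeas_cst.
have h1 := E_le fc c1 (fun w => le_trans (ler_norm _) (fc.2 w)).
have h2 := EZ (- 1) fc.
have f1 : bmeas (fun w => - 1 * f w) (`|- 1| * c).
  by apply: bmeasM => //; exact: bmeas_cst.
have h3 := E_le f1 c1 _; rewrite h2 !E_cst in h1 h3.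
rewrite ler_norml; apply/andP; split => //; rewrite -[E f]opprK lerN2 -mulN1r.
by apply: h3 => w; rewrite mulN1r (le_trans _ (fc.2 w))// -normrN ler_norm.
Qed.

Lemma E_sum (s : seq nat) (F : nat -> Om -> R) c : (forall v, bmeas (F v) c) ->
  E (fun w => \sum_(v <- s) F v w) = \sum_(v <- s) E (F v).
Proof.
move=> Fc; elim: s => [|v s ih].
  by rewrite big_nil -[RHS]E_cst; congr E; apply/funext => w; rewrite big_nil.
rewrite big_cons -ih -(ED (Fc v) (bmeas_sum s Fc)).
by congr E; apply/funext => w; rewrite big_cons.
Qed.

Definition indep2 f g := forall A A' : set R, measurable A -> measurable A' ->
  P ([set w | A (f w)] `&` [set w | A' (g w)]) =
  (P [set w | A (f w)] * P [set w | A' (g w)])%E.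

Lemma indep2_comp f g (h k : R -> R) : indep2 f g ->
  measurable_fun setT h -> measurable_fun setT k ->
  indep2 (h \o f) (k \o g).
Proof.
move=> fg mh mk A A' mA mA'; apply: (fg (h @^-1` A) (k @^-1` A')).
- by have := mh measurableT A mA; rewrite setTI.
- by have := mk measurableT A' mA'; rewrite setTI.
Qed.

(** The joint law is the product of the laws, so the integral is computed by Tonelli's
    theorem. *)
Lemma indep2_E_ge0 f g c c' : bmeas f c -> bmeas g c' ->
  (forall w, 0 <= f w) -> (forall w, 0 <= g w) -> indep2 f g ->
  E (fun w => f w * g w) = E f * E g.
Proof.
move=> fc gc f0 g0 ifg.
have mf := fc.1; have mg := gc.1.
have mfg : measurable_fun setT (fun w => (f w, g w)) by exact: measurable_fun_pair.
have prodE : forall A : set (R * R), measurable A ->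
    (law P mf \x law P mg)%E A = law P mfg A.
  apply: product_measure_unique => A A' mA mA'.
  exact: ifg.
pose F (z : R * R) : \bar R := (`|z.1| * `|z.2|)%:E.
have mF : measurable_fun setT F.
  apply/measurable_EFinP; apply: measurable_funM.
    by apply: measurableT_comp => //; exact: measurable_fst.
  by apply: measurableT_comp => //; exact: measurable_snd.
have F0 z : (0 <= F z)%E by rewrite lee_fin mulr_ge0.
have mn : measurable_fun setT (fun x : R => `|x|%:E).
  by apply/measurable_EFinP; exact: normr_measurable.
have int_prod : (\int[law P mfg]_z F z = \int[P]_w (f w * g w)%:E)%E.
  rewrite ge0_integral_distribution//.
  by apply: eq_integral => w _; rewrite /F/= !ger0_norm.
have int_iter : (\int[law P mfg]_z F z =
    \int[law P mf]_x \int[law P mg]_y F (x, y))%E.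
  rewrite -(@fubini_tonelli1 _ _ _ _ _ (law P mf) (law P mg) F)//.
  by apply: eq_measure_integral => A mA _; exact: (esym (prodE A mA)).
have int_law (h : Om -> R) (mh : measurable_fun setT h) : (forall w, 0 <= h w) ->
    (\int[law P mh]_x `|x|%:E = \int[P]_w (h w)%:E)%E.
  move=> h0; rewrite ge0_integral_distribution//.
  by apply: eq_integral => w _; rewrite /= ger0_norm.
have If := bmeas_integrable fc; have Ig := bmeas_integrable gc.
rewrite /E /Rintegral -int_prod int_iter.
have -> : (\int[law P mf]_x \int[law P mg]_y F (x, y) =
    \int[law P mf]_x (`|x|%:E * \int[P]_w (g w)%:E))%E.
  apply: eq_integral => x _; rewrite -(int_law _ mg)// -ge0_integralZl//.
rewrite ge0_integralZr//; last by apply: integral_ge0 => w _; rewrite lee_fin.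
rewrite (int_law _ mf)// fineM//; exact: integrable_fin_num.
Qed.

(** Adding constants reduces to nonnegative factors. *)
Lemma indep2_E f g c c' : bmeas f c -> bmeas g c' -> indep2 f g ->
  E (fun w => f w * g w) = E f * E g.
Proof.
move=> fc gc ifg.
have kc := bmeas_cst c; have kc' := bmeas_cst c'.
have := @indep2_E_ge0 (fun w => f w + c) (fun w => g w + c') _ _
  (bmeasD fc kc) (bmeasD gc kc').
have h0 : forall w, 0 <= f w + c.
  by move=> w; rewrite -lerBlDr sub0r; have := fc.2 w; rewrite ler_norml => /andP[].
have h0' : forall w, 0 <= g w + c'.
  by move=> w; rewrite -lerBlDr sub0r; have := gc.2 w; rewrite ler_norml => /andP[].
move=> /(_ h0 h0'); rewrite (ED fc kc) (ED gc kc') !E_cst.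
have -> : (fun w => (f w + c) * (g w + c')) =
    (fun w => f w * g w + (c' * f w + (c * g w + c * c'))).
  by apply/funext => w; lra.
have b1 := bmeasM (bmeas_cst c') fc; have b2 := bmeasM (bmeas_cst c) gc.
have b3 := bmeas_cst (c * c').
rewrite (ED (bmeasM fc gc) (bmeasD b1 (bmeasD b2 b3))).
rewrite (ED b1 (bmeasD b2 b3)) (ED b2 b3) (EZ c' fc) (EZ c gc) E_cst.
move=> h; have {}h := h _; suff : indep2 (fun w => f w + c) (fun w => g w + c').
  by move=> /h; lra.
apply: (indep2_comp (h := fun x => x + c) (k := fun x => x + c')) => //;
  by apply: measurable_funD => //; exact: measurable_cst.
Qed.

End expectation.

(** * Fourth moments under local dependence *)

Section colouring.

Lemma fresh_colour (s : seq nat) (K : nat) : (size s <= K)%N ->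
  exists2 c, (c < K.+1)%N & c \notin s.
Proof.
move=> sK; have [/hasP[c cK cs]|/hasPn h] := boolP (has (fun c => c \notin s) (iota 0 K.+1)).
  by exists c => //; move: cK; rewrite mem_iota.
have sub : {subset iota 0 K.+1 <= s} by move=> c /h; rewrite negbK.
have := uniq_leq_size (iota_uniq _ _) sub.
by rewrite size_iota ltnNge sK.
Qed.

(** The vertices are coloured one by one: a new vertex is in conflict with at most [K]
    of the others, which leaves one of [K.+1] colours free. *)
Lemma greedy_colouring (conf : nat -> nat -> Prop) (K n : nat) :
  (forall u v, conf u v -> conf v u) ->
  (forall v, exists2 s : seq nat, (size s <= K)%N & forall u, conf u v -> u \in s) ->
  exists2 col : nat -> nat, forall v, (col v < K.+1)%N &
    forall u v, (u < n)%N -> (v < n)%N -> u <> v -> conf u v -> col u <> col v.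
Proof.
move=> csym clist; elim: n => [|n [col colK colP]]; first by exists (fun=> 0%N).
have [s sK sP] := clist n.
have [c cK cs] := @fresh_colour (map col s) K (etrans (congr1 (leq^~ K) (size_map _ _)) sK).
exists (fun v => if v == n then c else col v).
  by move=> v; case: ifP.
have cne u : conf u n -> c <> col u.
  by move=> /sP us cE; move: cs; rewrite cE map_f.
move=> u v; rewrite !ltnS leq_eqVlt => /predU1P[->|un].
  rewrite leq_eqVlt => /predU1P[->//|vn _ /csym uv]; rewrite eqxx (ltn_eqF vn).
  exact: cne.
rewrite leq_eqVlt => /predU1P[->|vn] uv cuv.
  by rewrite eqxx (ltn_eqF un) => /esym; exact: cne.
by rewrite (ltn_eqF un) (ltn_eqF vn); exact: colP.
Qed.

End colouring.

Section power_mean.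
Context {R : realType}.

Lemma sqr_sum_le (K : nat) (a : nat -> R) :
  (\sum_(k < K) a k) ^+ 2 <= K%:R * \sum_(k < K) a k ^+ 2.
Proof.
elim: K => [|K ih]; first by rewrite !big_ord0 expr0n/= mulr0.
rewrite !big_ord_recr/=; set S := \sum_(k < K) a k in ih *.
set Q := \sum_(k < K) _ in ih *.
have : 2 * S * a K <= Q + K%:R * a K ^+ 2.
  rewrite /S /Q -mulrA mulr_suml.
  have -> : K%:R * a K ^+ 2 = \sum_(k < K) a K ^+ 2.
    by rewrite sumr_const card_ord mulr_natl.
  rewrite -big_split/= mulr_sumr; apply: ler_sum => k _.
  by have := sqr_ge0 (a k - a K); nra.
by rewrite -natr1; nra.
Qed.

Lemma pow4_sum_le (K : nat) (a : nat -> R) :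
  (\sum_(k < K) a k) ^+ 4 <= K%:R ^+ 3 * \sum_(k < K) a k ^+ 4.
Proof.
have h1 := sqr_sum_le K a; have h2 := sqr_sum_le K (fun k => a k ^+ 2).
have E (x : R) : x ^+ 4 = (x ^+ 2) ^+ 2 by rewrite -exprM.
rewrite E; apply: (@le_trans _ _ ((K%:R * \sum_(k < K) a k ^+ 2) ^+ 2)).
  by rewrite ler_sqr// ?nnegrE ?sqr_ge0// (le_trans (sqr_ge0 _) h1).
rewrite exprMn; under [in leRHS]eq_bigr do rewrite E.
by rewrite (exprSr K%:R 2) -mulrA ler_wpM2l ?sqr_ge0.
Qed.

End power_mean.

Section moments.
Context {d} {Om : measurableType d} {R : realType} (P : probability Om R).
Implicit Types (Y : nat -> Om -> R) (s : seq nat).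

(** In the expansion of [(X + S) ^ 4] the terms in which [X] or [S] occurs once vanish,
    as both are centred and independent. The remaining mixed term is a product of
    two second moments, of which that of [S] is linear in the number of terms: this
    makes the fourth moment quadratic instead of quartic. *)
Lemma fourth_moment s Y c : (forall v, bmeas (Y v) c) -> (forall v, E P (Y v) = 0) ->
  (forall s1 v s2, s = s1 ++ v :: s2 ->
    indep2 P (Y v) (fun w => \sum_(u <- s2) Y u w)) ->
  E P (fun w => (\sum_(v <- s) Y v w) ^+ 2) <= (size s)%:R * c ^+ 2 /\
  E P (fun w => (\sum_(v <- s) Y v w) ^+ 4) <= 3 * (size s)%:R ^+ 2 * c ^+ 4.
Proof.
move=> Yc Y0; elim: s => [|v s ih] ind.
  rewrite /= mul0r; split.
    rewrite (_ : (fun _ => _) = (fun=> 0)) ?E_cst//.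
    by apply/funext => w; rewrite big_nil expr0n.
  rewrite (_ : (fun _ => _) = (fun=> 0)) ?E_cst ?expr0n ?mulr0 ?mul0r//.
  by apply/funext => w; rewrite big_nil expr0n.
have [ih2 ih4] := ih (fun s1 u s2 sE => ind (v :: s1) u s2 (congr1 (cons v) sE)).
pose S w := \sum_(u <- s) Y u w.
have bS : bmeas S ((size s)%:R * c) by exact: bmeas_sum.
pose X := Y v; have bX : bmeas X c := Yc v.
have S0 : E P S = 0 by rewrite (E_sum _ _ Yc) big1.
have XS : indep2 P X S by apply: (ind [::] v s).
have EXS p q : E P (fun w => X w ^+ p * S w ^+ q) =
    E P (fun w => X w ^+ p) * E P (fun w => S w ^+ q).
  apply: (indep2_E (bmeasX p bX) (bmeasX q bS)).
  by apply: (indep2_comp (h := fun x => x ^+ p) (k := fun x => x ^+ q) XS);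
    exact: measurable_funX.
have E1 (f : Om -> R) : (fun w => f w ^+ 1) = f by apply/funext => w; rewrite expr1.
have XS11 : E P (fun w => X w ^+ 1 * S w ^+ 1) = 0 by rewrite EXS !E1 Y0 mul0r.
have XS13 : E P (fun w => X w ^+ 1 * S w ^+ 3) = 0 by rewrite EXS !E1 Y0 mul0r.
have XS31 : E P (fun w => X w ^+ 3 * S w ^+ 1) = 0 by rewrite EXS !E1 S0 mulr0.
have bXS p q := bmeasM (bmeasX p bX) (bmeasX q bS).
have EX p : `|E P (fun w => X w ^+ p)| <= c ^+ p by apply: E_norm; exact: bmeasX.
have EX2 : E P (fun w => X w ^+ 2) <= c ^+ 2 by apply: le_trans (EX 2); exact: ler_norm.
have EX4 : E P (fun w => X w ^+ 4) <= c ^+ 4 by apply: le_trans (EX 4); exact: ler_norm.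
have ES2 : 0 <= E P (fun w => S w ^+ 2).
  rewrite -[0](E_cst P 0); apply: (E_le P (bmeas_cst 0) (bmeasX 2 bS)) => w.
  exact: sqr_ge0.
have bZ (a : R) (f : Om -> R) (b : R) : bmeas f b -> bmeas (fun w : Om => a * f w) (`|a| * b).
  by move=> fb; apply: bmeasM => //; exact: bmeas_cst.
have two : E P (fun w => (\sum_(u <- v :: s) Y u w) ^+ 2) =
    E P (fun w => X w ^+ 2) + E P (fun w => S w ^+ 2).
  rewrite (_ : (fun _ => _) = (fun w => X w ^+ 2 +
      (2 * (X w ^+ 1 * S w ^+ 1) + S w ^+ 2))); last first.
    by apply/funext => w; rewrite big_cons -/(S w) -/(X w); lra.
  rewrite (ED P (bmeasX 2 bX) (bmeasD (bZ 2 _ _ (bXS 1%N 1%N)) (bmeasX 2 bS))).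
  rewrite (ED P (bZ 2 _ _ (bXS 1%N 1%N)) (bmeasX 2 bS)) (EZ P 2 (bXS 1%N 1%N)) XS11.
  by rewrite mulr0 add0r.
have four : E P (fun w => (\sum_(u <- v :: s) Y u w) ^+ 4) =
    E P (fun w => X w ^+ 4) +
    6 * (E P (fun w => X w ^+ 2) * E P (fun w => S w ^+ 2)) +
    E P (fun w => S w ^+ 4).
  rewrite (_ : (fun _ => _) = (fun w => X w ^+ 4 + (4 * (X w ^+ 3 * S w ^+ 1) +
      (6 * (X w ^+ 2 * S w ^+ 2) + (4 * (X w ^+ 1 * S w ^+ 3) + S w ^+ 4))))); last first.
    by apply/funext => w; rewrite big_cons -/(S w) -/(X w); lra.
  have b1 := bmeasD (bZ 4 _ _ (bXS 1%N 3)) (bmeasX 4 bS).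
  have b2 := bmeasD (bZ 6 _ _ (bXS 2 2)) b1.
  have b3 := bmeasD (bZ 4 _ _ (bXS 3 1%N)) b2.
  rewrite (ED P (bmeasX 4 bX) b3) (ED P (bZ 4 _ _ (bXS 3 1%N)) b2).
  rewrite (ED P (bZ 6 _ _ (bXS 2 2)) b1) (ED P (bZ 4 _ _ (bXS 1%N 3)) (bmeasX 4 bS)).
  rewrite (EZ P 4 (bXS 3 1%N)) (EZ P 6 (bXS 2 2)) (EZ P 4 (bXS 1%N 3)) XS13 XS31.
  by rewrite EXS; lra.
rewrite two four; split; rewrite /= -natr1; first by rewrite mulrDl mul1r addrC lerD.
set m := (size s)%:R in ih2 ih4 *; have m0 : 0 <= m by rewrite ler0n.
have h : E P (fun w => X w ^+ 2) * E P (fun w => S w ^+ 2) <= c ^+ 2 * (m * c ^+ 2).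
  apply: (@le_trans _ _ (c ^+ 2 * E P (fun w => S w ^+ 2))).
    by rewrite ler_wpM2r.
  by rewrite ler_wpM2l// sqr_ge0.
have c4 : c ^+ 4 = c ^+ 2 * c ^+ 2 by rewrite -exprD.
have c40 : 0 <= c ^+ 2 * c ^+ 2 by rewrite mulr_ge0 ?sqr_ge0.
by move: ih4 EX4; rewrite /S c4 -/S; nra.
Qed.

(** The sum is split by colour. Within a colour the terms are independent, and the
    power mean inequality controls the sum over the colours. *)
Lemma coloured_fourth_moment s Y c (K : nat) (col : nat -> nat) :
  (forall v, bmeas (Y v) c) -> (forall v, E P (Y v) = 0) ->
  (forall v, (col v < K)%N) ->
  (forall k s1 v s2, [seq v <- s | col v == k] = s1 ++ v :: s2 ->
    indep2 P (Y v) (fun w => \sum_(u <- s2) Y u w)) ->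
  E P (fun w => (\sum_(v <- s) Y v w) ^+ 4) <=
    3 * K%:R ^+ 4 * (size s)%:R ^+ 2 * c ^+ 4.
Proof.
move=> Yc Y0 colK ind.
pose S k w := \sum_(v <- [seq v <- s | col v == k]) Y v w.
have bS k : bmeas (S k) ((size [seq v <- s | col v == k])%:R * c) by exact: bmeas_sum.
have c0 : 0 <= c.
  by have [_ h] := Yc 0%N; exact: le_trans (h point).
have bS' k : bmeas (S k) ((size s)%:R * c).
  split; first by have [] := bS k.
  move=> w; have [_ h] := bS k; apply: (le_trans (h w)).
  by rewrite ler_wpM2r// ler_nat size_filter count_size.
have SE w : \sum_(v <- s) Y v w = \sum_(k < K) S k w.
  rewrite (partition_big (fun v => Ordinal (colK v)) xpredT)//=.
  by apply: eq_bigr => k _; rewrite /S big_filter.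
have b4 k := bmeasX 4 (bS' k).
have sum_iota w : \sum_(k < K) S k w ^+ 4 = \sum_(k <- iota 0 K) S k w ^+ 4.
  by rewrite -(big_mkord xpredT (fun k => S k w ^+ 4)) /index_iota subn0.
apply: (@le_trans _ _ (E P (fun w => K%:R ^+ 3 * \sum_(k <- iota 0 K) S k w ^+ 4))).
  apply: (E_le P (bmeasX 4 (bmeas_sum s Yc)) (bmeasM (bmeas_cst (K%:R ^+ 3))
    (bmeas_sum (iota 0 K) b4))) => w.
  by rewrite -sum_iota SE; exact: (pow4_sum_le K (fun k => S k w)).
rewrite (EZ P _ (bmeas_sum (iota 0 K) b4)) (E_sum P _ b4).
apply: (@le_trans _ _ (K%:R ^+ 3 * \sum_(k <- iota 0 K) (3 * (size s)%:R ^+ 2 * c ^+ 4))).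
  rewrite ler_wpM2l ?exprn_ge0//; apply: ler_sum => k _.
  have [_ h] := fourth_moment Yc Y0 (ind k); apply: (le_trans h).
  rewrite ler_wpM2r ?exprn_ge0// ler_wpM2l// lerXn2r ?nnegrE//.
  by rewrite ler_nat size_filter count_size.
rewrite big_const_seq count_predT size_iota iter_addr_0 -mulr_natl.
by rewrite le_eqVlt; apply/orP; left; apply/eqP; lra.
Qed.

End moments.

Section local_functions.
Context {d d'} {Om : measurableType d} {S : measurableType d'} {R : realType}.
Variables (P : probability Om R) (X : Om -> nat -> S).
Hypothesis mX : forall i, measurable_fun setT (fun w => X w i).
Hypothesis pX : prod_rule P X.
Variables (G : nat -> seqm S -> R) (D : nat -> set nat) (e : nat -> R).
Hypothesis mG : forall v, measurable_fun setT (G v).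

Let Y v w := G v (mask (D v) (X w)) - e v.

(** Functions of disjoint sets of coordinates. The sum depends on the coordinates in
    the union [DD] of the sets [D u], the other variable on the complement of [DD]. *)
Lemma local_indep v s :
  (forall u, u \in s -> D u `&` D v = set0) ->
  indep2 P (Y v) (fun w => \sum_(u <- s) Y u w).
Proof.
move=> disj A A' mA mA'.
pose DD : set nat := [set i | exists2 u, u \in s & D u i].
have mm E' : measurable_fun setT (mask E' : seqm S -> seqm S).
  by apply: (@mask_measurable _ _ (seqm S) S id) => i; exact: coord_measurable.
pose H1 (x : seqm S) := \sum_(u <- s) (G u (mask (D u) x) - e u).
pose H2 (x : seqm S) := G v (mask (D v) x) - e v.
have mH2 : measurable_fun setT H2.
  apply: measurable_funB; last exact: measurable_cst.
  exact: (measurableT_comp (mG v) (mm (D v))).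
have mH1 : measurable_fun setT H1.
  apply: measurable_sum => u; apply: measurable_funB; last exact: measurable_cst.
  exact: (measurableT_comp (mG u) (mm (D u))).
have Y1 w : \sum_(u <- s) Y u w = H1 (mask DD (X w)).
  apply: eq_big_seq => u us; rewrite /Y; congr (G u _ - _).
  apply/funext => i; rewrite /mask; case: asboolP => // Di.
  by case: asboolP => // -[]; exists u.
have Y2 w : Y v w = H2 (mask (~` DD) (X w)).
  rewrite /Y /H2; congr (G v _ - _).
  apply/funext => i; rewrite /mask; case: asboolP => // Di.
  case: asboolP => // /contrapT[u us Du].
  by have : (D u `&` D v) i by []; rewrite disj.
have := @mask_indep R _ _ Om S P X DD mX pX (H1 @^-1` A') (H2 @^-1` A).
have m1 : measurable (H1 @^-1` A') by have := mH1 measurableT A' mA'; rewrite setTI.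
have m2 : measurable (H2 @^-1` A) by have := mH2 measurableT A mA; rewrite setTI.
move=> /(_ m1 m2) h.
rewrite setIC muleC.
have -> : [set w | A (Y v w)] = [set w | (H2 @^-1` A) (mask (~` DD) (X w))].
  by apply/seteqP; split=> w /=; rewrite Y2.
have -> : [set w | A' (\sum_(u <- s) Y u w)] = [set w | (H1 @^-1` A') (mask DD (X w))].
  by apply/seteqP; split=> w /=; rewrite Y1.
exact: h.
Qed.

End local_functions.

(** * Localized observables *)

Lemma brack_finite n : finite_set (brack n).
Proof.
by apply: (sub_finite_set _ (finite_II n.+1)) => v /= /andP[_]; rewrite ltnS.
Qed.

Section ball_growth.
Context {R : realType}.
Implicit Types (N : network R) (u v : nat).

Lemma gball_cat N u v w r r' : gball N u r v -> gball N v r' w ->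
  gball N u (r + r') w.
Proof.
elim: r' w => [|r' ih] w uv; first by move=> /gball0E ->; rewrite addn0.
move=> /gballSE[->|[x vx xw]].
  by apply: gballS uv; rewrite leq_addr.
by rewrite addnS; apply: gball_step xw; exact: ih.
Qed.

Lemma gball_sym N u v r : gball N u r v -> gball N v r u.
Proof.
elim: r v => [|r ih] v; first by move=> /gball0E ->; exact: gball_root.
move=> /gballSE[->|[x ux xv]]; first exact: gball_root.
rewrite -add1n; apply: gball_cat (ih _ ux).
by apply: gball_step (gball_root N v 0) _; rewrite adj_sym.
Qed.

Lemma gball_list N (D : nat) : (forall v, (degree N v <= D)%N) ->
  forall v r, exists2 s : seq nat, (size s <= D.+1 ^ r)%N &
    forall u, gball N v r u -> u \in s.
Proof.
move=> dD v; elim=> [|r [s sz sP]].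
  by exists [:: v] => // u /gball0E ->; rewrite inE.
exists (flatten [seq u :: nbs N u | u <- s]).
  rewrite size_flatten /shape -map_comp sumnE big_map.
  apply: (@leq_trans (\sum_(u <- s) D.+1)).
    by apply: leq_sum => u _ /=; rewrite ltnS; exact: dD.
  by rewrite big_const_seq count_predT iter_addn_0 expnS leq_mul2l sz orbT.
move=> u /gballSE[->|[x vx xu]].
  apply/flatten_mapP; exists v; first by apply: sP; exact: gball_root.
  by rewrite inE eqxx.
apply/flatten_mapP; exists x; first exact: sP.
by rewrite inE mem_nbs xu orbT.
Qed.

Lemma degree_le_max N v : finite_set (vset N) -> (degree N v <= max_degree N)%N.
Proof.
move=> fV; have [Vv|nVv] := pselect (vset N v).
  by apply: (@leq_bigmax_seq _ _ xpredT (degree N)) => //; rewrite in_fset_set// inE.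
rewrite (_ : degree N v = 0%N)// /degree; apply/eqP.
rewrite cardfs_eq0; apply/eqP; rewrite -fset_set0; congr fset_set.
by apply/seteqP; split=> // u /= /adj_vset.
Qed.

End ball_growth.

Section local_flow.
Context {R : realType}.
Variables (phi : R * R * R * R -> R) (psi : R * R -> R) (T L M : R).
Hypothesis L0 : 0 < L.
Hypothesis phiL : forall p q, `|phi p - phi q| <= L * `|p - q|.
Hypothesis psiL : forall p q, `|psi p - psi q| <= L * `|p - q|.
Hypothesis phiM : forall p, `|phi p| <= M.
Hypothesis T0 : 0 < T.
Notation C := (path_space T).
Variables (h : C -> R) (c : R).
Hypothesis ch : continuous h.
Hypothesis hc : forall f, `|h f| <= c.
Implicit Types (N : network R).

Lemma flow_seqm_measurable N v :
  measurable_fun setT (fun x : seqm (borel C) => h (flow phi psi N x v)).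
Proof.
have mh : measurable_fun setT (h : borel C -> R) by exact: continuous_borel_measurable.
apply: (measurableT_comp mh).
apply: (flow_borel_measurable L0 phiL psiL phiM T0) => u s sT.
apply: (measurableT_comp (path_at_borel sT)).
exact: coord_measurable.
Qed.

Context {d} {Om : measurableType d} (P : probability Om R).
Variable X : Om -> nat -> borel C.
Hypothesis mX : forall i, measurable_fun setT (fun w => X w i).
Hypothesis pX : prod_rule P X.

(** The noise is masked, rather than the network truncated: the dynamics remain those
    of [N], and only the dependence on the randomness becomes local. *)
Definition local_obs N r v (w : Om) : R :=
  h (flow phi psi N (mask (gball N v r) (X w)) v).

Lemma local_obs_bmeas N r v : bmeas (local_obs N r v) c.
Proof.
split; last by move=> w; exact: hc.
exact: (measurableT_comp (flow_seqm_measurable N v) (mask_measurable _ mX)).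
Qed.

(** Vertices whose balls intersect are in conflict. They are at distance at most
    [r + r], which bounds the number of conflicts of a vertex and hence the number of
    colours. *)
Lemma local_obs_fourth N r n : vset N = brack n ->
  E P (fun w => (\sum_(v <- iota 1 n)
     (local_obs N r v w - E P (local_obs N r v))) ^+ 4) <=
  3 * ((max_degree N).+1 ^ (r + r)).+1%:R ^+ 4 * n%:R ^+ 2 * (c + c) ^+ 4.
Proof.
move=> VN; have fV : finite_set (vset N) by rewrite VN; exact: brack_finite.
pose conf u v := exists i, gball N u r i /\ gball N v r i.
have csym u v : conf u v -> conf v u by move=> [i [? ?]]; exists i.
have clist v : exists2 s : seq nat, (size s <= (max_degree N).+1 ^ (r + r))%N &
    forall u, conf u v -> u \in s.
  have [s sz sP] := gball_list (fun v => degree_le_max v fV) v (r + r).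
  exists s => // u [i [ui vi]]; apply: sP.
  by apply: gball_cat vi _; exact: gball_sym.
(* the vertices are [1, ..., n] *)
have [col colK colP] := greedy_colouring n.+1 csym clist.
pose Y v w := local_obs N r v w - E P (local_obs N r v).
have be v : bmeas (fun _ : Om => - E P (local_obs N r v)) c.
  split; first exact: measurable_cst.
  by move=> w; rewrite normrN; apply: E_norm; exact: local_obs_bmeas.
have Yc v : bmeas (Y v) (c + c) by exact: bmeasD (local_obs_bmeas N r v) (be v).
have Y0 v : E P (Y v) = 0.
  by rewrite /Y (ED P (local_obs_bmeas N r v) (be v)) E_cst subrr.
have := coloured_fourth_moment (s := iota 1 n) Yc Y0 colK.
rewrite size_iota; apply => k s1 v s2 sE.
have mem u : u \in v :: s2 -> (u < n.+1)%N /\ col u = k.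
  move=> us; have : u \in [seq v <- iota 1 n | col v == k].
    by rewrite sE mem_cat us orbT.
  by rewrite mem_filter mem_iota add1n => /andP[/eqP ? /andP[_ ?]].
have us : uniq (v :: s2).
  have := filter_uniq (fun v => col v == k) (iota_uniq 1 n).
  by rewrite sE cat_uniq => /and3P[].
apply: (local_indep mX pX (G := fun v x => h (flow phi psi N x v)) _ _).
  by move=> u; exact: flow_seqm_measurable.
move=> u us2; apply/seteqP; split=> // i [ui vi].
have [un uk] := mem u (mem_behead (s := v :: s2) us2).
have [vn vk] := mem v (mem_head _ _).
have uv : u <> v by move=> uE; move: us; rewrite /= -uE us2.
by case: (colP u v un vn uv); [exists i|rewrite uk vk].
Qed.

End local_flow.

(** * Almost sure convergence from fourth moments *)

Section borel_cantelli.
Context {d} {Om : measurableType d} {R : realType} (P : probability Om R).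

(** With [s = sqrt n] and [s' = sqrt n.+1], the summand [n ^ (- 3 / 2)] is dominated by
    a telescoping difference. *)
Lemma inv_sqrt_telescope (s s' : R) : 1 <= s -> 0 <= s' -> s' ^+ 2 = s ^+ 2 + 1 ->
  (s ^+ 3)^-1 <= 4 * (s^-1 - s'^-1).
Proof.
move=> s1 s'0 ss; have s0 : 0 < s by lra.
have s'p : 0 < s' by rewrite lt_neqAle s'0 andbT eq_sym; apply/eqP => s'E; nra.
have -> : s^-1 - s'^-1 = (s' - s) / (s * s').
  rewrite invfM mulrBl mulrCA divff ?gt_eqF// mulr1 mulrA divff ?gt_eqF//.
  by rewrite mul1r.
rewrite mulrA ler_pdivlMr ?mulr_gt0// ler_pdivrMl ?exprn_gt0//.
have h1 : (s' - s) * (s' + s) = 1 by lra.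
have d0 : 0 <= s' - s by nra.
have h2 : s' * (s' + s) <= 4 * s ^+ 2 by nra.
have h3 : s' <= 4 * s ^+ 2 * (s' - s).
  have E : s' * (s' + s) * (s' - s) = s'.
    by rewrite -mulrA [(s' + s) * _]mulrC h1 mulr1.
  by have := ler_wpM2r d0 h2; rewrite E.
have := ler_wpM2l (ltW s0) h3; lra.
Qed.

Lemma measurable_norm_ge (f : Om -> R) (e : R) : measurable_fun setT f ->
  measurable [set w | (e <= `|f w|)%R].
Proof.
move=> mf; have mn : measurable_fun setT (fun w => `|f w|).
  exact: measurableT_comp.
have := mn measurableT `[e, +oo[%classic (measurable_itv _).
rewrite setTI; congr measurable.
by apply/seteqP; split=> w /=; rewrite in_itv/= andbT.
Qed.

Lemma markov_fourth (f : Om -> R) b (e : R) : bmeas f b -> 0 < e ->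
  (P [set w | (e <= `|f w|)%R] <= (E P (fun w => f w ^+ 4) / e ^+ 4)%:E)%E.
Proof.
move=> fb e0; set F := [set w | _].
have mF : measurable F by exact: measurable_norm_ge fb.1.
have mI : measurable_fun setT (\1_F : Om -> R) by exact: measurable_indic.
have bI : bmeas (\1_F : Om -> R) 1.
  by split => // w; rewrite indicE; case: (_ \in _); rewrite ?normr1 ?normr0.
have be : bmeas (fun w => e ^+ 4 * \1_F w) (`|e ^+ 4| * 1).
  by apply: bmeasM => //; exact: bmeas_cst.
have := E_le P be (bmeasX 4 fb); rewrite (EZ P _ bI) => h.
have PF : P F = (E P (\1_F))%:E.
  rewrite /E /Rintegral fineK; first by rewrite integral_indic// setIT.
  by apply: integrable_fin_num => //; exact: bmeas_integrable bI.
rewrite PF lee_fin ler_pdivlMr ?exprn_gt0// mulrC; apply: h => w.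
rewrite indicE; case: (boolP (w \in F)) => [|_]; last first.
  by rewrite mulr0 -[4%N]/(2 * 2)%N exprM sqr_ge0.
rewrite inE /F/= mulr1 => ew.
have -> : f w ^+ 4 = `|f w| ^+ 4.
  by rewrite -[4%N]/(2 * 2)%N !exprM real_normK// num_real.
by rewrite lerXn2r ?nnegrE// ltW.
Qed.

(** Markov's inequality for the fourth moment and the Borel-Cantelli lemma. The bound
    [c / n ^ (3 / 2)] leaves a factor [sqrt n] to the dependence. *)
Lemma ae_cvg0_fourth (Z : nat -> Om -> R) (b : nat -> R) (c : R) (n0 : nat) :
  (forall n, bmeas (Z n) (b n)) ->
  (forall n, (n0 < n)%N ->
     E P (fun w => Z n w ^+ 4) <= c / (n%:R * Num.sqrt n%:R)) ->
  {ae P, forall w, Z ^~ w @ \oo --> (0 : R)}.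
Proof.
move=> Zb Zc.
suff h : forall k : nat, {ae P, forall w, \forall n \near \oo, `|Z n w| < k.+1%:R^-1}.
  have := ae_foralln h; apply: filterS => w hw.
  apply/cvgrPdist_lt => e e0.
  have [k ke] : exists k : nat, k.+1%:R^-1 < e.
    exists (Num.truncn e^-1); rewrite -ltf_pV2 ?posrE ?invr_gt0// invrK.
    exact: truncnS_gt.
  apply: filterS (hw k) => n hn; rewrite sub0r normrN.
  exact: lt_trans hn ke.
move=> k; set e : R := k.+1%:R^-1; have e0 : 0 < e by rewrite invr_gt0.
pose F m := [set w | (e <= `|Z (m + n0.+1)%N w|)%R].
have mF m : measurable (F m) by exact: measurable_norm_ge (Zb _).1.
pose u m : R := (Num.sqrt (m + n0.+1)%:R)^-1.
pose c' := `|c| / e ^+ 4 * 4.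
have c'0 : 0 <= c' by rewrite mulr_ge0// divr_ge0// exprn_ge0// ltW.
have PF m : (P (F m) <= (c' * (u m - u m.+1))%:E)%E.
  apply: (le_trans (markov_fourth (Zb _) e0)); rewrite lee_fin.
  have sq j : Num.sqrt j%:R ^+ 2 = j%:R :> R by rewrite sqr_sqrtr.
  have s1 : 1 <= Num.sqrt (m + n0.+1)%:R :> R.
    by rewrite -{1}sqrtr1 ler_sqrt ?ler0n// addnS ler1n.
  have sS : Num.sqrt (m.+1 + n0.+1)%:R ^+ 2 =
      Num.sqrt (m + n0.+1)%:R ^+ 2 + 1 :> R by rewrite !sq addSn -natr1.
  have h := inv_sqrt_telescope s1 (sqrtr_ge0 _) sS.
  rewrite ler_pdivrMr ?exprn_gt0//; apply: (le_trans (Zc _ _)).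
    by rewrite addnS ltnS leq_addl.
  have -> : c' * (u m - u m.+1) * e ^+ 4 = `|c| * (4 * (u m - u m.+1)).
    transitivity (`|c| * (4 * (u m - u m.+1)) * ((e ^+ 4)^-1 * e ^+ 4)).
      by rewrite /c'; set a := (e ^+ 4)^-1; set a' := e ^+ 4; lra.
    by rewrite mulVf ?mulr1// expf_eq0/= gt_eqF.
  have -> : (m + n0.+1)%:R * Num.sqrt (m + n0.+1)%:R =
      Num.sqrt (m + n0.+1)%:R ^+ 3 :> R by rewrite exprSr sq.
  apply: (@le_trans _ _ (`|c| / Num.sqrt (m + n0.+1)%:R ^+ 3)).
    by rewrite ler_wpM2r ?ler_norm// invr_ge0 exprn_ge0// sqrtr_ge0.
  by rewrite ler_wpM2l.
have PL : P (lim_sup_set F) = 0%E.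
  apply: lim_sup_set_cvg0 => //.
  apply: (@le_lt_trans _ _ (c' * u 0%N)%:E); last exact: ltry.
  apply: lime_le; first exact: is_cvg_nneseries.
  apply: nearW => j; apply: (@le_trans _ _ (\sum_(0 <= i < j) (c' * (u i - u i.+1))%:E)%E).
    by apply: lee_sum => i _; exact: PF.
  rewrite sumEFin lee_fin -mulr_sumr ler_wpM2l//.
  rewrite (eq_bigr (fun i => - (u i.+1 - u i))) => [|i _]; last by rewrite opprB.
  by rewrite sumrN telescope_sumr// opprB lerBlDr lerDl invr_ge0 sqrtr_ge0.
exists (lim_sup_set F); split => //.
  by apply: bigcap_measurable => // j _; exact: bigcup_measurable.
move=> w /= nw j _.
apply: contrapT => h; apply: nw; exists (j + n0.+1)%N => // n /= jn.
have [i nE] : exists i, n = (i + n0.+1)%N.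
  by exists (n - n0.+1)%N; rewrite subnK// (leq_trans _ jn)// leq_addl.
rewrite ltNge; apply/negP => en; apply: h; exists i => /=.
  by move: jn; rewrite nE leq_add2r.
by rewrite /F/= -nE.
Qed.

End borel_cantelli.

Section growth.
Context {R : realType}.

Lemma leq_exp2r_weak m n e : (m <= n -> m ^ e <= n ^ e)%N.
Proof. by move=> mn; case: e => // e; rewrite leq_exp2r. Qed.

(** The left-hand side is the number of colours to the power 4 for maximal degree [D n].
    If [D n = n ^ eps] with [eps < 1 / (8 * p.+1)], then [D n ^ (4 * p)] is at most
    [sqrt n]. *)
Lemma degree_growth (D : nat -> nat) (eps : nat -> R) (p : nat) :
  eps n @[n --> \oo] --> (0 : R) ->
  (\forall n \near \oo, (D n)%:R = n%:R `^ eps n) ->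
  exists n0, forall n, (n0 < n)%N ->
    ((D n).+1 ^ p).+1%:R ^+ 4 <= (2 ^ (4 * p.+1))%:R * Num.sqrt n%:R :> R.
Proof.
move=> eps0 Deps.
have p0 : 0 < (8 * p.+1)%:R :> R by rewrite ltr0n.
have ip0 : 0 < (8 * p.+1)%:R^-1 :> R by rewrite invr_gt0.
have /cvgrPdist_lt/(_ _ ip0) h := eps0.
have [n0 _ n0P] : \forall n \near \oo, (D n)%:R = n%:R `^ eps n /\
    `|0 - eps n| < (8 * p.+1)%:R^-1.
  by apply: filterS2 Deps h => n.
exists n0 => n nn0; have [Dn en] := n0P n (ltnW nn0).
have n1 : 1 <= n%:R :> R by rewrite ler1n (leq_ltn_trans _ nn0).
have D0 : (0 < D n)%N by rewrite -(ltr_nat R) Dn powR_gt0// (lt_le_trans _ n1).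
have le1 : (((D n).+1 ^ p).+1 <= 2 ^ p.+1 * D n ^ p)%N.
  apply: (@leq_trans (2 * (D n).+1 ^ p)); first by rewrite mul2n -addnn -add1n leq_add2r expn_gt0.
  rewrite expnS -mulnA leq_mul2l/= -expnMn leq_exp2r_weak//.
  by rewrite mul2n -addnn -add1n leq_add2r.
apply: (@le_trans _ _ ((2 ^ p.+1 * D n ^ p)%:R ^+ 4)).
  by rewrite lerXn2r ?nnegrE// ler_nat.
rewrite -natrX expnMn -!expnM natrM [(p.+1 * 4)%N]mulnC ler_wpM2l//.
rewrite natrX Dn -powR_mulrn ?powR_ge0// -powRrM -powR12_sqrt ?(le_trans _ n1)//.
apply: ler_powR => //.
move: en; rewrite sub0r normrN => en.
have h1 : eps n <= (8 * p.+1)%:R^-1 by rewrite (le_trans (ler_norm _))// ltW.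
apply: (@le_trans _ _ ((8 * p.+1)%:R^-1 * (p * 4)%:R)).
  by rewrite ler_wpM2r.
rewrite mulrC ler_pdivrMr// ler_pdivlMl//.
by rewrite -natrM ler_nat; lia.
Qed.

End growth.

(** * The law of large numbers *)

Section law_of_large_numbers.
Context {R : realType}.
Variables (phi : R * R * R * R -> R) (psi : R * R -> R) (T L M : R).
Hypothesis L0 : 0 < L.
Hypothesis phiL : forall p q, `|phi p - phi q| <= L * `|p - q|.
Hypothesis psiL : forall p q, `|psi p - psi q| <= L * `|p - q|.
Hypothesis phiM : forall p, `|phi p| <= M.
Hypothesis T0 : 0 < T.
Notation C := (path_space T).
Variables (h : C -> R) (c H : R).
Hypothesis hc : forall f, `|h f| <= c.
Hypothesis H0 : 0 <= H.
Hypothesis hH : forall f g, `|h f - h g| <= H * sup_dist f g.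

Lemma lipschitz_path_continuous : continuous h.
Proof.
move=> f; apply: (cvgrPdist_lt (F := nbhs f) _ _).2 => e e0.
have H1 : 0 < H + 1 by rewrite ltr_wpDl.
apply/nbhs_ballP; exists (e / (H + 1)); first by rewrite /= divr_gt0.
move=> g; rewrite ball_sup_dist => fg; apply: (le_lt_trans (hH _ _)).
apply: (@le_lt_trans _ _ ((H + 1) * sup_dist f g)).
  by rewrite ler_wpM2r ?sup_dist_ge0// lerDl.
by rewrite mulrC -ltr_pdivlMr.
Qed.

Context {d} {Om : measurableType d} (P : probability Om R).
Variable X : Om -> nat -> borel C.
Hypothesis mX : forall i, measurable_fun setT (fun w => X w i).
Hypothesis pX : prod_rule P X.
Variable N : nat -> network R.
Hypothesis VN : forall n, vset (N n) = brack n.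
Hypothesis N_degree : exists2 eps : nat -> R, eps n @[n --> \oo] --> (0 : R) &
  \forall n \near \oo, (max_degree (N n))%:R = n%:R `^ eps n.

Definition obs n v (w : Om) : R := h (flow phi psi (N n) (X w) v).

Lemma obs_bmeas n v : bmeas (obs n v) c.
Proof.
split; last by move=> w; exact: hc.
apply: (measurableT_comp (flow_seqm_measurable L0 phiL psiL phiM T0
  lipschitz_path_continuous (N n) v)).
exact: (@seqm_measurable _ (borel C) _ Om X mX).
Qed.

Let lobs r n := local_obs phi psi h X (N n) r.

Lemma lobs_bmeas r n v : bmeas (lobs r n v) c.
Proof.
exact: (local_obs_bmeas L0 phiL psiL phiM T0 lipschitz_path_continuous hc mX).
Qed.

(** The locality of the flow, for a Lipschitz observable. *)
Lemma obs_local r n v w : `|obs n v w - lobs r n v w| <=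
  H * (stab_tail M T (2 * L) / 2 ^+ r).
Proof.
apply: (le_trans (hH _ _)); rewrite ler_wpM2l//.
apply: sup_dist_le => [|t tT].
  by rewrite divr_ge0 ?exprn_ge0// (stab_tail_ge0 phiM T0).
have TT : 0 <= T <= T by rewrite lexx ltW.
have := @flow_noise_dist R phi psi T L M L0 phiL psiL phiM T0 (N n) (X w)
  (mask (gball (N n) v r) (X w)) v r 0 T TT (lexx _).
rewrite mulr0 add0r; apply => // u Bu s sT.
by rewrite /mask; case: asboolP => // _; rewrite subrr normr0.
Qed.

Definition centred (Y : nat -> nat -> Om -> R) n (w : Om) : R :=
  n%:R^-1 * \sum_(v <- iota 1 n) (Y n v w - E P (Y n v)).

(** The fourth moment of the sum is at most the fourth power of the number of colours,
    which is [O(sqrt n)], times [n ^ 2], so that of the average is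
    [O(n ^ (- 3 / 2))]. *)
Lemma lln_local r : {ae P, forall w, (centred (lobs r)) ^~ w @ \oo --> (0 : R)}.
Proof.
have [eps eps0 epsP] := N_degree.
have [n0 n0P] := degree_growth (r + r) eps0 epsP.
have c0 : 0 <= c by exact: le_trans (hc point).
have bc n v : bmeas (fun w => lobs r n v w - E P (lobs r n v)) (c + c).
  apply: bmeasD (lobs_bmeas r n v) _; split; first exact: measurable_cst.
  by move=> w; rewrite normrN; apply: E_norm; exact: lobs_bmeas.
apply: (@ae_cvg0_fourth _ _ _ P (centred (lobs r))
  (fun n => `|n%:R^-1| * ((size (iota 1 n))%:R * (c + c)))
  (3 * (2 ^ (4 * (r + r).+1))%:R * (c + c) ^+ 4) n0).
  by move=> n; apply: bmeasM (bmeas_cst _) (bmeas_sum _ (bc n)).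
move=> n nn0; have n1 : 0 < n%:R :> R by rewrite ltr0n (leq_ltn_trans _ nn0).
have h4 := local_obs_fourth L0 phiL psiL phiM T0 lipschitz_path_continuous hc
  mX pX r (VN n).
rewrite (_ : (fun w => _) = (fun w => (n%:R^-1) ^+ 4 * (\sum_(v <- iota 1 n)
    (lobs r n v w - E P (lobs r n v))) ^+ 4)); last first.
  by apply/funext => w; rewrite /centred exprMn.
rewrite (EZ P _ (bmeasX 4 (bmeas_sum _ (bc n)))).
have i4 : 0 <= n%:R^-1 ^+ 4 :> R by rewrite exprn_ge0// invr_ge0 ltW.
apply: (le_trans (ler_wpM2l i4 h4)).
set K := _%:R ^+ 4; have KP : K <= (2 ^ (4 * (r + r).+1))%:R * Num.sqrt n%:R.
  exact: n0P.
set s := Num.sqrt n%:R in KP *.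
have s2 : s * s = n%:R by rewrite -expr2 sqr_sqrtr// ltW.
have s0 : 0 < s by rewrite sqrtr_gt0.
have cc : 0 <= (c + c) ^+ 4 by rewrite exprn_ge0// addr_ge0.
rewrite ler_pdivlMr ?mulr_gt0//.
apply: (@le_trans _ _ (n%:R^-1 ^+ 4 * (3 * ((2 ^ (4 * (r + r).+1))%:R * s) *
    n%:R ^+ 2 * (c + c) ^+ 4) * (n%:R * s))).
  apply: ler_wpM2r; first by rewrite mulr_ge0// ltW.
  apply: ler_wpM2l => //; apply: ler_wpM2r => //; apply: ler_wpM2r.
    exact: sqr_ge0.
  exact: ler_wpM2l.
have ni : n%:R^-1 * (s * s) = 1 by rewrite s2 mulVf// gt_eqF.
rewrite -s2 in ni *; set i := (s * s)^-1 in ni *.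
set A := (2 ^ _)%:R; set B := (c + c) ^+ 4.
rewrite (_ : _ * (s * s * s) = 3 * A * B * (i * (s * s)) ^+ 4); last by lra.
by rewrite ni expr1n mulr1.
Qed.

(** The localized averages converge almost surely for all radii at once, and they
    approximate the true ones uniformly in [n] and in the outcome. *)
Theorem lln : {ae P, forall w, (centred obs) ^~ w @ \oo --> (0 : R)}.
Proof.
apply: filterS (ae_foralln lln_local) => w hw.
apply/cvgrPdist_le => e e0; set tl := stab_tail M T (2 * L).
have t0 : 0 <= tl by exact: stab_tail_ge0 phiM T0 _.
have Ht1 : 0 < 2 * (H * tl) + 1 by rewrite ltr_wpDl// mulr_ge0// mulr_ge0.
have e2 : 0 < e / 2 by rewrite divr_gt0.
have [r rP] := ex_mesh Ht1 e2.
have rb : 2 * (H * (tl / 2 ^+ r)) <= e / 2.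
  apply: le_trans (ltW rP).
  rewrite !mulrA ler_wpM2r ?invr_ge0 ?exprn_ge0// -mulrA; lra.
have /cvgrPdist_lt/(_ _ e2) hwr := hw r.
near=> n; have : `|0 - centred (lobs r) n w| < e / 2 by near: n.
rewrite !sub0r !normrN => hn.
set b := H * (tl / 2 ^+ r) in rb.
have b0 : 0 <= b by rewrite mulr_ge0// divr_ge0// exprn_ge0.
have dE v : `|E P (obs n v) - E P (lobs r n v)| <= b.
  have bN := bmeasM (bmeas_cst (-1)) (lobs_bmeas r n v).
  have := @E_norm _ _ _ P (fun w => obs n v w + -1 * lobs r n v w) b.
  rewrite (ED P (obs_bmeas n v) bN) (EZ P _ (lobs_bmeas r n v)) mulN1r; apply.
  split; first by have [] := bmeasD (obs_bmeas n v) bN.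
  by move=> w'; rewrite mulN1r; exact: obs_local.
have [n1|n1] := posnP n.
  by rewrite /centred n1 big_nil mulr0 normr0 ltW.
have n1' : 0 < n%:R :> R by rewrite ltr0n.
suff h2 : `|centred obs n w - centred (lobs r) n w| <= 2 * b.
  have := ler_normB (centred obs n w - centred (lobs r) n w) (- centred (lobs r) n w).
  by rewrite opprK subrK normrN; lra.
rewrite /centred -mulrBr -sumrB normrM ger0_norm; last by rewrite invr_ge0 ltW.
rewrite ler_pdivrMl//; apply: (le_trans (ler_norm_sum _ _ _)).
apply: (@le_trans _ _ (\sum_(v <- iota 1 n) (2 * b))).
  apply: ler_sum => v _.
  have -> : obs n v w - E P (obs n v) - (lobs r n v w - E P (lobs r n v)) =
    (obs n v w - lobs r n v w) - (E P (obs n v) - E P (lobs r n v)) by lra.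
  rewrite (le_trans (ler_normB _ _))//.
  by have := obs_local r n v w; have := dE v; rewrite -/tl -/b; lra.
by rewrite big_const_seq count_predT size_iota iter_addr_0 -[leLHS]mulr_natl.
Unshelve. all: by end_near. Qed.

End law_of_large_numbers.

(** * Comparison of neighbourhoods *)

Section good_neighbourhoods.
Context {R : realType}.
Implicit Types (x y : rooted R) (r : nat).

(** The change of a normalized weight comes from the weight itself and from the total
    mass; both are controlled by [e], relative to the total mass. *)
Lemma ratio_dist (s : seq nat) (a a' : nat -> R) (e : R) :
  (forall u, u \in s -> 0 < a u) -> (forall u, u \in s -> 0 < a' u) ->
  (forall u, u \in s -> `|a' u - a u| <= e) ->
  \sum_(u <- s) `|(\sum_(u <- s) a u)^-1 * a u - (\sum_(u <- s) a' u)^-1 * a' u| <=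
  e * (2 * (size s)%:R / \sum_(u <- s) a u).
Proof.
move=> a0 a'0 aa'.
have [->|s0] := eqVneq s [::]; first by rewrite !big_nil mulr0 mul0r mulr0.
set m := \sum_(u <- s) a u; set m' := \sum_(u <- s) a' u.
have pos (b : nat -> R) : (forall u, u \in s -> 0 < b u) -> 0 < \sum_(u <- s) b u.
  case: s s0 {a0 a'0 aa' m m'} => // v s _ b0; rewrite big_cons ltr_pwDl//.
    by apply: b0; rewrite mem_head.
  rewrite big_seq sumr_ge0// => u us; rewrite ltW// b0// inE us orbT.
  by [].
have m0 : 0 < m by exact: pos. have m'0 : 0 < m' by exact: pos.
have sc (e' : R) : \sum_(u <- s) e' = (size s)%:R * e'.
  by rewrite big_const_seq count_predT iter_addr_0 mulr_natl.
have mm' : `|m' - m| <= (size s)%:R * e.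
  rewrite /m /m' -sumrB (le_trans (ler_norm_sum _ _ _))// -sc.
  by rewrite big_seq [leRHS]big_seq; apply: ler_sum => u /aa'.
apply: (@le_trans _ _ (\sum_(u <- s) (e / m + `|m' - m| / m * (m'^-1 * a' u)))).
  rewrite big_seq [leRHS]big_seq; apply: ler_sum => u us.
  have -> : m^-1 * a u - m'^-1 * a' u =
      (a u - a' u) / m + (m' - m) / m * (m'^-1 * a' u).
    have e1 : m * m^-1 = 1 by rewrite divff// gt_eqF.
    have e2 : m' * m'^-1 = 1 by rewrite divff// gt_eqF.
    move: e1 e2; set i := m^-1; set i' := m'^-1 => e1 e2.
    have -> : (a u - a' u) * i + (m' - m) * i * (i' * a' u) =
      i * (a u - a' u) + i * (m' * i') * a' u - (m * i) * (i' * a' u) by lra.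
    by rewrite e1 e2; lra.
  rewrite (le_trans (ler_normD _ _))// !normrM.
  have i0 : 0 < m^-1 by rewrite invr_gt0.
  have i'0 : 0 < m'^-1 by rewrite invr_gt0.
  rewrite (gtr0_norm i0) (gtr0_norm i'0) (gtr0_norm (a'0 _ us)) lerD2r.
  by rewrite ler_pM2r// distrC; exact: aa'.
rewrite big_split/= sc -mulr_sumr -mulr_sumr mulVf ?gt_eqF// mulr1.
have : `|m' - m| / m <= (size s)%:R * e / m by rewrite ler_pM2r ?invr_gt0.
lra.
Qed.

(** The factor by which [ratio_dist] turns a change of the weights into a change of the
    transition probabilities is bounded on a ball, which is finite. *)
Lemma ball_modulus_ex x r : exists2 k : R, 0 <= k & forall v,
  gball x (Defs.root x) r v -> 2 * (size (nbs x v))%:R / vertex_mu x v <= k.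
Proof.
pose F v : R := 2 * (size (nbs x v))%:R / vertex_mu x v.
have F0 v : 0 <= F v by rewrite divr_ge0 ?vertex_mu_ge0// mulr_ge0.
exists (\sum_(v <- fset_set (gball x (Defs.root x) r)) F v); first by apply: sumr_ge0.
move=> v Bv; have vB : v \in fset_set (gball x (Defs.root x) r).
  by rewrite in_fset_set ?inE//; exact: gball_finite.
by rewrite (big_rem v vB)/= lerDl sumr_ge0.
Qed.

(** For a vertex in the interior of the ball all neighbours lie in the ball, so that an
    isomorphism of balls maps its neighbourhood onto a neighbourhood. *)
Lemma good_nbs_close x y r (e : R) g :
  set_bij (gball x (Defs.root x) r) (gball y (Defs.root y) r) g ->
  g (Defs.root x) = Defs.root y ->
  (forall u v, gball x (Defs.root x) r u -> gball x (Defs.root x) r v ->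
     adj y (g u) (g v) = adj x u v) ->
  (forall u v, gball x (Defs.root x) r u -> gball x (Defs.root x) r v -> adj x u v ->
     `|ewt y (g u) (g v) - ewt x u v| < e) ->
  forall v j, (j < r)%N -> gball x (Defs.root x) j v ->
  nbs_close x y g (e * (2 * (size (nbs x v))%:R / vertex_mu x v)) v.
Proof.
move=> [gsub ginj gsurj] gr gE ge v j jr Bv.
have Bvr : gball x (Defs.root x) r v by apply: gballS Bv; exact: ltnW.
have Bu u : adj x v u -> gball x (Defs.root x) r u.
  by move=> vu; apply: (@gballS _ _ _ j.+1) => //; exact: gball_step vu.
have pe : perm_eq (map g (nbs x v)) (nbs y (g v)).
  apply: uniq_perm; last 2 first.
  - exact: nbs_uniq.
  - move=> u'; rewrite mem_nbs; apply/mapP/idP => [[u] |vu'].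
      by rewrite mem_nbs => vu ->; rewrite gE//; exact: Bu.
    have Bv' : gball y (Defs.root y) j (g v).
      by apply: (gball_image gr gE) Bv; exact: ltnW.
    have [u Bxu uE] := gsurj u' (gballS jr (gball_step Bv' vu')).
    by exists u => //; rewrite mem_nbs -gE// uE.
  rewrite map_inj_in_uniq ?nbs_uniq// => u w; rewrite !mem_nbs => vu vw.
  by apply: ginj; rewrite inE; exact: Bu.
split => //; rewrite /pw vertex_muE [vertex_mu y _]vertex_muE -(perm_big _ pe)/= big_map.
apply: (@ratio_dist (nbs x v) (fun u => ewt x u v) (fun u => ewt y (g u) (g v)) e).
- by move=> u; exact: nbs_ewt_gt0.
- move=> u uv; apply: nbs_ewt_gt0; rewrite -(perm_mem pe).
  exact: map_f.
- move=> u; rewrite mem_nbs => vu; apply/ltW/ge => //; first exact: Bu.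
  by rewrite adj_sym.
Qed.

(** Outside [A] the extension shifts by more than all values of [g] on [A]. Relabelling
    the noise requires an injection that is defined on all the vertices. *)
Lemma extend_injective (A : set nat) (g : nat -> nat) : finite_set A ->
  set_inj A g -> exists2 s : nat -> nat, injective s & {in A, s =1 g}.
Proof.
move=> Af ginj.
have [n nP] := finite_set_bounded (finite_image g Af).
exists (fun v => if `[< A v >] then g v else (v + n)%N).
  move=> u v; case: asboolP => Au; case: asboolP => Av.
  - by apply: ginj; rewrite inE.
  - move=> uE; have : (g u < n)%N by apply: nP; exists u.
    by rewrite uE ltnNge leq_addl.
  - move=> uE; have : (g v < n)%N by apply: nP; exists v.
    by rewrite -uE ltnNge leq_addl.
  - exact: addIn.
by move=> v; rewrite inE => Av; case: asboolP.
Qed.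

End good_neighbourhoods.

(** * Expected observables at the root *)

(** Both expectations are integrals against the law of the variable. *)
Lemma E_same_law d d' (Om : measurableType d) (S : measurableType d') (R : realType)
    (P : probability Om R) (X Y : Om -> S) (f : S -> R) c :
  measurable_fun setT X -> measurable_fun setT Y ->
  (forall A, measurable A -> P [set w | A (X w)] = P [set w | A (Y w)]) ->
  bmeas f c -> E P (fun w => f (X w)) = E P (fun w => f (Y w)).
Proof.
move=> mX mY XY fc.
have mf : measurable_fun setT (EFin \o f) by apply/measurable_EFinP; exact: fc.1.
have bX (Z : Om -> S) : measurable_fun setT Z -> bmeas (fun w => f (Z w)) c.
  by move=> mZ; split; [exact: (measurableT_comp fc.1 mZ)|move=> w; exact: fc.2].
have eX (Z : Om -> S) (mZ : measurable_fun setT Z) :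
    (\int[law P mZ]_x (f x)%:E = \int[P]_w (f (Z w))%:E)%E.
  rewrite integral_distribution//.
  exact: bmeas_integrable (bX _ mZ).
rewrite /E /Rintegral -(eX _ mX) -(eX _ mY); congr fine.
by apply: eq_measure_integral => A mA _; exact: XY.
Qed.

Section root_observable.
Local Open Scope quotient_scope.
Context {R : realType}.
Variables (phi : R * R * R * R -> R) (psi : R * R -> R) (T L M : R).
Hypothesis L0 : 0 < L.
Hypothesis phiL : forall p q, `|phi p - phi q| <= L * `|p - q|.
Hypothesis psiL : forall p q, `|psi p - psi q| <= L * `|p - q|.
Hypothesis phiM : forall p, `|phi p| <= M.
Hypothesis T0 : 0 < T.
Notation C := (path_space T).
Context {d} {Om : measurableType d} (P : probability Om R).
Variable X : Om -> nat -> borel C.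
Hypothesis mX : forall i, measurable_fun setT (fun w => X w i).
Hypothesis Xex : forall s : nat -> nat, injective s ->
  forall A : set (seqm (borel C)), measurable A ->
    P [set w | A (X w)] = P [set w | A (fun v => X w (s v))].

(** The flow of the network satisfies the equation of the component at all the vertices
    of the component. *)
Lemma flow_component (N : network R) (b : nat -> C) v :
  flow phi psi (rooted_component N v) b v = flow phi psi N b v.
Proof.
symmetry; apply: (flow_unique L0 phiL psiL phiM T0) => r u.
move=> /(@gball_vset R (rooted_component N v)) /= Cu t tT.
rewrite (flowP L0 phiL psiL phiM T0 N b u tT).
have nbsE : nbs (rooted_component N v) u = nbs N u.
  congr fset_set; apply/seteqP; split=> w /=; first by case/and3P.
  move=> uw; rewrite uw !mem_set//.
  by have [p vp pu] := Cu; exists (rcons p w); rewrite ?last_rcons// rcons_path vp pu.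
congr (_ + _ + _); congr Rintegral; apply/funext => s.
rewrite !driftE nbsE; congr (_ + _); apply: eq_bigr => w _.
by rewrite /pw !vertex_muE nbsE.
Qed.

Section observable.
Variables (h : C -> R) (c H : R).
Hypothesis hc : forall f, `|h f| <= c.
Hypothesis H0 : 0 <= H.
Hypothesis hH : forall f g, `|h f - h g| <= H * sup_dist f g.

Definition root_obs (x : rooted R) : R :=
  E P (fun w => h (flow phi psi x (X w) (Defs.root x))).

Let hcont : continuous h. Proof. exact: lipschitz_path_continuous H0 hH. Qed.

Lemma flow_obs_bmeas (N : network R) (s : nat -> nat) v :
  bmeas (fun w => h (flow phi psi N (fun u => X w (s u)) v)) c.
Proof.
split; last by move=> w; exact: hc.
apply: (measurableT_comp (flow_seqm_measurable L0 phiL psiL phiM T0 hcont N v)).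
by apply: seqm_measurable => i; exact: mX.
Qed.

Lemma root_obs_relabel (x : rooted R) s : injective s ->
  root_obs x = E P (fun w => h (flow phi psi x (fun u => X w (s u)) (Defs.root x))).
Proof.
move=> sinj; apply: (@E_same_law _ _ _ (seqm (borel C)) R P X
  (fun w u => X w (s u)) (fun b => h (flow phi psi x b (Defs.root x))) c).
- exact: seqm_measurable.
- by apply: seqm_measurable => i; exact: mX.
- by move=> A mA; exact: Xex.
- split; last by move=> b; exact: hc.
  exact: (flow_seqm_measurable L0 phiL psiL phiM T0 hcont).
Qed.

(** A good isomorphism of balls is used twice: it matches the two networks, and, by
    exchangeability, it lets matched vertices carry the same noise. *)
Theorem root_obs_good (x : rooted R) (r : nat) : exists2 k : R, 0 <= k &
  forall (y : rooted R) r' (e : R), 0 < e -> (r < r')%N -> good x y r' e ->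
    `|root_obs x - root_obs y| <=
    H * (stab_coef M T (2 * L) * (e + e * k) + stab_tail M T (2 * L) / 2 ^+ r).
Proof.
have [k k0 kP] := ball_modulus_ex x r; exists k => // y r' e e0 rr' [g [gb gr gE gv ge]].
have [s sinj sg] := extend_injective (gball_finite x (Defs.root x) r')
  (let: And3 _ i _ := gb in i).
have nc := good_nbs_close gb gr gE ge.
have bx := flow_obs_bmeas x s (Defs.root x).
have by_ := flow_obs_bmeas y id (Defs.root y).
have b1 := bmeasM (bmeas_cst (-1)) by_.
rewrite (root_obs_relabel x sinj) /root_obs.
have := @E_norm _ _ _ P (fun w => h (flow phi psi x (fun u => X w (s u)) (Defs.root x)) +
  -1 * h (flow phi psi y (X w) (Defs.root y))).
rewrite (ED P bx b1) (EZ P _ by_) mulN1r; apply.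
split; first by have [] := bmeasD bx b1.
move=> w; rewrite mulN1r (le_trans (hH _ _))// ler_wpM2l//.
have c0 := stab_coef_ge0 L0 phiM T0 (erefl (2 * L)).
have t0 := stab_tail_ge0 phiM T0 (2 * L).
have ek : 0 <= e * k by rewrite mulr_ge0// ltW.
apply: sup_dist_le => [|t tT].
  by rewrite addr_ge0 ?divr_ge0 ?exprn_ge0// mulr_ge0// addr_ge0// ltW.
have TT : 0 <= T <= T by rewrite lexx ltW.
rewrite -gr.
apply: (@stability R phi psi L M T L0 phiL psiL phiM T0 (2 * L) erefl x y g
  (Defs.root x) r (fun v => path_at (X w (s v))) (fun v => path_at (X w v))
  _ _ e (e * k) T TT (ltW e0) ek _ _ _ t tT).
- move=> v _; split; first exact: (flowP L0 phiL psiL phiM T0 x (fun u => X w (s u))).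
  exact: (flowP L0 phiL psiL phiM T0 y (X w)).
- move=> v Bv; have Bv' : gball x (Defs.root x) r' v.
    by apply: gballS Bv; exact: ltnW.
  have [h1 h2] := gv v Bv'; split; [exact: ltW|exact: ltW|].
  by move=> z _; rewrite sg ?inE// subrr normr0 ltW.
- move=> v j jr Bv; have [pe le] := nc v j (ltn_trans jr rr') Bv.
  split=> //; apply: (le_trans le); rewrite ler_pM2l//; apply: kP.
  by apply: gballS Bv; exact: ltnW.
Qed.

(** The constant [k] depends on the ball of radius [r] in [x]: the radius is chosen
    first, to make the tail small, and then the distance of the networks. *)
Lemma root_obs_rdist (x : rooted R) (e : R) : 0 < e ->
  exists2 z : R, 0 < z & forall y, (rdist x y < z%:E)%E ->
    `|root_obs x - root_obs y| <= e.
Proof.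
move=> e0; set c1 := stab_coef M T (2 * L); set t1 := stab_tail M T (2 * L).
have c0 : 0 <= c1 by exact: stab_coef_ge0 L0 phiM T0 _ (erefl (2 * L)).
have t0 : 0 <= t1 by exact: stab_tail_ge0 phiM T0 (2 * L).
have e2 : 0 < e / 2 by rewrite divr_gt0.
have Ht : 0 < H * t1 + 1 by rewrite ltr_wpDl//; apply: mulr_ge0.
have [r rP] := ex_mesh Ht e2.
have [k k0 kP] := root_obs_good x r.
pose z1 := e / 2 / (H * (c1 * (1 + k)) + 1).
have d0 : 0 < H * (c1 * (1 + k)) + 1.
  rewrite ltr_wpDl//; apply: mulr_ge0 => //; apply: mulr_ge0 => //.
  by rewrite addr_ge0.
have z10 : 0 < z1 by rewrite divr_gt0.
exists (Num.min z1 r.+2%:R^-1); first by rewrite lt_min z10 /= invr_gt0.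
move=> y /rdist_ltP[r' [de [de0 gxy]]]; rewrite lt_min => /andP[h1 h2].
have rr' : (r < r')%N.
  have : r'.+1%:R^-1 < r.+2%:R^-1 :> R by apply: le_lt_trans h2; rewrite lerDl ltW.
  by rewrite ltf_pV2 ?posrE// ltr_nat ltnS => /ltnW.
have dz : de <= z1 by rewrite ltW// (le_lt_trans _ h1)// lerDr invr_ge0.
apply: (le_trans (kP y r' de de0 rr' gxy)); rewrite -/c1 -/t1.
have h3 : H * (t1 / 2 ^+ r) <= e / 2.
  apply: le_trans (ltW rP); rewrite mulrA ler_wpM2r ?invr_ge0 ?exprn_ge0//.
  by rewrite lerDl.
have h4 : de * (H * (c1 * (1 + k)) + 1) <= e / 2.
  by rewrite -ler_pdivlMr.
have h5 : 0 <= de by exact: ltW.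
by move: h3 h4; set a := t1 / _; lra.
Qed.

Lemma root_obs_iso (x y : rooted R) : rooted_iso x y -> root_obs x = root_obs y.
Proof.
move=> xy; apply/eqP; rewrite -subr_eq0 -normr_le0; apply/ler_addgt0Pr => e e0.
rewrite add0r; have [z z0 zP] := root_obs_rdist x e0.
by apply: zP; exact: rdist_iso.
Qed.

Definition class_obs (A : Nstar R) : R := root_obs (repr A).

Lemma class_obs_pi (x : rooted R) : class_obs (\pi_(Nstar R) x) = root_obs x.
Proof.
rewrite /class_obs; apply: root_obs_iso.
apply/asboolP; rewrite -[asbool _]/(rooted_iso_equiv _ _).
by rewrite -(@eqmodE _ (@rooted_iso_equiv R)); apply/eqP; rewrite reprK.
Qed.

Lemma class_obs_continuous : continuous class_obs.
Proof.
move=> A; apply: (cvgrPdist_le (F := nbhs A) _ _).2 => e e0.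
have [z z0 zP] := root_obs_rdist (repr A) e0.
by apply/nbhs_ballP; exists z => // B AB; exact: zP.
Qed.

Lemma class_obs_bound A : `|class_obs A| <= c.
Proof. by apply: E_norm; exact: flow_obs_bmeas (repr A) id _. Qed.

(** Identifies the average of the expected observables over the vertices of [N] as an
    integral against the measure [root_measure N]. *)
Lemma class_obs_component (N : network R) v :
  class_obs (\pi_(Nstar R) (rooted_component N v)) =
  E P (fun w => h (flow phi psi N (X w) v)).
Proof.
rewrite class_obs_pi /root_obs; congr E; apply/funext => w /=.
by rewrite flow_component.
Qed.

End observable.
End root_observable.

(** * Measurability of the nice networks *)

Section nice_measurable.
Context {R : realType}.
Implicit Types (x y : rooted R) (A : Nstar R).

Lemma rdist_good x q (e : R) : 0 < e -> exists2 z : R, 0 < z &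
  forall y, (rdist x y < z%:E)%E -> exists r e', [/\ (q < r)%N, e' < e & good x y r e'].
Proof.
move=> e0; exists (Num.min e q.+2%:R^-1); first by rewrite lt_min e0 /= invr_gt0.
move=> y /rdist_ltP[r [e' [e'0 gxy]]]; rewrite lt_min => /andP[h1 h2].
exists r, e'; split => //.
  have : r.+1%:R^-1 < q.+2%:R^-1 :> R by apply: le_lt_trans h2; rewrite lerDl ltW.
  by rewrite ltf_pV2 ?posrE// ltr_nat ltnS => /ltnW.
by apply: le_lt_trans h1; rewrite lerDr invr_ge0.
Qed.

Lemma gbdry_finite (N : network R) o r : finite_set (gbdry N o r).
Proof. by apply: sub_finite_set (gball_finite N o r) => v []. Qed.

(** An isomorphism of slightly larger balls maps boundary vertices to boundary
    vertices. *)
Lemma good_gbdry x y r q (e : R) : (r < q)%N -> good x y q e ->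
  (#|` fset_set (gbdry y (Defs.root y) r)| <= #|` fset_set (gbdry x (Defs.root x) r)|)%N.
Proof.
move=> rq [f [[fsub finj fsurj] fr fE _ _]].
have Bq := gball_root x (Defs.root x) q.
have sub : gbdry y (Defs.root y) r `<=` f @` gbdry x (Defs.root x) r.
  move=> w [Bw [u' wu' nu']].
  have [v Bv vE] := fsurj w (gballS (ltnW rq) Bw).
  have [u Bu uE] := fsurj u' (gballS rq (gball_step Bw wu')).
  exists v => //; split.
    apply: (gball_preimage fr Bq finj fE fsurj (ltnW rq) Bv).
    by rewrite vE.
  exists u; first by rewrite -fE// vE uE.
  move=> Bur; apply: nu'; rewrite -uE.
  by apply: (gball_image fr fE) Bur; exact: ltnW.
have ff := gbdry_finite x (Defs.root x) r.
apply: (@leq_trans #|` [fset f v | v in fset_set (gbdry x (Defs.root x) r)]%fset|).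
  apply: fsubset_leq_card; apply/fsubsetP => w; rewrite in_fset_set; last exact: gbdry_finite.
  rewrite inE => /sub[v Bv <-]; apply/imfsetP; exists v => //=.
  by rewrite in_fset_set ?inE.
exact: leq_imfset_card.
Qed.

Lemma measurable_open_class (U : set (Nstar R)) :
  (forall A, U A -> exists2 z : R, 0 < z & forall B, (ndist A B < z%:E)%E -> U B) ->
  measurable (U : set (borel (Nstar R))).
Proof.
move=> UP; apply: sub_sigma_algebra; rewrite /= openE => A /UP[z z0 zP].
by apply/nbhs_ballP; exists z.
Qed.

Local Notation rp A := (repr (A : Nstar R) : rooted R).

(** With an integer constant [a.+1], which loses nothing as the condition becomes weaker
    when the constant grows. *)
Definition growth_class (a r : nat) : set (Nstar R) := [set A |
  #|` fset_set (gbdry (rp A) (Defs.root (rp A)) r) |%:R <=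
    a.+1%:R * expR (a.+1%:R * r%:R) :> R].

Definition weight_class (k : nat) : set (Nstar R) := [set A |
  forall u v, adj (rp A) u v -> k.+1%:R^-1 <= ewt (rp A) u v <= k.+1%:R].

(** The cardinality of the boundary is locally constant in the network, so these
    classes are open. *)
Lemma growth_class_measurable a r :
  measurable (growth_class a r : set (borel (Nstar R))).
Proof.
apply: measurable_open_class => A h.
have [z z0 zP] := rdist_good (rp A) r (@ltr01 R).
exists z => // B /zP[q [e [rq _ /(good_gbdry rq) le]]].
by apply: le_trans h; rewrite ler_nat.
Qed.

Lemma edge_in_ball x u v : adj x u v -> exists r,
  gball x (Defs.root x) r u /\ gball x (Defs.root x) r v.
Proof.
move=> uv; have [p xp pu] := rooted_connected (root_vset x) (adj_vset uv).
have Bu : gball x (Defs.root x) (size p) u by exists p.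
exists (size p).+1; split; first exact: gballS Bu.
exact: gball_step uv.
Qed.

(** An edge whose weight violates the bounds persists, with nearly the same weight, in
    all the networks close to this one: the complement is open. *)
Lemma weight_class_measurable k :
  measurable (weight_class k : set (borel (Nstar R))).
Proof.
rewrite -[weight_class k]setCK; apply: (@measurableC _ (borel (Nstar R))).
apply: measurable_open_class => A.
move=> /existsNP[u /existsNP[v /not_implyP[uv /negP nw]]].
have [q [Bu Bv]] := edge_in_ball uv.
have {nw}[e e0 eP] : exists2 e : R, 0 < e & forall x : R,
    `|x - ewt (rp A) u v| < e -> ~~ (k.+1%:R^-1 <= x <= k.+1%:R).
  move: nw; set m := ewt _ _ _; rewrite negb_and -!ltNge => /orP[h|h].
    exists (k.+1%:R^-1 - m); first by rewrite subr_gt0.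
    move=> x xm; rewrite negb_and -!ltNge; apply/orP; left.
    by move: h (le_lt_trans (ler_norm _) xm); set y := k.+1%:R^-1; lra.
  exists (m - k.+1%:R); first by rewrite subr_gt0.
  move=> x xm; rewrite negb_and -!ltNge; apply/orP; right.
  by rewrite distrC in xm; move: (le_lt_trans (ler_norm _) xm); lra.
have [z z0 zP] := rdist_good (rp A) q e0.
exists z => // B /zP[r [e' [qr e'e [f [_ _ fE _ fw]]]]].
have Bu' := gballS (ltnW qr) Bu; have Bv' := gballS (ltnW qr) Bv.
move=> /(_ (f u) (f v)); rewrite fE// => /(_ uv); apply/negP/eP.
exact: lt_trans (fw _ _ Bu' Bv' uv) e'e.
Qed.

Lemma weight_classP A : (exists k, weight_class k A) <->
  (0 < ereal_inf [set x%:E | x in edge_weights (rp A)])%E /\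
  (ereal_sup [set x%:E | x in edge_weights (rp A)] < +oo)%E.
Proof.
split=> [[k kP]|[]].
  split.
    apply: (@lt_le_trans _ _ (k.+1%:R^-1)%:E); first by rewrite lte_fin invr_gt0.
    by apply: le_ereal_inf_tmp => _ [_ [u [v [uv ->]]] <-]; rewrite lee_fin; have /andP[] := kP u v uv.
  apply: (@le_lt_trans _ _ (k.+1%:R)%:E); last exact: ltry.
  by apply: ge_ereal_sup => _ [_ [u [v [uv ->]]] <-]; rewrite lee_fin; have /andP[] := kP u v uv.
set I := ereal_inf _; set S := ereal_sup _ => I0 Soo.
have [k kP] : exists k : nat, ((k.+1%:R^-1)%:E <= I)%E.
  case: I I0 => [i| |]//; rewrite ?lte_fin => i0; last by exists 0%N; rewrite leey.
  exists (Num.truncn i^-1); rewrite lee_fin ltW// -ltf_pV2 ?posrE ?invr_gt0// invrK.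
  exact: truncnS_gt.
have [l lP] : exists l : nat, (S <= (l.+1%:R)%:E)%E.
  case: S Soo => [s| |]// _; last by exists 0%N; rewrite leNye.
  by exists (Num.truncn s); rewrite lee_fin ltW// truncnS_gt.
exists (maxn k l) => u v uv.
have inW : [set x%:E | x in edge_weights (rp A)] (ewt (rp A) u v)%:E.
  by exists (ewt (rp A) u v) => //; exists u, v.
have h1 := le_trans kP (ereal_inf_lbound inW).
have h2 := le_trans (ereal_sup_ubound inW) lP.
rewrite !lee_fin in h1 h2; apply/andP; split.
  by apply: le_trans h1; rewrite lef_pV2 ?posrE// ler_nat ltnS leq_maxl.
by apply: (le_trans h2); rewrite ler_nat ltnS leq_maxr.
Qed.

(** Being nice is a countable combination of growth conditions, which are open, and of
    bounds on the weights, which are closed. *)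
Theorem nice_classes_measurable :
  measurable (nice_classes R : set (borel (Nstar R))).
Proof.
have -> : nice_classes R =
    (\bigcup_a \bigcap_(r in [set r | (1 <= r)%N]) growth_class a r) `&`
    (\bigcup_k weight_class k).
  apply/seteqP; split=> A.
    move=> [[a a0 aP] /weight_classP[k kP]]; split; last by exists k.
    exists (Num.truncn a) => // r r1; apply: (le_trans (aP r r1)).
    have aa : a <= (Num.truncn a).+1%:R by rewrite ltW// truncnS_gt.
    by apply: ler_pM; rewrite ?expR_ge0 ?(ltW a0)// ler_expR ler_wpM2r.
  move=> [[a _ aP] [k _ kP]]; split; last by apply/weight_classP; exists k.
  by exists a.+1%:R => // r r1; exact: aP.
apply: (@measurableI _ (borel (Nstar R))).
  apply: (@bigcupT_measurable _ (borel (Nstar R))) => a.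
  apply: (@bigcap_measurable _ (borel (Nstar R))); first by exists 1%N.
  by move=> r _; exact: growth_class_measurable.
apply: (@bigcupT_measurable _ (borel (Nstar R))) => k.
exact: weight_class_measurable.
Qed.

End nice_measurable.

(** * Maxima of cones *)

Section cones.
Context {R : realType} {T : R}.
Notation C := (path_space T).
Variable q : nat -> C.
Hypothesis qP : forall f e, 0 < e -> exists i, sup_dist f (q i) < e.

Definition code := (nat * nat * nat * nat)%type.

(** Heights are rational and slopes integral, so that there are countably many
    cones. *)
Definition cone (z : code) (f : C) : R :=
  let: (i, m, p, k) := z in p%:R / k.+1%:R - m%:R * sup_dist f (q i).

Definition cones (s : seq code) (f : C) : R :=
  foldr (fun z a => Num.max (cone z f) a) 0 s.

Lemma cones_ge0 s f : 0 <= cones s f.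
Proof. by elim: s => //= z s ih; rewrite le_max ih orbT. Qed.

Lemma cone_le_cones s z f : z \in s -> cone z f <= cones s f.
Proof.
elim: s => //= z' s ih; rewrite inE => /predU1P[->|/ih h].
  by rewrite le_max lexx.
by rewrite le_max h orbT.
Qed.

Lemma cones_le s f b : 0 <= b -> (forall z, z \in s -> cone z f <= b) ->
  cones s f <= b.
Proof.
move=> b0; elim: s => //= z s ih h; rewrite ge_max h ?mem_head//=.
by apply: ih => z' z's; apply: h; rewrite inE z's orbT.
Qed.

Lemma cones_bound s : exists c : R, forall f, `|cones s f| <= c.
Proof.
elim: s => [|[[[i m] p] k] s [c cP]]; first by exists 0 => f; rewrite /= normr0.
exists (p%:R / k.+1%:R + c) => f; rewrite ger0_norm ?cones_ge0//=.
have h := le_trans (ler_norm _) (cP f).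
have h0 := cones_ge0 s f.
have pk : 0 <= p%:R / k.+1%:R :> R by rewrite divr_ge0.
rewrite ge_max; apply/andP; split; last by rewrite (le_trans h)// lerDr.
have : 0 <= m%:R * sup_dist f (q i) by rewrite mulr_ge0// sup_dist_ge0.
by move: pk; set a := _ / _; lra.
Qed.

Lemma sup_dist_lipschitz (p f g : C) : sup_dist f p - sup_dist g p <= sup_dist f g.
Proof.
rewrite lerBlDr.
exact: (@metric_triangle _ C f g p).
Qed.

Lemma max_dist (a b a' b' e : R) : `|a - a'| <= e -> `|b - b'| <= e ->
  `|Num.max a b - Num.max a' b'| <= e.
Proof.
rewrite !ler_norml => /andP[h1 h2] /andP[h3 h4].
rewrite /Num.max; case: ltP => h; case: ltP => h';
  apply/andP; split; lra.
Qed.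

Lemma cones_lipschitz s : exists2 H : R, 0 <= H &
  forall f g, `|cones s f - cones s g| <= H * sup_dist f g.
Proof.
elim: s => [|[[[i m] p] k] s [H H0 HP]].
  by exists 0 => // f g; rewrite /= subrr normr0 mul0r.
exists (m%:R + H); first by rewrite addr_ge0.
move=> f g /=; have d0 := sup_dist_ge0 f g; apply: max_dist.
  have h1 := sup_dist_lipschitz (q i) f g.
  have h2 := sup_dist_lipschitz (q i) g f; rewrite (sup_distC g f) in h2.
  set a := _ / _; have -> : a - m%:R * sup_dist f (q i) - (a - m%:R * sup_dist g (q i)) =
    m%:R * (sup_dist g (q i) - sup_dist f (q i)) by lra.
  rewrite normrM ger0_norm// mulrDl.
  apply: (@le_trans _ _ (m%:R * sup_dist f g)); last by rewrite lerDl mulr_ge0.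
  by rewrite ler_wpM2l// ler_norml; apply/andP; split; lra.
by apply: (le_trans (HP f g)); rewrite mulrDl lerDr mulr_ge0.
Qed.

(** The sequence enumerates the cones that lie below [F]. If [a < F f], then [F] exceeds
    some [a' > a] on a ball around [f], and a cone of height between [a] and [a'],
    steep enough to be negative outside this ball, lies below [F] and exceeds [a]
    at [f]. *)
Theorem lsc_cones (F : C -> R) : (forall f, 0 <= F f) ->
  (forall f a, a < F f -> exists2 e, 0 < e & forall g, sup_dist f g < e -> a < F g) ->
  exists s : nat -> seq code, [/\ forall n f, cones (s n) f <= F f,
    forall n m f, (n <= m)%N -> cones (s n) f <= cones (s m) f &
    forall f, cones (s n) f @[n --> \oo] --> F f].
Proof.
move=> F0 Flsc.
pose below z := `[< forall f, cone z f <= F f >].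
pose s n := [seq z <- pmap (choice.unpickle : nat -> option code) (iota 0 n) | below z].
have sP n z : z \in s n -> forall f, cone z f <= F f.
  by rewrite mem_filter => /andP[/asboolP].
have smono n m z : (n <= m)%N -> z \in s n -> z \in s m.
  move=> nm; rewrite !mem_filter => /andP[->] /=.
  rewrite !mem_pmap => /mapP[i]; rewrite mem_iota => /andP[_ im] ->.
  by apply: map_f; rewrite mem_iota (leq_trans im).
have sle n f : cones (s n) f <= F f by apply: cones_le => // z /sP.
have sm n m f : (n <= m)%N -> cones (s n) f <= cones (s m) f.
  by move=> nm; apply: cones_le; [exact: cones_ge0|move=> z /(smono _ _ _ nm); exact: cone_le_cones].
exists s; split => // f; apply/cvgrPdist_lt => e e0.
suff [n nP] : exists n, F f - e < cones (s n) f.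
  near=> m; have nm : (n <= m)%N by near: m; exact: nbhs_infty_ge.
  rewrite ger0_norm ?subr_ge0//; have := sm n m f nm; move: nP; lra.
have [Fe|Fe] := ltP (F f - e) 0; first by exists 0%N.
pose a := F f - e; pose a' := F f - e / 2.
have aa' : a < a' by rewrite /a /a'; lra.
have a'F : a' < F f by rewrite /a'; lra.
have [rho rho0 rhoP] := Flsc f a' a'F.
(* a rational height strictly between [a] and [a'] *)
pose k := Num.truncn (2 / e).
have k0 : 0 < k.+1%:R :> R by rewrite ltr0n.
have ke : 1 < e / 2 * k.+1%:R.
  have : 2 / e < k.+1%:R by exact: truncnS_gt.
  by rewrite ltr_pdivrMr// => h; lra.
pose p := (Num.truncn (a * k.+1%:R)).+1.
have a0 : 0 <= a * k.+1%:R by rewrite mulr_ge0.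
have pa : a * k.+1%:R < p%:R by exact: truncnS_gt.
have pa' : p%:R <= a' * k.+1%:R.
  rewrite /p -natr1; have : (Num.truncn (a * k.+1%:R))%:R <= a * k.+1%:R by rewrite truncn_le.
  by move: ke; rewrite /a /a'; lra.
pose al := p%:R / k.+1%:R : R.
have ala : a < al by rewrite ltr_pdivlMr.
have ala' : al <= a' by rewrite ler_pdivrMr.
have al0 : 0 < al by apply: le_lt_trans ala.
(* a slope so large that the cone is supported where [F > a'] *)
pose m := (Num.truncn (2 * al / rho)).+1.
have m0 : 0 < m%:R :> R by rewrite ltr0n.
have mr : 2 * al < m%:R * rho by rewrite -ltr_pdivrMr//; exact: truncnS_gt.
have d0 : 0 < Num.min (rho / 2) ((al - a) / m%:R).
  by rewrite lt_min divr_gt0//= divr_gt0// subr_gt0.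
have [i] := qP f d0; rewrite lt_min => /andP[i1 i2].
pose z : code := (i, m, p, k).
have zb : below z.
  apply/asboolP => g; rewrite /cone/= -/al.
  have [h|h] := leP (al - m%:R * sup_dist g (q i)) 0; first exact: le_trans h _.
  have gi : sup_dist g (q i) < rho / 2.
    by rewrite -(ltr_pM2l m0); move: mr h; lra.
  have fg : sup_dist f g < rho.
    have := sup_dist_lipschitz (q i) f g.
    have := @metric_triangle _ C f (q i) g; rewrite -![mdist _ _]/(sup_dist _ _).
    by rewrite (sup_distC (q i)); lra.
  have := rhoP g fg; have : 0 <= m%:R * sup_dist g (q i).
    by rewrite mulr_ge0// sup_dist_ge0.
  by lra.
exists (choice.pickle z).+1.
apply: (@lt_le_trans _ _ (cone z f)).
  rewrite /cone/= -/al -/a; rewrite ltr_pdivlMr// in i2; lra.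
apply: cone_le_cones; rewrite mem_filter zb andTb mem_pmap -(choice.pickleK z).
by apply: map_f; rewrite mem_iota leq0n ltnSn.
Unshelve. all: by end_near. Qed.

End cones.

(** * Weak convergence of averages *)

Definition avg (R : realType) (n : nat) (g : nat -> R) : R :=
  n%:R^-1 * \sum_(v <- iota 1 n) g v.

Section averages.
Context {R : realType}.

Lemma avg_le n (g g' : nat -> R) : (forall v, g v <= g' v) -> avg n g <= avg n g'.
Proof. by move=> gg; rewrite ler_wpM2l ?invr_ge0//; apply: ler_sum. Qed.

Lemma avgN n (g : nat -> R) : avg n (fun v => - g v) = - avg n g.
Proof. by rewrite /avg sumrN mulrN. Qed.

Lemma avgD n (g g' : nat -> R) : avg n (fun v => g v + g' v) = avg n g + avg n g'.
Proof. by rewrite /avg big_split mulrDr. Qed.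

Lemma avg_cst n (a : R) : (0 < n)%N -> avg n (fun=> a) = a.
Proof.
move=> n0; rewrite /avg big_const_seq count_predT size_iota iter_addr_0.
by rewrite -[a *+ n]mulr_natl mulrA mulVf ?mul1r// pnatr_eq0 -lt0n.
Qed.

End averages.

Section portmanteau.
Context {R : realType} {T : R}.
Notation C := (path_space T).
Variable q : nat -> C.
Hypothesis qP : forall f e, 0 < e -> exists i, sup_dist f (q i) < e.

Lemma cones_bmeas s : exists c, bmeas (cones q s : borel C -> R) c.
Proof.
have [c cP] := cones_bound q s; exists c; split => //.
have [H H0 HP] := cones_lipschitz q s.
by apply: continuous_borel_measurable; exact: (lipschitz_path_continuous H0 HP).
Qed.

Lemma E_increasing d (S : measurableType d) (P : probability S R)
    (g : nat -> S -> R) (F : S -> R) c :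
  (forall n, exists c', bmeas (g n) c') -> bmeas F c -> (forall n x, 0 <= g n x) ->
  (forall n m x, (n <= m)%N -> g n x <= g m x) ->
  (forall x, g n x @[n --> \oo] --> F x) ->
  E P (g n) @[n --> \oo] --> E P F.
Proof.
move=> bg bF g0 gm gF.
have := @cvg_monotone_convergence _ S R P setT measurableT (fun n x => (g n x)%:E).
have -> : (\int[P]_x limn ((fun n => (g n x)%:E)) = \int[P]_x (F x)%:E)%E.
  apply: eq_integral => x _; apply/cvg_lim => //.
  by apply: cvg_EFin; [exact: nearW|exact: gF].
move=> h; rewrite /E /Rintegral; apply: fine_cvg.
rewrite fineK; last exact: integrable_fin_num (bmeas_integrable P bF).
apply: h.
- by move=> n; have [c' [m _]] := bg n; apply/measurable_EFinP.
- by move=> n x _; rewrite lee_fin.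
- by move=> x _ n m nm; rewrite lee_fin; exact: gm.
Qed.

(** Both [f + c] and [c - f] are nonnegative, and each is approximated from below by
    maxima of cones. This bounds the averages of [f] from below and from above. *)
Theorem portmanteau_averages (L : probability (borel C) R) (x : nat -> nat -> C) :
  (forall s, avg n (fun v => cones q s (x n v)) @[n --> \oo] --> E L (cones q s)) ->
  forall (f : C -> R) c, continuous f -> (forall y, `|f y| <= c) ->
    avg n (fun v => f (x n v)) @[n --> \oo] --> E L f.
Proof.
move=> xL.
have low (F : C -> R) c : continuous F -> (forall y, 0 <= F y) ->
    (forall y, `|F y| <= c) -> forall e, 0 < e ->
    \forall n \near \oo, E L F - e < avg n (fun v => F (x n v)).
  move=> cF F0 Fc e e0.
  have Flsc y a : a < F y -> exists2 e, 0 < e & forall g, sup_dist y g < e -> a < F g.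
    move=> aF; have : nbhs y (F @^-1` [set z | a < z]).
      by apply: cF; apply: open_nbhs_nbhs; split => //; exact: open_gt.
    move=> /nbhs_ballP[r /= r0 rP]; by exists r.
  have [s [sF sm sc]] := lsc_cones qP F0 Flsc.
  have bF : bmeas (F : borel C -> R) c.
    by split => //; exact: continuous_borel_measurable.
  have e2 : 0 < e / 2 by rewrite divr_gt0.
  have := @E_increasing _ _ L (fun n => cones q (s n)) F c
    (fun n => cones_bmeas (s n)) bF (fun n => cones_ge0 q (s n)) sm sc.
  move=> /cvgrPdist_lt /(_ _ e2) [k _ /(_ k (leqnn _))] hk.
  have /cvgrPdist_lt /(_ _ e2) := xL (s k); apply: filterS => n hn.
  have h := @avg_le _ n (fun v => cones q (s k) (x n v)) (fun v => F (x n v))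
    (fun v => sF k (x n v)).
  by move: hk hn; rewrite !ltr_norml => /andP[_ +] /andP[_ +]; lra.
move=> f c cf fc.
have bf : bmeas (f : borel C -> R) c.
  by split => //; exact: continuous_borel_measurable.
have f1 y : 0 <= f y + c.
  by have := fc y; rewrite ler_norml => /andP[+ _]; lra.
have f2 y : 0 <= - f y + c.
  by have := fc y; rewrite ler_norml => /andP[_ +]; lra.
have c0 : 0 <= c by exact: le_trans (fc point).
have bc : bmeas (fun _ : borel C => c) c.
  by split => [|y]; [exact: measurable_cst|rewrite ger0_norm].
have bn : bmeas (fun y : borel C => - f y) c.
  split; last by move=> y; rewrite normrN.
  by apply: measurableT_comp => //; exact: bf.1.
apply/cvgrPdist_lt => e e0.
have k1 := low (fun y => f y + c) (c + c) _ f1 _ e e0.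
have k2 := low (fun y => - f y + c) (c + c) _ f2 _ e e0.
have {}k1 : \forall n \near \oo, E L (fun y => f y + c) - e < avg n (fun v => f (x n v) + c).
  apply: k1 => y; first exact: (@cvgD _ R^o _ _ _ _ _ _ _ (cf y) (cvg_cst _)).
  by rewrite (le_trans (ler_normD _ _))// (ger0_norm c0) lerD2r.
have {}k2 : \forall n \near \oo, E L (fun y => - f y + c) - e < avg n (fun v => - f (x n v) + c).
  apply: k2 => y; first exact: (@cvgD _ R^o _ _ _ _ _ _ _ (@cvgN _ R^o _ _ _ _ _ (cf y)) (cvg_cst _)).
  by rewrite (le_trans (ler_normD _ _))// (ger0_norm c0) normrN lerD2r.
rewrite (ED L bf bc) E_cst in k1; rewrite (ED L bn bc) E_cst in k2.
have En : E L (fun y : borel C => - f y) = - E L f.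
  have := EZ L (-1) bf; rewrite mulN1r => <-.
  by congr E; apply/funext => y; rewrite mulN1r.
rewrite En in k2.
near=> n.
have n0 : (0 < n)%N by near: n; exact: nbhs_infty_gt.
have h1 : E L f + c - e < avg n (fun v => f (x n v) + c) by near: n.
have h2 : - E L f + c - e < avg n (fun v => - f (x n v) + c) by near: n.
rewrite avgD avg_cst// in h1; rewrite avgD avgN avg_cst// in h2.
by rewrite ltr_norml; apply/andP; split; lra.
Unshelve. all: by end_near. Qed.

End portmanteau.

(** * Mixtures of laws *)

(** The monadic bind of the Giry monad produces a subprobability measure; its total mass
    is [1] because each [k x] has mass [1]. *)
Theorem mixture d d' (S : measurableType d) (S' : measurableType d') (R : realType)
    (nu : probability S R) (k : S -> probability S' R) :
  (forall A, measurable A -> measurable_fun setT (fun x => k x A)) ->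
  exists2 L : probability S' R,
    forall A, measurable A -> L A = (\int[nu]_x k x A)%E &
    forall f c, bmeas f c -> E L f = E nu (fun x => E (k x) f).
Proof.
move=> mk.
pose g x : giry S' R := k x.
have mg : measurable_fun setT g by apply: measurable_giry_codensity.
pose m : {measure set S' -> \bar R} := giry_bind (nu : giry S R) mg.
have mE (h : S' -> \bar R) : measurable_fun setT h -> (forall x, (0 <= h x)%E) ->
    (\int[m]_y h y = \int[nu]_x \int[k x]_y h y)%E.
  by move=> mh h0; exact: giry_int_bind.
have mA A : measurable A -> m A = (\int[nu]_x k x A)%E.
  move=> mA; have := mE (fun y => (\1_A y)%:E).
  rewrite integral_indic// setIT => ->//.
  - by apply: eq_integral => x _; rewrite integral_indic// setIT.
  - by apply/measurable_EFinP; exact: measurable_indic.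
have mT : m setT = 1%E.
  rewrite mA//.
  have -> : (\int[nu]_x k x setT = \int[nu]_x cst 1%E x)%E.
    by apply: eq_integral => x _; exact: probability_setT.
  by rewrite integral_cst// mul1e; exact: probability_setT.
pose L : probability S' R := HB.pack (Measure.sort m)
  (Measure_isProbability.Build _ _ _ (Measure.sort m) mT).
exists L => // f c bf.
have [mf fc] := bf.
have f0 y : 0 <= f y + `|c|.
  have := fc y; rewrite ler_norml => /andP[+ _].
  by have := ler_norm c; lra.
have bc d1 (S1 : measurableType d1) : bmeas (fun _ : S1 => `|c|) `|c|.
  by split => [|y]; [exact: measurable_cst|rewrite normr_id].
have bf1 : bmeas (fun y => f y + `|c|) (c + `|c|) := bmeasD bf (bc _ S').
have mh : measurable_fun setT (fun y => (f y + `|c|)%:E).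
  by apply/measurable_EFinP; exact: bf1.1.
have h0 y : (0 <= (f y + `|c|)%:E)%E by rewrite lee_fin.
have kE x : ((E (k x) (fun y => f y + `|c|))%:E = \int[k x]_y (f y + `|c|)%:E)%E.
  rewrite /E /Rintegral fineK//.
  exact: integrable_fin_num (bmeas_integrable (k x) bf1).
have Lf : E L (fun y => f y + `|c|) = E nu (fun x => E (k x) (fun y => f y + `|c|)).
  rewrite /E/= /Rintegral (mE _ mh h0); congr fine.
  by apply: eq_integral => x _; rewrite -kE.
have kD x : E (k x) (fun y => f y + `|c|) = E (k x) f + `|c|.
  by rewrite (ED _ bf (bc _ S')) E_cst.
have bk : bmeas (fun x => E (k x) f) c.
  split => [|x]; last exact: E_norm.
  have -> : (fun x => E (k x) f) = (fun x => E (k x) (fun y => f y + `|c|) - `|c|).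
    by apply/funext => x; rewrite kD addrK.
  apply: measurable_funB => //; apply: (measurableT_comp (@fine_measurable R _ measurableT)) => //.
  exact: (measurableT_comp (measurable_giry_int mh h0) mg).
have h1 : E L (fun y => f y + `|c|) = E L f + `|c|.
  by rewrite (ED L bf (bc _ S')) E_cst.
have h2 : E nu (fun x => E (k x) f + `|c|) = E nu (fun x => E (k x) f) + `|c|.
  by rewrite (ED nu bk (bc _ S)) E_cst.
apply: (addIr `|c|); rewrite -h1 -h2 Lf; congr E.
by apply/funext => x; rewrite kD.
Qed.

Section kernels.
Context {R : realType} {T : R}.
Notation C := (path_space T).
Variable q : nat -> C.
Hypothesis qP : forall f e, 0 < e -> exists i, sup_dist f (q i) < e.

(** The indicator of an open set is lower semicontinuous, so that [k x U] is a limit of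
    integrals of maxima of cones. The open sets form a pi-system, and the sets [A] for
    which the claim holds form a Dynkin system. *)
Theorem kernel_measurable d (S : measurableType d) (k : S -> probability (borel C) R) :
  (forall s, measurable_fun setT (fun x => E (k x) (cones q s))) ->
  forall A, measurable A -> measurable_fun setT (fun x => k x A).
Proof.
move=> mk.
apply: (@dynkin_induction _ (borel C) (@open C)) => //.
- by move=> U V oU oV; exact: openI.
- rewrite (_ : (fun x => k x setT) = cst 1%E); first exact: measurable_cst.
  by apply/funext => x; exact: probability_setT.
- move=> U oU /=.
  have mU : measurable (U : set (borel C)) by exact: sub_sigma_algebra.
  have bU : bmeas (\1_U : borel C -> R) 1.
    split; first exact: measurable_indic.
    by move=> y; rewrite indicE; case: (y \in U); rewrite ?normr1// normr0.
  have [s [sF sm sc]] : exists s : nat -> seq code, [/\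
      forall n f, cones q (s n) f <= \1_U f,
      forall n m f, (n <= m)%N -> cones q (s n) f <= cones q (s m) f &
      forall f, cones q (s n) f @[n --> \oo] --> (\1_U f : R)].
    apply: (lsc_cones qP) => [f|f a]; first by rewrite indicE.
    rewrite indicE; have [|] := boolP (f \in U) => fU; rewrite /= => aU.
      have /nbhs_ballP[r /= r0 rP] : nbhs f U.
        by apply: open_nbhs_nbhs; split => //; exact: set_mem.
      by exists r => // g fg; rewrite indicE mem_set//; exact: rP.
    by exists 1 => // g _; apply: (lt_le_trans aU); rewrite indicE.
  have kU x : E (k x) (\1_U : borel C -> R) = fine (k x U).
    by rewrite /E /Rintegral integral_indic// setIT.
  apply: (eq_measurable_fun (fun x => (E (k x) (\1_U : borel C -> R))%:E)).
    by move=> x _; rewrite kU fineK// fin_num_measure.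
  apply/measurable_EFinP.
  apply: (@measurable_fun_cvg _ _ _ _ (fun n x => E (k x) (cones q (s n)))) => // x _.
  apply: (@E_increasing _ _ _ (k x) _ _ 1) => //; first by move=> n; exact: cones_bmeas.
  by move=> n y; exact: cones_ge0.
- move=> A mA kA /=.
  rewrite (_ : (fun x => k x (~` A)) = (fun x => 1 - k x A)%E).
    by apply: emeasurable_funB => //; exact: measurable_cst.
  by apply/funext => x; exact: probability_setC.
- move=> F mF tF kF /=.
  apply: (emeasurable_fun_cvg (fun n x => \sum_(0 <= i < n) k x (F i))%E).
    by move=> n; apply: emeasurable_sum.
  by move=> x _; exact: measure_sigma_additive.
Qed.

End kernels.

(** * Integrals against empirical measures *)

Section empirical_integral.
Context {R : realType} {X : ptopologicalType}.

Lemma perm_brack n : perm_eq (fset_set (brack n)) (iota 1 n).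
Proof.
apply: uniq_perm; [exact: fset_uniq|exact: iota_uniq|move=> v].
rewrite (in_fset_set (brack_finite n)) mem_iota add1n ltnS.
by apply/idP/idP => [/set_mem//|h]; exact: mem_set.
Qed.

(** The empirical measure is a multiple of a finite sum of Dirac measures. For [n = 0]
    both sides vanish. *)
Lemma ge0_integral_empirical n (x : nat -> X) (g : borel X -> \bar R) :
  measurable_fun setT g -> (forall y, 0 <= g y)%E ->
  (\int[empirical R (brack n) x]_y g y =
    n%:R^-1%:E * \sum_(v <- iota 1 n) g (x v))%E.
Proof.
move=> mg g0.
pose s : seq nat := fset_set (brack n).
have sn : #|` fset_set (brack n) | = n by rewrite (perm_size (perm_brack n)) size_iota.
have c0 : 0 <= n%:R^-1 :> R by rewrite invr_ge0.
pose c := NngNum c0.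
transitivity (\int[mscale c (msum (fun i => \d_(x (nth 0%N s i) : borel X)) (size s))]_y g y)%E.
  apply: eq_measure_integral => A mA _; rewrite -[LHS]/((#|` fset_set (brack n) |%:R^-1)%:E *
    \sum_(v <- fset_set (brack n)) \d_(x v : borel X) A)%E.
  by rewrite /mscale /msum/= sn (big_nth 0%N) big_mkord sn.
rewrite ge0_integral_mscale//= ge0_integral_measure_sum//=.
congr (_ * _)%E; rewrite -(perm_big _ (perm_brack n))/= (big_nth 0%N) big_mkord.
by apply: eq_bigr => i _; rewrite integral_dirac// diracT mul1e.
Qed.

Lemma integral_empirical n (x : nat -> X) (f : borel X -> R) :
  measurable_fun setT f ->
  (\int[empirical R (brack n) x]_y (f y)%:E = (avg n (fun v => f (x v)))%:E)%E.
Proof.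
move=> mf; have mE : measurable_fun setT (EFin \o f) by exact/measurable_EFinP.
rewrite integralE !ge0_integral_empirical//; last 2 first.
- exact: measurable_funeneg.
- exact: measurable_funepos.
under eq_bigr do rewrite funeposE -EFin_max.
under [in X in (_ - X)%E]eq_bigr do rewrite funenegE -EFinN -EFin_max.
rewrite !sumEFin -!EFinM -EFinB /avg -mulrBr -sumrB; congr (_ * _)%:E.
apply: eq_bigr => v _; rewrite /Num.max oppr_lt0.
by case: (ltgtP (f (x v)) 0) => [h|h|->]; rewrite ?sub0r ?opprK ?oppr0 ?subr0 ?addr0.
Qed.

End empirical_integral.

(** * The diffusion as an image of the noise *)

Lemma filtration_measurable d (Om : measurableType d) (R : realType)
    (P : probability Om R) B t A : iid_brownian P B ->
  brownian_filtration P B t A -> measurable A.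
Proof.
move=> BB; apply: smallest_sub; first exact: sigma_algebra_measurable.
move=> D [[v [s [/andP[s0 _] [E mE <-]]]]|[mD _]] //.
exact: (B_measurable BB).
Qed.

Section strong_solutions.
Context {R : realType}.
Variables (phi : R * R * R * R -> R) (psi : R * R -> R) (T L M : R).
Hypothesis L0 : 0 < L.
Hypothesis phiL : forall p q, `|phi p - phi q| <= L * `|p - q|.
Hypothesis psiL : forall p q, `|psi p - psi q| <= L * `|p - q|.
Hypothesis phiM : forall p, `|phi p| <= M.
Hypothesis T0 : 0 < T.
Notation C := (path_space T).
Context {d} {Om : measurableType d} (P : probability Om R).
Variable B : nat -> R -> Om -> R.
Hypothesis BB : iid_brownian P B.
Variable Z : set Om.
Hypothesis mZ : measurable Z.
Hypothesis PZ : P Z = 0%E.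
Hypothesis ZP : forall w, ~ Z w -> forall v, B v 0 w = 0 /\
    {within `[0, +oo[, continuous (B v ^~ w)}.
Implicit Types N : network R.

Let b (w : Om) : nat -> C := noise B Z w.

(** Adaptedness holds since the flow up to time [t] is a measurable function of the
    noise up to time [t]. *)
Lemma flow_strong_solution N :
  strong_solution P phi psi B N (fun v w => flow phi psi N (b w) v).
Proof.
split=> v.
  move=> t _ tT A [D mD <-].
  have tT' : 0 <= t <= T by move: tT; rewrite in_itv.
  pose G := [set A | (exists v s, 0 <= s <= t /\ sigma_var (B v s) A) \/
               (measurable A /\ P A = 0%E)].
  have mf := @flow_measurable R phi psi T L M L0 phiL psiL phiM T0 _
    (g_sigma_algebraType G) b t tT' _ N v.
  apply: mf => // u s st _ E mE; rewrite setTI.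
  by apply: (noise_adapted mZ PZ ZP u st _ mE); case/andP: tT'.
move=> _; exists Z; split => // w /= h; apply: contrapT => Zw; apply: h => t tT.
have tT' : 0 <= t <= T by move: tT; rewrite in_itv.
by rewrite (flowP L0 phiL psiL phiM T0 N (b w) v tT') (noiseE ZP)// asboolF.
Qed.

Lemma diffusion_strong_solution N :
  strong_solution P phi psi B N (diffusion P phi psi T B N).
Proof.
apply: (@getPex _ [set x | strong_solution P phi psi B N x]).
by exists (fun v w => flow phi psi N (b w) v); exact: flow_strong_solution.
Qed.

Lemma diffusion_measurable N v : vset N v ->
  measurable_fun setT (diffusion P phi psi T B N v : Om -> borel C).
Proof.
move=> Nv; apply: borel_path_measurable => // s sT.
have [ad _] := diffusion_strong_solution N.
have sT' : s \in `[0, T] by rewrite in_itv.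
move=> _ A mA; apply: (filtration_measurable BB (t := s)).
by apply: (ad v s Nv sT'); exists A.
Qed.

Lemma gball_sub_vset N v r : vset N v -> gball N v r `<=` vset N.
Proof.
move=> Nv u [p [pp <- _]]; elim/last_ind: p pp => [//|p w _].
by rewrite rcons_path last_rcons => /andP[_]; rewrite adj_sym => /adj_vset.
Qed.

(** A strong solution satisfies the equation almost surely at each vertex, hence at all
    of the countably many vertices at once; then the uniqueness of the flow
    applies outcome by outcome. *)
Theorem diffusion_flow N : {ae P, forall w, forall v, vset N v ->
  diffusion P phi psi T B N v w = flow phi psi N (b w) v}.
Proof.
have [_ eqn] := diffusion_strong_solution N.
have nZ : {ae P, forall w, ~ Z w}.
  by exists Z; split => // w /= /contrapT.
have /ae_foralln aeqn : forall v, {ae P, forall w, vset N v ->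
    forall t, t \in `[0, T] ->
     path_at (diffusion P phi psi T B N v w) t = init N v +
       (\int[lebesgue_measure]_(s in `[0, t])
          drift phi psi N (fun u => path_at (diffusion P phi psi T B N u w) s) v) +
       B v t w}.
  move=> v; have [Nv|Nv] := pselect (vset N v).
    by apply: filterS (eqn v Nv) => w h _.
  by apply: filterS nZ => w _ /Nv.
apply: filterS2 nZ aeqn => w Zw h v Nv.
apply: (flow_unique L0 phiL psiL phiM T0 (x := fun u => diffusion P phi psi T B N u w)).
move=> r u Bu t tT; have Nu := gball_sub_vset Nv Bu.
by rewrite (noiseE ZP)// asboolF// h ?in_itv.
Qed.

Lemma root_flow_measurable (x : network R) v :
  measurable_fun setT ((fun w => flow phi psi x (b w) v) : Om -> borel C).
Proof.
apply: (flow_borel_measurable L0 phiL psiL phiM T0) => u s sT.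
exact: (noise_measurable BB mZ ZP).
Qed.

Definition flow_law (X : Nstar R) : probability (borel C) R :=
  law P (root_flow_measurable (repr X) (Defs.root (repr X))).

Lemma root_law_flow (X : Nstar R) A : measurable A ->
  root_law P phi psi B X A = flow_law X A.
Proof.
move=> mA; have [Z' [mZ' PZ' ZP']] := diffusion_flow (repr X).
have rv : vset (repr X) (Defs.root (repr X)) by exact: root_vset.
apply: (prob_eq_off mZ' PZ').
- by have := diffusion_measurable rv measurableT mA; rewrite setTI.
- by have := root_flow_measurable (repr X) (Defs.root (repr X)) measurableT mA; rewrite setTI.
move=> w Zw; rewrite /= -(_ : diffusion P phi psi T B (repr X) (Defs.root (repr X)) w =
  flow phi psi (repr X) (b w) (Defs.root (repr X)))//.
by apply: contrapT => h; apply: Zw; apply: ZP' => /= /(_ _ rv).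
Qed.

Lemma E_flow_law (h : C -> R) c X : continuous h -> (forall f, `|h f| <= c) ->
  E (flow_law X) h = class_obs phi psi P b h X.
Proof.
move=> ch hc; have mh : measurable_fun setT (h : borel C -> R).
  exact: continuous_borel_measurable.
rewrite /E /Rintegral integral_distribution//; first exact/measurable_EFinP.
apply: (@bmeas_integrable _ _ _ P _ c); split => [|w]; last exact: hc.
by apply: (measurableT_comp mh); exact: root_flow_measurable.
Qed.

End strong_solutions.

(** * Convergence of the empirical measures *)

Lemma common_constants (R : realType) (phi : R * R * R * R -> R) (psi : R * R -> R) :
  lipschitz psi -> bounded_fun phi -> lipschitz phi ->
  exists L M : R, [/\ 0 < L, forall p q, `|phi p - phi q| <= L * `|p - q|,
    forall p q, `|psi p - psi q| <= L * `|p - q| & forall p, `|phi p| <= M].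
Proof.
move=> psiL phiM phiL.
have /pinfty_ex_gt0[L1 L10 h1] := psiL.
have /pinfty_ex_gt0[L2 L20 h2] := phiL.
have /pinfty_ex_gt0[M M0 h3] := phiM.
exists (L1 + L2), M; split => [|p q|p q|p]; first exact: addr_gt0.
- apply: (le_trans (h2 (p, q) (conj I I))).
  by rewrite ler_wpM2r// lerDr ltW.
- apply: (le_trans (h1 (p, q) (conj I I))).
  by rewrite ler_wpM2r// lerDl ltW.
- exact: h3.
Qed.

Section limit.
Context {R : realType}.
Variables (phi : R * R * R * R -> R) (psi : R * R -> R) (T L M : R).
Hypothesis L0 : 0 < L.
Hypothesis phiL : forall p q, `|phi p - phi q| <= L * `|p - q|.
Hypothesis psiL : forall p q, `|psi p - psi q| <= L * `|p - q|.
Hypothesis phiM : forall p, `|phi p| <= M.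
Hypothesis T0 : 0 < T.
Notation C := (path_space T).
Context {d} {Om : measurableType d} (P : probability Om R).
Variable X : Om -> nat -> borel C.
Hypothesis mX : forall i, measurable_fun setT (fun w => X w i).
Hypothesis pX : prod_rule P X.
Hypothesis Xex : forall s : nat -> nat, injective s ->
  forall A : set (seqm (borel C)), measurable A ->
    P [set w | A (X w)] = P [set w | A (fun v => X w (s v))].
Variables (N : nat -> network R) (nu : probability (borel (Nstar R)) R).
Hypothesis VN : forall n, vset (N n) = brack n.
Hypothesis N_degree : exists2 eps : nat -> R, eps n @[n --> \oo] --> (0 : R) &
  \forall n \near \oo, (max_degree (N n))%:R = n%:R `^ eps n.
Hypothesis N_cvg : weak_cvg (fun n => root_measure (N n)) nu.
Variables (h : C -> R) (c H : R).
Hypothesis hc : forall f, `|h f| <= c.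
Hypothesis H0 : 0 <= H.
Hypothesis hH : forall f g, `|h f - h g| <= H * sup_dist f g.

Let clo := class_obs phi psi P X h.

Let clo_continuous : continuous clo.
Proof. exact: (class_obs_continuous L0 phiL psiL phiM T0 mX Xex hc H0 hH). Qed.

Let clo_bmeas : bmeas (clo : borel (Nstar R) -> R) c.
Proof.
split; first exact: continuous_borel_measurable.
by move=> A; exact: (class_obs_bound L0 phiL psiL phiM T0 P mX hc H0 hH).
Qed.

(** The average of the expected observables is the integral of [clo], a bounded
    continuous function, against [root_measure (N n)]. *)
Lemma mean_obs_cvg :
  avg n (fun v => E P (obs phi psi h X N n v)) @[n --> \oo] --> E nu clo.
Proof.
have bf : bounded_fun clo.
  by exists c; split; [exact: num_real|move=> x cx A _; apply: le_trans (clo_bmeas.2 A) (ltW cx)].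
have := N_cvg clo_continuous bf.
have -> : (\int[nu]_A (clo A)%:E = (E nu clo)%:E)%E.
  rewrite /E /Rintegral fineK//.
  exact: integrable_fin_num (bmeas_integrable nu clo_bmeas).
have -> : (fun n => avg n (fun v => E P (obs phi psi h X N n v))) =
    (fun n => fine (\int[root_measure (N n)]_A (clo A)%:E)%E).
  apply/funext => n; symmetry.
  rewrite /root_measure VN integral_empirical//=; last exact: clo_bmeas.1.
  rewrite /avg; congr (_ * _); apply: eq_bigr => v _.
  exact: (class_obs_component L0 phiL psiL phiM T0 mX Xex hc H0 hH).
by move=> /fine_cvg.
Qed.

Lemma obs_cvg : {ae P, forall w,
  avg n (fun v => obs phi psi h X N n v w) @[n --> \oo] --> E nu clo}.
Proof.
have := lln L0 phiL psiL phiM T0 hc H0 hH mX pX VN N_degree.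
apply: filterS => w hw.
have := @cvgD _ R^o _ _ _ _ _ _ _ hw mean_obs_cvg; rewrite add0r.
have -> : (fun n => avg n (fun v => obs phi psi h X N n v w)) =
  (fun n => centred P (obs phi psi h X N) n w) \+
  (fun n => avg n (fun v => E P (obs phi psi h X N n v))).
  by apply/funext => n /=; rewrite /centred -/(avg n _) avgD avgN subrK.
exact.
Qed.

End limit.

Theorem corollary1 (R : realType) (psi : R * R -> R) (phi : R * R * R * R -> R)
    (T : R) (d : measure_display) (Omega : measurableType d)
    (P : probability Omega R) (B : nat -> R -> Omega -> R)
    (N : nat -> network R) (nu : probability (borel (Nstar R)) R)
    (psi_lip : lipschitz psi)
    (phi_bnd : bounded_fun phi) (phi_lip : lipschitz phi)
    (T_gt0 : 0 < T)
    (B_brownian : iid_brownian P B)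
    (N_vset : forall n, vset (N n) = brack n)
    (N_cvg : weak_cvg (fun n => root_measure (N n)) nu)
    (nu_nice : nu (nice_classes R) = 1%E)
    (N_degree : exists2 eps : nat -> R, eps n @[n --> \oo] --> 0 &
       \forall n \near \oo, (max_degree (N n))%:R = n%:R `^ eps n) :
  exists2 L : probability (borel (path_space T)) R,
    forall A, measurable A ->
      L A = (\int[nu]_(X in nice_classes R) root_law P phi psi B X A)%E &
    {ae P, forall w,
       weak_cvg (fun n => empirical R (brack n)
                   (fun v => diffusion P phi psi T B (N n) v w)) L}.
Proof.
have [L [M [L0 phiL psiL phiM]]] := common_constants psi_lip phi_bnd phi_lip.
have [Z [mZ PZ ZP]] := brownian_regular_off_null B_brownian.
have [q qP] := path_separable T_gt0.
pose X w : nat -> path_space T := noise B Z w.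
have mX i : measurable_fun setT (fun w => X w i : borel (path_space T)).
  exact: (noise_borel T_gt0 B_brownian mZ ZP).
have pX : prod_rule P (X : Omega -> nat -> borel (path_space T)).
  exact: (@noise_prod_rule _ _ _ _ _ _ T_gt0 B_brownian _ mZ PZ ZP id (fun _ _ => id)).
have Xex := noise_exchangeable T_gt0 B_brownian mZ PZ ZP.
(* the law at the root, as a kernel *)
pose k : borel (Nstar R) -> probability (borel (path_space T)) R :=
  flow_law L0 phiL psiL phiM T_gt0 B_brownian mZ ZP.
have kE s : (fun A => E (k A) (cones q s)) = class_obs phi psi P X (cones q s).
  apply/funext => A; have [H H0 HP] := cones_lipschitz q s.
  have [c cP] := cones_bound q s.
  exact: (E_flow_law L0 phiL psiL phiM T_gt0 B_brownian mZ ZP A (lipschitz_path_continuous H0 HP) cP).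
have mk : forall A, measurable A -> measurable_fun setT (fun x => k x A).
  apply: (@kernel_measurable _ _ q qP _ (borel (Nstar R)) k) => s; rewrite kE.
  have [H H0 HP] := cones_lipschitz q s; have [c cP] := cones_bound q s.
  apply: continuous_borel_measurable.
  exact: (class_obs_continuous L0 phiL psiL phiM T_gt0 mX Xex cP H0 HP).
have [LL LLA LLE] := mixture nu mk.
exists LL => [A mA|].
  (* the mixture is over all networks, but almost all of them are nice *)
  have nice0 : nu (~` nice_classes R) = 0%E.
    have := probability_setC nu (@nice_classes_measurable R).
    by rewrite nu_nice subee.
  rewrite LLA// (ge0_negligible_integral _ _ (mk A mA) _ nice0)//; last first.
    by apply: measurableC; exact: nice_classes_measurable.
  rewrite setTD setCK; apply: eq_integral => Y _; symmetry.
  exact: (root_law_flow L0 phiL psiL phiM T_gt0 B_brownian mZ PZ ZP).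
have obsP s : {ae P, forall w,
    avg n (fun v => cones q s (flow phi psi (N n) (X w) v)) @[n --> \oo] -->
    E LL (cones q s)}.
  have [H H0 HP] := cones_lipschitz q s; have [c cP] := cones_bound q s.
  have -> : E LL (cones q s) = E nu (class_obs phi psi P X (cones q s)).
    have [c' bc'] := cones_bmeas q s; by rewrite (LLE _ _ bc') kE.
  exact: (obs_cvg L0 phiL psiL phiM T_gt0 mX pX Xex N_vset N_degree N_cvg cP H0 HP).
(* a single null event for the countably many maxima of cones *)
have obsPP : {ae P, forall w, forall s,
    avg n (fun v => cones q s (flow phi psi (N n) (X w) v)) @[n --> \oo] -->
    E LL (cones q s)}.
  have := ae_foralln (fun i => obsP (odflt [::] (choice.unpickle i))).
  apply: filterS => w hw s; have := hw (choice.pickle s).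
  by rewrite choice.pickleK.
have diffP := ae_foralln (fun n =>
  diffusion_flow L0 phiL psiL phiM T_gt0 mZ PZ ZP (N n)).
apply: filterS2 obsPP diffP => w hw dw f cf [r [_ fr]].
have fc y : `|f y| <= r + 1 by apply: fr => //; rewrite ltrDl.
have mf : measurable_fun setT (f : borel (path_space T) -> R).
  exact: continuous_borel_measurable.
have bf : bmeas (f : borel (path_space T) -> R) (r + 1) by split.
have -> : (\int[LL]_x (f x)%:E = (E LL f)%:E)%E.
  rewrite /E /Rintegral fineK//; exact: integrable_fin_num (bmeas_integrable LL bf).
under eq_fun do rewrite integral_empirical//.
apply: cvg_EFin; first exact: nearW.
have := portmanteau_averages qP hw cf fc.
have -> : (fun n => avg n (fun v => f (flow phi psi (N n) (X w) v))) =
   fine \o (fun n => (avg n (fun v => f (diffusion P phi psi T B (N n) v w)))%:E).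
  apply/funext => n /=; rewrite /avg; congr (_ * _).
  apply: eq_big_seq => v; rewrite mem_iota add1n ltnS => vn.
  by rewrite dw// N_vset.
exact.
Qed.
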